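(* Let $G$ be a connected reductive real Lie group and $S\subset G$ a non-empty $G$-dominated compact set. For every $\varepsilon>0$ there is $\delta>0$ such that for every non-empty compact set $S'\subset G$, if $d(S,S')<\delta$, then $d(J(S),J(S'))<\varepsilon$.
   Context: A connected reductive real Lie group $G$ is the identity component (for the Lie group topology) of the group of real points of a reductive linear algebraic group defined over $\mathbb{R}$. Fix a maximal $\mathbb{R}$-split torus $A$ of $G$ (a closed connected subgroup isomorphic to $(\mathbb{R}_+^* )^d$) with Lie algebra $\mathfrak{a}$, a maximal compact subgroup $K$ whose Lie algebra is orthogonal to $\mathfrak{a}$ for the Killing form, so that $G=KAK$, and a system of positive roots of $\mathfrak{a}$ in $\mathrm{Lie}(G)$. The closed Weyl chamber $\mathfrak{a}^+$ (resp. open Weyl chamber $\mathfrak{a}^{++}$) is the set of $x\in\mathfrak{a}$ with $\alpha(x)\geq 0$ (resp. $\alpha(x)>0$) for every positive root $\alpha$. The Cartan projection $\kappa:G\to\mathfrak{a}^+$ sends $g$ to the unique $\kappa(g)\in\mathfrak{a}^+$ with $g\in K\exp(\kappa(g))K$. For $n\geq1$, $S^n:=\{g_1\cdots g_n : g_i\in S\}$. A compact subset $S\subset G$ is called $G$-dominated if there is a compact subset $C$ of $\mathfrak{a}^{++}$ such that $\frac1n\kappa(S^n)\subset C$ for all large enough $n$. The joint spectrum $J(S)$ is the limit, in the Hausdorff metric on non-empty compact subsets of $\mathfrak{a}$, of $\frac1n\kappa(S^n)$ as $n\to+\infty$; it exists whenever $S$ is $G$-dominated, and for $S'$ the existence of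 $J(S')$ (for $d(S,S')<\delta$) is part of the assertion. The letter $d(\cdot,\cdot)$ denotes the Hausdorff distance on non-empty compact subsets of $G$ (with respect to a fixed metric on $G$ inducing its topology) and of $\mathfrak{a}$ (with respect to a fixed norm) respectively. *)

(* Defs.v *)
From HB Require Import structures.
From mathcomp Require Import all_boot all_order all_algebra.
From mathcomp Require complex mpoly.
From mathcomp Require Import all_classical all_reals all_analysis.

Set Implicit Arguments.
Unset Strict Implicit.
Unset Printing Implicit Defensive.

Import Order.TTheory GRing.Theory Num.Theory.
Import numFieldNormedType.Exports.
Import complex.

Local Open Scope classical_set_scope.
Local Open Scope ring_scope.

(* A linear algebraic group is represented by its complex points, a Zariski
   closed subgroup of GL_n(C); every linear algebraic group defined over R is
   R-isomorphic to one of this form with n >= 1. *)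

Section AlgebraicGroups.
Variable R : realType.
Local Notation C := (complex R).

Definition subgroup_GL (n : nat) (H : set 'M[C]_n) : Prop :=
  [/\ H `<=` [set g | g \in unitmx],
      H 1%:M,
      forall g h, H g -> H h -> H (g *m h) &
      forall g, H g -> H (invmx g)].

Definition poly_at (n : nat) (p : mpoly.mpoly (n * n) C) (g : 'M[C]_n) : C :=
  mpoly.meval (fun k => mxvec g 0 k) p.

Definition real_poly (n : nat) (p : mpoly.mpoly (n * n) C) : Prop :=
  exists q : mpoly.mpoly (n * n) R,
    p = mpoly.map_mpoly (real_complex R) q.

Definition zero_locus (n : nat) (I : set (mpoly.mpoly (n * n) C)) :
    set 'M[C]_n :=
  [set g | g \in unitmx /\ forall p, I p -> poly_at p g = 0].

Definition zariski_closed (n : nat) (X : set 'M[C]_n) : Prop :=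
  exists I, X = zero_locus I.

(* Over a perfect field such as R, being the zero locus of polynomials with
   coefficients in the field is the same as being defined over the field. *)
Definition closed_over_R (n : nat) (X : set 'M[C]_n) : Prop :=
  exists2 I, I `<=` @real_poly n & X = zero_locus I.

Definition zariski_connected (n : nat) (X : set 'M[C]_n) : Prop :=
  forall Y Z, zariski_closed Y -> zariski_closed Z ->
    X = Y `|` Z -> Y `&` Z = set0 -> Y = set0 \/ Z = set0.

Definition algebraic_group_over_R (n : nat) (GG : set 'M[C]_n) : Prop :=
  subgroup_GL GG /\ closed_over_R GG.

Definition unipotent (n : nat) (g : 'M[C]_n.+1) : Prop :=
  exists k, (g - 1) ^+ k = 0.

(* The unipotent radical, the largest connected normal unipotent closed
   subgroup, is trivial. *)
Definition reductive (n : nat) (GG : set 'M[C]_n.+1) : Prop :=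
  forall U : set 'M[C]_n.+1,
    subgroup_GL U -> zariski_closed U -> zariski_connected U ->
    U `<=` GG ->
    (forall g u, GG g -> U u -> U (g *m u *m invmx g)) ->
    U `<=` @unipotent n ->
    U = [set 1%:M].

Definition reductive_group_over_R (n : nat) (GG : set 'M[C]_n.+1) : Prop :=
  algebraic_group_over_R GG /\ reductive GG.

(* The entries of [f] lie in the coordinate ring R[x_ij, 1 / det] of [X]. *)
Definition regular_over_R (n m : nat) (X : set 'M[C]_n)
    (f : 'M[C]_n -> 'M[C]_m) : Prop :=
  forall i j, exists (p : mpoly.mpoly (n * n) C) (k : nat),
    real_poly p /\ forall g, X g -> f g i j = poly_at p g / \det g ^+ k.

Definition isomorphic_over_R (n m : nat) (X : set 'M[C]_n) (Y : set 'M[C]_m) :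
    Prop :=
  exists (f : 'M[C]_n -> 'M[C]_m) (f' : 'M[C]_m -> 'M[C]_n),
    [/\ regular_over_R X f /\ regular_over_R Y f',
        (forall g, X g -> Y (f g)) /\ (forall h, Y h -> X (f' h)),
        (forall g, X g -> f' (f g) = g) /\ (forall h, Y h -> f (f' h) = h) &
        forall g h, X g -> X h -> f (g *m h) = f g *m f h].

(* The [d]-th power of the multiplicative group, embedded in GL_d. *)
Definition diagonal_torus (d : nat) : set 'M[C]_d :=
  [set g | g \in unitmx /\ is_diag_mx g].

Definition split_torus (n : nat) (T : set 'M[C]_n) : Prop :=
  algebraic_group_over_R T /\ exists d, isomorphic_over_R T (@diagonal_torus d).

Definition maximal_split_torus (n : nat) (GG T : set 'M[C]_n) : Prop :=
  [/\ split_torus T, T `<=` GG &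
      forall T', split_torus T' -> T' `<=` GG -> T `<=` T' -> T' = T].

Definition real_points (n : nat) (X : set 'M[C]_n) : set 'M[R]_n :=
  [set g | X (map_mx (real_complex R) g)].

(* The real points are closed in GL_n(R), so their Lie group topology is the
   one induced by the matrix space; this is their identity component. *)
Definition real_component (n : nat) (X : set 'M[C]_n.+1) : set 'M[R]_n.+1 :=
  connected_component (real_points X) 1%:M.

End AlgebraicGroups.

Section LieTheory.
Variables (R : realType) (n : nat).
Local Notation M := 'M[R]_n.+1.

Definition expmx (X : M) : M :=
  limn (series (fun k : nat => k`!%:R^-1 *: X ^+ k)).

Definition lie_algebra (H : set M) : set M :=
  [set X | forall t : R, H (expmx (t *: X))].

Definition is_lie_algebra (H : set M) (h : {vspace M}) : Prop :=
  forall X, X \in h <-> lie_algebra H X.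

Definition bracket (X Y : M) : M := X * Y - Y * X.

(* Trace of [ad X \o ad Y] on [g], computed in the basis [vbasis g]. *)
Definition killing_form (g : {vspace M}) (X Y : M) : R :=
  \sum_(i < \dim g)
    coord (vbasis g) i (bracket X (bracket Y (vbasis g)`_i)).

Definition compact_subgroup (G K : set M) : Prop :=
  [/\ compact K, K `<=` G, K 1%:M,
      forall x y, K x -> K y -> K (x *m y) &
      forall x, K x -> K (invmx x)].

Definition maximal_compact_subgroup (G K : set M) : Prop :=
  compact_subgroup G K /\
  forall K', compact_subgroup G K' -> K `<=` K' -> K' = K.

Definition killing_orthogonal (g : {vspace M}) (K : set M) (a : {vspace M}) :
    Prop :=
  forall X Y, lie_algebra K X -> Y \in a -> killing_form g X Y = 0.

Definition dual (a : {vspace M}) := 'Hom(subvs_of a, R^o).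

Definition is_root (g a : {vspace M}) (alpha : dual a) : Prop :=
  alpha != 0 /\
  exists X : M, [/\ X \in g, X != 0 &
    forall H : subvs_of a, bracket (vsval H) X = (alpha H : R) *: X].

Definition positive_system (g a : {vspace M}) (P : set (dual a)) : Prop :=
  [/\ P `<=` @is_root g a,
      forall alpha, @is_root g a alpha -> P alpha \/ P (- alpha),
      forall alpha, P alpha -> ~ P (- alpha) &
      forall alpha beta, P alpha -> P beta -> @is_root g a (alpha + beta) ->
        P (alpha + beta)].

Definition closed_chamber (a : {vspace M}) (P : set (dual a)) : set M :=
  [set x | x \in a /\ forall alpha, P alpha -> 0 <= (alpha (vsproj a x) : R)].

Definition open_chamber (a : {vspace M}) (P : set (dual a)) : set M :=
  [set x | x \in a /\ forall alpha, P alpha -> 0 < (alpha (vsproj a x) : R)].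

Definition in_KexpK (K : set M) (g x : M) : Prop :=
  exists k l, [/\ K k, K l & g = k *m expmx x *m l].

(* The values of [kappa] outside [G] are irrelevant. *)
Definition cartan_projection (G K : set M) (a : {vspace M})
    (P : set (dual a)) (kappa : M -> M) : Prop :=
  forall g, G g ->
    [/\ closed_chamber P (kappa g), in_KexpK K g (kappa g) &
        forall x, closed_chamber P x -> in_KexpK K g x -> x = kappa g].

Definition is_metric_on (G : set M) (d : M -> M -> R) : Prop :=
  [/\ forall x y, G x -> G y -> 0 <= d x y,
      forall x y, G x -> G y -> (d x y = 0 <-> x = y),
      forall x y, G x -> G y -> d x y = d y x &
      forall x y z, G x -> G y -> G z -> d x z <= d x y + d y z].

Definition induces_topology_on (G : set M) (d : M -> M -> R) : Prop :=
  forall x, G x -> forall U : set M,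
    within G (nbhs x) U <->
    exists2 e : R, 0 < e & forall y, G y -> d x y < e -> U y.

Definition is_norm_on (a : {vspace M}) (N : M -> R) : Prop :=
  [/\ forall x, x \in a -> 0 <= N x,
      forall x, x \in a -> N x = 0 -> x = 0,
      forall (c : R) x, x \in a -> N (c *: x) = `|c| * N x &
      forall x y, x \in a -> y \in a -> N (x + y) <= N x + N y].

(* Extended-real valued, so that no convention is needed for the supremum of
   an unbounded set; finite when [A] and [B] are compact and non-empty. *)
Definition hausdorff_dist (d : M -> M -> R) (A B : set M) : \bar R :=
  maxe (ereal_sup [set ereal_inf [set (d x y)%:E | y in B] | x in A])
       (ereal_sup [set ereal_inf [set (d x y)%:E | x in A] | y in B]).

Definition norm_dist (N : M -> R) (x y : M) : R := N (x - y).

Fixpoint set_pow (S : set M) (k : nat) : set M :=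
  if k is k'.+1 then [set g *m h | g in set_pow S k' & h in S]
  else [set 1%:M].

Definition scaled_cartan (kappa : M -> M) (S : set M) (k : nat) : set M :=
  [set (k%:R : R)^-1 *: kappa g | g in set_pow S k].

Definition dominated (a : {vspace M}) (P : set (dual a)) (kappa : M -> M)
    (S : set M) : Prop :=
  exists C : set M, [/\ compact C, C `<=` open_chamber P &
    \forall k \near \oo, scaled_cartan kappa S k `<=` C].

Definition is_joint_spectrum (a : {vspace M}) (kappa : M -> M) (N : M -> R)
    (S J : set M) : Prop :=
  [/\ compact J, J !=set0, J `<=` [set x | x \in a] &
    hausdorff_dist (norm_dist N) (scaled_cartan kappa S k) J @[k --> \oo]
      --> (0 : \bar R)%E].

End LieTheory.

(* Main.v *)
Require Import Defs.
From HB Require Import structures.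
From mathcomp Require Import all_boot all_order all_algebra.
From mathcomp Require complex mpoly.
From mathcomp Require Import all_classical all_reals all_analysis.
From mathcomp Require Import perm zify ring lra.
Import numFieldNormedType.Exports.

Set Implicit Arguments.
Unset Strict Implicit.
Unset Printing Implicit Defensive.

Import Order.TTheory GRing.Theory Num.Theory.

Local Open Scope classical_set_scope.
Local Open Scope ring_scope.

(** The joint spectrum depends continuously on a dominated set because the
    Cartan projection is almost additive along words in its letters, with a
    bound on the error that also holds for all nearby sets.

    The Cartan projection of a group element is read off from the norms of its
    images in finitely many representations. The weights of the torus, in a
    basis where it is diagonal ([split_torus_diag]), are ordered by their values
    at a point of the open chamber; for every set of weights that is stable
    under raising operators, the corresponding exterior product generates a
    representation whose top weight has multiplicity one
    ([highest_weight_module]). It is generated first by the Lie algebra, then it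
    is stable under the group because a closed subgroup containing all
    exponentials is the whole connected group ([closed_subgroup_exp]). In this
    representation the norm of an element is, up to a constant, the exponential
    of the top weight of its Cartan projection, and the element is exponentially
    close to rank one when its Cartan projection is far from the walls
    ([norm_highest_weight]). Every weight is proportional to a difference of two
    such top weights ([lam_top_weights]).

    The analytic core is [near_multiplicativity]: if all the subwords of a word
    in bounded letters are exponentially close, in terms of their length, to
    matrices of rank one, then the norm of the word is at least a fixed
    proportion of the product of the norms of its two parts. Hence the Cartan
    projection is almost additive along words whose subwords stay linearly far
    from the walls ([kappa_near_additive]).

    Domination provides this linear distance for words in [S]. It persists for
    every set close to [S], with uniform constants ([nearby_gap]): words of a
    fixed length [n1] are compared with words in [S], and longer words are split
    into a block of length [n1] and a shorter word. Almost additivity loses a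
    constant at each splitting, and [n1] is chosen so large that the larger
    linear gain of [S] on the block compensates it.

    Finally, almost additivity implies that averages achieved at some length are
    achieved at all larger lengths up to a small error ([average_persists]), so
    that the normalized Cartan projections converge. Comparing words in [S] and
    in a nearby set block by block, for blocks of length [p], shows that the two
    limits are at distance O(1 / p) ([nearby_average_limits]). *)

(** * The maximum norm on matrices *)

Section MatrixNorm.
Variable R : realType.

Lemma mx_norm_le m n (A : 'M[R]_(m, n)) (c : R) :
  0 <= c -> (forall i j, `|A i j| <= c) -> `|A| <= c.
Proof.
move=> c0 h; rewrite /Num.norm/= mx_normrE.
by apply: bigmax_le => // -[i j] _; exact: h.
Qed.

Lemma entry_le_norm m n (A : 'M[R]_(m, n)) i j : `|A i j| <= `|A|.
Proof.
rewrite [leRHS]/Num.norm/= mx_normrE.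
exact: (le_bigmax _ (fun ij : 'I_m * 'I_n => `|A ij.1 ij.2|) (i, j)).
Qed.

(** The maximum norm is submultiplicative only up to the inner dimension; this
    factor is harmless since all later estimates are up to constants. *)
Lemma norm_mulmx_le m n p (A : 'M[R]_(m, n)) (B : 'M[R]_(n, p)) :
  `|A *m B| <= n%:R * `|A| * `|B|.
Proof.
apply: mx_norm_le => [|i j]; first by rewrite !mulr_ge0.
rewrite mxE (le_trans (ler_norm_sum _ _ _))//.
rewrite (le_trans (ler_sum _ (G := fun=> `|A| * `|B|) _))//; last first.
  by rewrite -[n%:R * _ * _]mulrA mulr_natl sumr_const card_ord.
by move=> k _; rewrite normrM ler_pM// entry_le_norm.
Qed.

Lemma mx_norm_attained m n (A : 'M[R]_(m.+1, n.+1)) :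
  exists i j, `|A i j| = `|A|.
Proof.
case: (eqVneq (mx_norm A) 0) => [A0|/mx_norm_neq0[[i j]/= e]]; last by exists i, j; rewrite -e.
by exists ord0, ord0; apply/eqP; rewrite eq_le entry_le_norm/=; have -> : `|A| = 0 by [].
Qed.

Lemma norm_col_mul_row m n (u : 'cV[R]_m) (v : 'rV[R]_n) :
  `|u *m v| = `|u| * `|v|.
Proof.
apply/eqP; rewrite eq_le (le_trans (norm_mulmx_le _ _)) ?mul1r//=.
case: m u => [|m] u; first by rewrite [u]flatmx0 !(normr0, mul0r).
case: n v => [|n] v; first by rewrite [v]thinmx0 !(normr0, mulr0).
have [i [j <-]] := mx_norm_attained u; have [k [l <-]] := mx_norm_attained v.
rewrite -normrM !ord1 (le_trans _ (entry_le_norm _ i l))//.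
by rewrite mxE big_ord1.
Qed.

Lemma norm_trmx m n (A : 'M[R]_(m, n)) : `|A^T| = `|A|.
Proof.
apply/eqP; rewrite eq_le; apply/andP; split; apply: mx_norm_le => // i j;
  first by rewrite mxE entry_le_norm.
by have := entry_le_norm A^T j i; rewrite mxE.
Qed.

(** The Lipschitz constant is given by the values at the matrix units. *)
Lemma linear_mx_bounded m n (V : normedModType R)
    (f : {linear 'M[R]_(m, n) -> V}) :
  exists2 C : R, 0 < C & forall A, `|f A| <= C * `|A|.
Proof.
exists (1 + \sum_i \sum_j `|f (delta_mx i j)|) => [|A].
  by rewrite ltr_pwDl// !sumr_ge0// => i _; rewrite sumr_ge0.
rewrite {1}[A]matrix_sum_delta linear_sum (le_trans (ler_norm_sum _ _ _))//.
rewrite mulrDl mul1r ler_wpDl// mulr_suml ler_sum// => i _.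
rewrite linear_sum (le_trans (ler_norm_sum _ _ _))// mulr_suml ler_sum// => j _.
by rewrite linearZ normrZ mulrC ler_wpM2l// entry_le_norm.
Qed.

End MatrixNorm.

(** * Products of matrices that are uniformly close to rank one *)

Section NearMultiplicativity.
Variable R : realType.

(** Distance between unit vectors up to sign, that is, between lines. *)
Definition sdist m n (x y : 'M[R]_(m, n)) : R := Num.min `|x - y| `|x + y|.

Lemma sdist_triangle m n (x y z : 'M[R]_(m, n)) :
  sdist x z <= sdist x y + sdist y z.
Proof.
have pp : `|x - z| <= `|x - y| + `|y - z| by rewrite (le_trans _ (ler_normD _ _))// addrA subrK.
have mm : `|x - z| <= `|x + y| + `|y + z|.
  by rewrite (le_trans _ (ler_normB _ _))// opprD addrA addrK.
have pm : `|x + z| <= `|x - y| + `|y + z|.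
  by rewrite (le_trans _ (ler_normD _ _))// addrA subrK.
have mp : `|x + z| <= `|x + y| + `|y - z|.
  rewrite (le_trans _ (ler_normB _ _))// le_eqVlt; apply/orP; left; apply/eqP.
  by congr `|_|; apply/matrixP => i j; rewrite !mxE; ring.
by rewrite /sdist; case: (leP `|x - y|) => ?; case: (leP `|y - z|) => ?;
  rewrite ge_min ?pp ?mm ?pm ?mp ?orbT.
Qed.

Lemma sdist_unit_le2 m n (x y : 'M[R]_(m, n)) :
  `|x| = 1 -> `|y| = 1 -> sdist x y <= 2.
Proof.
move=> x1 y1; rewrite ge_min; apply/orP; left.
by rewrite (le_trans (ler_normB _ _))// x1 y1.
Qed.

Lemma sdist_tr m n (x y : 'M[R]_(m, n)) : sdist x^T y^T = sdist x y.
Proof. by rewrite /sdist -!linearB -!linearD !norm_trmx. Qed.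

(** The scalar must be close to 1 in absolute value, since both vectors are
    unit. *)
Lemma sdist_unit m n (x y : 'M[R]_(m, n)) (t e : R) :
  `|x| = 1 -> `|y| = 1 -> `|y - t *: x| <= e -> sdist x y <= 2 * e.
Proof.
move=> x1 y1 h.
have nt : `| `|t| - 1| <= e.
  apply: le_trans h.
  have := ler_dist_dist y (t *: x).
  by rewrite normrZ x1 y1 mulr1 (distrC 1).
rewrite /sdist; case: (leP 0 t) => t0.
  rewrite ge_min; apply/orP; left.
  have -> : x - y = - (y - t *: x) - (t - 1) *: x.
    by apply/matrixP => i j; rewrite !mxE; ring.
  rewrite (le_trans (ler_normB _ _))// normrN normrZ x1 mulr1.
  rewrite (ger0_norm t0) in nt; lra.
rewrite ge_min; apply/orP; right.
have -> : x + y = (y - t *: x) + (t + 1) *: x.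
  by apply/matrixP => i j; rewrite !mxE; ring.
rewrite (le_trans (ler_normD _ _))// normrZ x1 mulr1.
rewrite (ltr0_norm t0) in nt; rewrite -opprD normrN in nt; lra.
Qed.

Lemma norm_mul_sdist m n p (v : 'M[R]_(m, n)) (x y : 'M[R]_(n, p)) :
  `|v *m x| <= `|v *m y| + n%:R * `|v| * sdist x y.
Proof.
rewrite /sdist /Num.min; case: ifP => _.
  have -> : v *m x = v *m y + v *m (x - y) by rewrite -mulmxDr addrC subrK.
  by rewrite (le_trans (ler_normD _ _))// lerD2l norm_mulmx_le.
have -> : v *m x = v *m (x + y) - v *m y by rewrite -mulmxBr addrK.
rewrite (le_trans (ler_normB _ _))// addrC lerD2l norm_mulmx_le//.
Qed.

(** The unit vectors are parameters because the proof follows how they change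
    from one word to another; they determine the scalar up to the error. *)
Definition near_rank1 m n (e : R) (A : 'M[R]_(m, n))
    (u : 'cV[R]_m) (v : 'rV[R]_n) : Prop :=
  [/\ `|u| = 1, `|v| = 1 & exists t : R, `|A - t *: (u *m v)| <= e * `|A|].

Lemma near_rank1_tr m n e (A : 'M[R]_(m, n)) u v :
  near_rank1 e A u v -> near_rank1 e A^T v^T u^T.
Proof.
case=> u1 v1 [t ht]; split; rewrite ?norm_trmx//; exists t.
by rewrite -trmx_mul -linearZ -linearB !norm_trmx.
Qed.

Lemma near_rank1_scalar m n e (A : 'M[R]_(m, n))
    (u : 'cV[R]_m) (v : 'rV[R]_n) (t : R) :
  `|u| = 1 -> `|v| = 1 -> `|A - t *: (u *m v)| <= e * `|A| ->
  (1 - e) * `|A| <= `|t| /\ `|t| <= (1 + e) * `|A|.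
Proof.
move=> u1 v1 h.
have := ler_dist_dist A (t *: (u *m v)).
rewrite normrZ norm_col_mul_row u1 v1 !mulr1 => h2.
have := le_trans h2 h; rewrite ler_norml => /andP[h3 h4]; split; lra.
Qed.

Lemma ler_norm_col m n (A : 'M[R]_(m, n)) j : `|col j A| <= `|A|.
Proof. by apply: mx_norm_le => // i k; rewrite mxE entry_le_norm. Qed.

(** Up to the error, [A *m g] has the same image as the rank-one approximation
    of [A], so one more letter on the right hardly moves the expanded
    direction. *)
Lemma near_rank1_step d (b e e' : R) (A g A' : 'M[R]_d.+1) u v u' v' :
  1 <= b -> A' = A *m g -> `|g| <= b -> `|A| <= d.+1%:R * b * `|A'| -> A' != 0 ->
  e' <= e -> 0 <= e' -> near_rank1 e A u v -> near_rank1 e' A' u' v' ->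
  sdist u u' <= 8 * (d.+1%:R * b) ^+ 2 * e.
Proof.
move=> b1 eA' gb AA' A'0 ee e0 [u1 v1 [t ht]] [u'1 v'1 [t' ht']].
set K := d.+1%:R; have K1 : 1 <= K :> R by rewrite ler1n.
have B1 : 1 <= K * b by rewrite mulr_ege1.
have B2 : 1 <= (K * b) ^+ 2 by rewrite exprn_ege1.
have [he|he] := leP e (1/2); last first.
  apply: (le_trans (sdist_unit_le2 u1 u'1)).
  have h : 1 * (1/2) <= (K * b) ^+ 2 * e by apply: ler_pM => //; exact: ltW.
  by rewrite -mulrA; lra.
have a0 : 0 < `|A'| by rewrite normr_gt0.
have [t'a _] := near_rank1_scalar u'1 v'1 ht'.
have t'2 : `|A'| / 2 <= `|t'|.
  by apply: le_trans t'a; rewrite mulrC ler_wpM2r//; lra.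
have {ht ht'} h : `|t *: (u *m (v *m g)) - t' *: (u' *m v')|
    <= 2 * (K * b) ^+ 2 * e * `|A'|.
  have -> : t *: (u *m (v *m g)) - t' *: (u' *m v') =
      (A' - t' *: (u' *m v')) - (A - t *: (u *m v)) *m g.
    rewrite mulmxBl -scalemxAl -mulmxA -eA'.
    by move: (u *m (v *m g)) (u' *m v') => X Y; apply/matrixP => i j; rewrite !mxE; ring.
  rewrite (le_trans (ler_normB _ _))//.
  have h1 : `|(A - t *: (u *m v)) *m g| <= (K * b) ^+ 2 * e * `|A'|.
    rewrite (le_trans (norm_mulmx_le _ _))//.
    have -> : (K * b) ^+ 2 * e * `|A'| = K * (e * (K * b * `|A'|)) * b by ring.
    rewrite ler_pM// ler_wpM2l// (le_trans ht)// ler_wpM2l//.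
    exact: le_trans ee.
  have h2 : e' * `|A'| <= (K * b) ^+ 2 * e * `|A'|.
    rewrite ler_wpM2r// (le_trans ee)// ler_peMl//; exact: le_trans ee.
  lra.
have [j vj] : exists j, `|v' ord0 j| = 1.
  by have [i [j]] := mx_norm_attained v'; rewrite v'1 ord1; exists j.
(* Reading off the column where [v'] is largest compares [u] and [u']. *)
set c := t' * v' ord0 j.
have c0 : `|A'| / 2 <= `|c| by rewrite normrM vj mulr1.
have cn0 : 0 < `|c| by apply: lt_le_trans c0; rewrite divr_gt0.
have hc : `|u' - (t * (v *m g) ord0 j / c) *: u| <= 4 * (K * b) ^+ 2 * e.
  rewrite -(ler_pM2l cn0) -normrZ scalerBr scalerA.
  have -> : c * (t * (v *m g) ord0 j / c) = t * (v *m g) ord0 j.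
    by rewrite mulrC divfK// -normr_gt0.
  have -> : c *: u' - (t * (v *m g) ord0 j) *: u =
      - col j (t *: (u *m (v *m g)) - t' *: (u' *m v')).
    rewrite /c; move: (v *m g) => w; apply/matrixP => i k.
    rewrite (_ : k = ord0) ?ord1// !mxE !big_ord1; ring.
  rewrite normrN (le_trans (ler_norm_col _ _))// (le_trans h)//.
  have : `|A'| / 2 * (4 * (K * b) ^+ 2 * e) <= `|c| * (4 * (K * b) ^+ 2 * e).
    rewrite ler_wpM2r//; apply: mulr_ge0; last exact: le_trans ee.
    by apply: mulr_ge0 => //; exact: le_trans B2.
  lra.
have := sdist_unit u1 u'1 hc; lra.
Qed.

End NearMultiplicativity.

Section NearMultiplicativityWords.
Variables (R : realType) (d : nat).
Local Notation M := 'M[R]_d.+1.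
Local Notation K := (d.+1%:R : R).
Variables (b C0 tau : R) (g : nat -> M) (N : nat).
Hypotheses (b1 : 1 <= b) (C01 : 1 <= C0) (tau0 : 0 < tau) (tau1 : tau < 1).
Hypothesis gunit : forall i, g i \in unitmx.
Hypothesis gb : forall i, `|g i| <= b.
Hypothesis gVb : forall i, `|invmx (g i)| <= b.

Definition word (p q : nat) : M := \prod_(p <= i < q) g i.

Hypothesis word_rank1 : forall p q, (p <= q <= N)%N -> exists u v,
  near_rank1 (C0 * tau ^+ (q - p)) (word p q) u v.

Local Notation B := (K * b).

Lemma word_nil p : word p p = 1%:M.
Proof. by rewrite /word big_geq. Qed.

Lemma word_rcons p q : (p <= q)%N -> word p q.+1 = word p q *m g q.
Proof. by move=> pq; rewrite /word big_nat_recr. Qed.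

Lemma word_cons p q : (p < q)%N -> word p q = g p *m word p.+1 q.
Proof. by move=> pq; rewrite /word big_ltn. Qed.

Lemma word_cat p m q : (p <= m)%N -> (m <= q)%N -> word p q = word p m *m word m q.
Proof. by move=> pm mq; rewrite /word (big_cat_nat _ mq). Qed.

Let K1 : 1 <= K. Proof. by rewrite ler1n. Qed.
Let b0 : 0 <= b. Proof. exact: le_trans b1. Qed.
Let tau00 n : 0 <= tau ^+ n. Proof. by rewrite exprn_ge0// ltW. Qed.
Let B1 : 1 <= B. Proof. by rewrite mulr_ege1. Qed.
Let B0 : 0 <= B. Proof. exact: le_trans B1. Qed.

Lemma norm_mul_letter (m : nat) (A : 'M[R]_(m, d.+1)) i : `|A *m g i| <= B * `|A|.
Proof.
rewrite (le_trans (norm_mulmx_le _ _))// mulrAC ler_wpM2r// ler_wpM2l//.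
Qed.

Lemma norm_mul_letterV (m : nat) (A : 'M[R]_(m, d.+1)) i : `|A| <= B * `|A *m g i|.
Proof.
rewrite -{1}(mulmxK (gunit i) A) (le_trans (norm_mulmx_le _ _))//.
by rewrite mulrAC ler_wpM2r// ler_wpM2l.
Qed.

Lemma norm_letter_mul (m : nat) (A : 'M[R]_(d.+1, m)) i : `|g i *m A| <= B * `|A|.
Proof. by rewrite (le_trans (norm_mulmx_le _ _))// ler_wpM2r// ler_wpM2l. Qed.

Lemma norm_letter_mulV (m : nat) (A : 'M[R]_(d.+1, m)) i : `|A| <= B * `|g i *m A|.
Proof.
rewrite -{1}(mulKmx (gunit i) A) (le_trans (norm_mulmx_le _ _))//.
by rewrite ler_wpM2r// ler_wpM2l.
Qed.

Lemma word_unit p q : word p q \in unitmx.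
Proof.
rewrite /word; elim/big_ind: _ => [|x y|i _]; first exact: unitmx1.
  by move=> hx hy; rewrite unitmx_mul hx.
exact: gunit.
Qed.

Lemma word_neq0 p q : word p q != 0.
Proof. by apply: contraTneq (word_unit p q) => ->; rewrite unitmxE det0 unitr0. Qed.

Lemma norm_word_le p q : (p <= q)%N -> `|word p q| <= B ^+ (q - p).
Proof.
move=> /subnK <-; elim: (q - p)%N => [|k IH].
  rewrite add0n word_nil subnn expr0; apply: mx_norm_le => // i j.
  by rewrite mxE; case: eqP => _; rewrite ?normr1 ?normr0.
rewrite addSn word_rcons ?leq_addl// subSn ?leq_addl// exprS.
by rewrite (le_trans (norm_mul_letter _ _))// ler_wpM2l.
Qed.

Let eps (n : nat) := C0 * tau ^+ n.

Let eps_ge0 n : 0 <= eps n.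
Proof. by rewrite mulr_ge0 ?exprn_ge0// ?(le_trans _ C01)// ltW. Qed.

Let epsS n : eps n.+1 <= eps n.
Proof.
rewrite /eps ler_wpM2l ?(le_trans _ C01)//.
by rewrite exprS ler_piMl ?exprn_ge0 ?ltW.
Qed.

Let Cs : R := 8 * B ^+ 2.
Let C3 : R := Cs * C0 * (2 / (1 - tau)).

Let Cs_ge0 : 0 <= Cs. Proof. by rewrite mulr_ge0// exprn_ge0. Qed.

Lemma geo_sum_le n : \sum_(i < n) tau ^+ i <= (1 - tau)^-1.
Proof.
have h : 0 < 1 - tau by rewrite subr_gt0.
rewrite -[leRHS]mul1r ler_pdivlMr// mulrC -opprB mulNr -subrX1 opprB.
by rewrite gerBl exprn_ge0 ?ltW.
Qed.

(** Extending a word on the right changes its expanded direction by a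
    geometric series of successive corrections. *)
Lemma col_stable p q q' u v u' v' : (p <= q)%N -> (q <= q')%N -> (q' <= N)%N ->
  near_rank1 (C0 * tau ^+ (q - p)) (word p q) u v ->
  near_rank1 (C0 * tau ^+ (q' - p)) (word p q') u' v' ->
  sdist u u' <= C3 * tau ^+ (q - p).
Proof.
move=> pq qq' q'N h h'.
have main : sdist u u' <=
    Cs * eps (q - p) * (1 + \sum_(i < q' - q) tau ^+ i).
  move: qq' q'N u' v' h' => /subnK <-; move: (q' - q)%N => k.
  rewrite addnK.
  elim: k => [|k IH] kN u' v' h'.
    rewrite big_ord0 addr0 mulr1.
    apply: (@near_rank1_step _ _ _ _ _ (word p q) 1%:M (word p q) _ _ _ _ b1
      _ _ _ (word_neq0 p q) (lexx _) (eps_ge0 _) h h').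
    - by rewrite mulmx1.
    - by rewrite -(word_nil 0) (le_trans (norm_word_le _))// subnn.
    - by rewrite ler_peMl.
  have [|u2 [v2 h2]] := @word_rank1 p (k + q).
    by rewrite (leq_trans pq (leq_addl _ _))/= ltnW// -addSn.
  rewrite big_ord_recr/= addrA mulrDr.
  apply: le_trans (sdist_triangle _ u2 _) _; apply: lerD.
    by apply: IH h2; rewrite ltnW// -addSn.
  have := @near_rank1_step _ _ b (eps (k + q - p)) (eps (k.+1 + q - p))
    (word p (k + q)) (g (k + q)) (word p (k.+1 + q)) u2 v2 u' v' b1.
  rewrite addSn word_rcons; last exact: leq_trans pq (leq_addl _ _).
  move=> /(_ erefl (gb _) (norm_mul_letterV _ _)).
  rewrite -word_rcons; last exact: leq_trans pq (leq_addl _ _).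
  move=> /(_ (word_neq0 _ _)).
  rewrite subSn; last exact: leq_trans pq (leq_addl _ _).
  move=> /(_ (epsS _) (eps_ge0 _) h2).
  rewrite addSn subSn in h'; last exact: leq_trans pq (leq_addl _ _).
  move=> /(_ h') hh; apply: le_trans hh _.
  rewrite /Cs /eps -addnBA// exprD [tau ^+ k * _]mulrC !mulrA.
  exact: lexx.
apply: (le_trans main).
have -> : C3 * tau ^+ (q - p) = Cs * eps (q - p) * (2 / (1 - tau)).
  by rewrite /C3 /eps; ring.
apply: ler_wpM2l; first by rewrite mulr_ge0.
have h1 : 1 <= (1 - tau)^-1 by rewrite invf_ge1 ?subr_gt0// gerBl ltW.
have := geo_sum_le (q' - q); lra.
Qed.


Let C3_ge0 : 0 <= C3.
Proof.
have C00 : 0 <= C0 by exact: le_trans C01.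
by rewrite /C3; apply: mulr_ge0; [exact: mulr_ge0|apply: divr_ge0 => //; rewrite subr_ge0 ltW].
Qed.

(** From here on [psi p] is the image under the suffix [word p N] of a fixed
    basis vector, chosen not to be contracted by the whole word, and [alpha p]
    is its norm. These vectors form a trajectory that follows the expanded
    directions of all the words. *)
Variable n0 : nat.
Hypothesis n0P : forall n, (n0 <= n)%N -> C3 * tau ^+ n <= 8^-1.
Hypothesis row_stable : forall p p' u v u' v', (p <= p')%N -> (p' <= N)%N ->
  near_rank1 (C0 * tau ^+ (N - p')) (word p' N) u v ->
  near_rank1 (C0 * tau ^+ (N - p)) (word p N) u' v' ->
  sdist v v' <= C3 * tau ^+ (N - p').

Variables (u0 : 'cV[R]_d.+1) (v0 : 'rV[R]_d.+1) (j0 : 'I_d.+1).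
Hypothesis uv0 : near_rank1 (C0 * tau ^+ (N - 0)) (word 0 N) u0 v0.
Hypothesis j0P : `|v0 ord0 j0| = 1.

Let psi p : 'cV[R]_d.+1 := col j0 (word p N).
Let alpha p := `|psi p|.

Lemma psi_rec p : (p < N)%N -> psi p = g p *m psi p.+1.
Proof. by move=> pN; rewrite /psi word_cons// !colE mulmxA. Qed.

Let psiN_norm : alpha N = 1.
Proof.
rewrite /alpha /psi word_nil; apply/eqP; rewrite eq_le; apply/andP; split.
  apply: mx_norm_le => // i k; rewrite !mxE.
  by case: eqP => _; rewrite ?normr1 ?normr0.
by rewrite (le_trans _ (entry_le_norm _ j0 ord0))// !mxE eqxx normr1.
Qed.

Lemma alpha_ratio p m : (p <= m)%N -> (m <= N)%N ->
  alpha m <= B ^+ (m - p) * alpha p.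
Proof.
move=> /subnK <-; elim: (m - p)%N => [|k IH] kN.
  by rewrite add0n subnn expr0 mul1r.
rewrite addnK exprS -mulrA.
apply: (@le_trans _ _ (B * alpha (k + p))).
  by rewrite /alpha (psi_rec kN) norm_letter_mulV.
by rewrite ler_wpM2l// (le_trans (IH (ltnW kN)))// addnK.
Qed.

Lemma alpha_gt0 p : (p <= N)%N -> 0 < alpha p.
Proof.
move=> pN; have := alpha_ratio pN (leqnn N); rewrite psiN_norm => h.
have : 0 < B ^+ (N - p) * alpha p by exact: lt_le_trans h.
by rewrite pmulr_rgt0// exprn_gt0// (lt_le_trans _ B1).
Qed.

Let C5 : R := 8 + B ^+ (n0 + n0).

Let C5_ge0 : 0 <= C5. Proof. by rewrite addr_ge0// exprn_ge0. Qed.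

Let eps_C3 n : eps n <= C3 * tau ^+ n.
Proof.
have t2 : 1 <= 2 / (1 - tau).
  have h : 0 < 1 - tau by rewrite subr_gt0.
  by rewrite ler_pdivlMr// mul1r; move: tau0 tau1 => ? ?; lra.
have B2 : 1 <= B ^+ 2 by rewrite exprn_ege1.
rewrite /eps; apply: ler_wpM2r; first by rewrite exprn_ge0// ltW.
rewrite /C3.
have h1 : C0 <= Cs * C0.
  rewrite ler_peMl ?(le_trans _ C01)// /Cs; lra.
apply: (le_trans h1); rewrite ler_peMr//.
exact: le_trans (le_trans ler01 C01) h1.
Qed.

(** The chosen basis vector is never contracted: its pairing with the
    expanding row of a long suffix is bounded below, and short suffixes have
    bounded distortion. *)
Lemma norm_word_alpha p : (p <= N)%N -> `|word p N| <= C5 * alpha p.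
Proof.
move=> pN; have a0 := alpha_gt0 pN.
have [n0N|n0N] := leqP n0 (N - p).
  have [|u [v uv]] := @word_rank1 p N; first by rewrite pN/=.
  have [u1 v1 [t ht]] := uv.
  have small := n0P n0N.
  have eps8 : eps (N - p) <= 8^-1 := le_trans (eps_C3 _) small.
  have [ta _] := near_rank1_scalar u1 v1 ht.
  have vj : 1 / 2 <= `|v ord0 j0|.
    have sd : sdist v v0 <= 8^-1.
      apply: le_trans small; exact: (@row_stable 0 p u v u0 v0).
    have hh : `|v0 ord0 j0| <= `|v ord0 j0| + sdist v v0.
      rewrite /sdist /Num.min; case: ifP => _.
        have := entry_le_norm (v - v0) ord0 j0; rewrite !mxE.
        have := ler_dist_dist (v ord0 j0) (v0 ord0 j0).
        rewrite ler_norml => /andP[? _]; lra.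
      have := entry_le_norm (v + v0) ord0 j0; rewrite !mxE.
      have := lerB_normD (v0 ord0 j0) (v ord0 j0); rewrite [v0 _ _ + _]addrC; lra.
    rewrite j0P in hh; lra.
  have h1 : `|psi p - (t * v ord0 j0) *: u| <= eps (N - p) * `|word p N|.
    have -> : psi p - (t * v ord0 j0) *: u = col j0 (word p N - t *: (u *m v)).
      rewrite /psi; move: (word p N) => W; apply/matrixP => i k.
      by rewrite (_ : k = ord0) ?ord1// !mxE big_ord1; ring.
    exact: le_trans (ler_norm_col _ _) _.
  have h2 : `|t * v ord0 j0| <= alpha p + eps (N - p) * `|word p N|.
    have := ler_dist_dist (psi p) ((t * v ord0 j0) *: u).
    rewrite normrZ u1 mulr1 => h2.
    have := le_trans h2 h1; rewrite ler_norml /alpha => /andP[? _]; lra.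
  have h3 : (1 - eps (N - p)) * `|word p N| * (1 / 2) <= `|t * v ord0 j0|.
    rewrite normrM; apply: ler_pM => //; rewrite mulr_ge0// subr_ge0.
    by apply: le_trans eps8 _; lra.
  have W0 : 0 <= `|word p N| by [].
  have h4 : eps (N - p) * `|word p N| <= 8^-1 * `|word p N| by rewrite ler_wpM2r.
  have h5 : `|word p N| <= 8 * alpha p by lra.
  apply: (le_trans h5); apply: ler_wpM2r; first exact: ltW.
  by rewrite /C5 lerDl exprn_ge0.
apply: (@le_trans _ _ (B ^+ (n0 + n0) * alpha p)); last first.
  by apply: ler_wpM2r; [exact: ltW|rewrite /C5 lerDr].
have := alpha_ratio pN (leqnn N); rewrite psiN_norm => h.
apply: (le_trans (norm_word_le pN)).
have h6 : B ^+ (N - p) <= B ^+ n0 by rewrite ler_weXn2l// ltnW.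
rewrite exprD -mulrA -[leLHS]mulr1.
have Bn : 0 <= B ^+ (N - p) by rewrite exprn_ge0.
apply: ler_pM => //; apply: (le_trans h); rewrite ler_wpM2r// ltW//.
Qed.


Let psih p := (alpha p)^-1 *: psi p.

Let psih_norm p : (p <= N)%N -> `|psih p| = 1.
Proof.
move=> pN; have a0 := alpha_gt0 pN.
by rewrite /psih normrZ gtr0_norm ?invr_gt0// mulVf// gt_eqF.
Qed.

Let C6 : R := 2 * C5 * C0 + C3.

Let C6_ge0 : 0 <= C6.
Proof. by rewrite addr_ge0// !mulr_ge0// (le_trans _ C01). Qed.

Let tau_le k m : (k <= m)%N -> tau ^+ m <= tau ^+ k.
Proof. by move=> km; apply: ler_wiXn2l => //; exact: ltW. Qed.

(** The trajectory is close to the expanded direction of every word, as both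
    are close to that of the full suffix. *)
Lemma psih_col p q u v : (p <= q)%N -> (q <= N)%N ->
  near_rank1 (C0 * tau ^+ (q - p)) (word p q) u v ->
  sdist u (psih p) <= C6 * tau ^+ (q - p).
Proof.
move=> pq qN uv; have pN := leq_trans pq qN; have a0 := alpha_gt0 pN.
have [|u' [v' uv']] := @word_rank1 p N; first by rewrite pN/=.
apply: le_trans (sdist_triangle _ u' _) _.
rewrite /C6 mulrDl addrC; apply: lerD; last exact: (col_stable pq qN _ uv uv').
have [u1 v1 [t ht]] := uv'.
have h1 : `|psih p - (t * v' ord0 j0 / alpha p) *: u'| <= C5 * eps (N - p).
  have -> : psih p - (t * v' ord0 j0 / alpha p) *: u' =
      (alpha p)^-1 *: col j0 (word p N - t *: (u' *m v')).
    rewrite /psih /psi; move: (word p N) => W; apply/matrixP => i k.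
    by rewrite (_ : k = ord0) ?ord1// !mxE big_ord1; ring.
  rewrite normrZ gtr0_norm ?invr_gt0// mulrC ler_pdivrMr//.
  apply: le_trans (ler_norm_col _ _) _; apply: le_trans ht _.
  have -> : C5 * eps (N - p) * alpha p = C0 * tau ^+ (N - p) * (C5 * alpha p).
    by rewrite /eps; ring.
  by apply: ler_wpM2l; [exact: eps_ge0|exact: norm_word_alpha].
apply: le_trans (sdist_unit u1 (psih_norm pN) h1) _.
rewrite /eps !mulrA; apply: ler_wpM2l; last by apply: tau_le; rewrite leq_sub2r.
by rewrite !mulr_ge0// (le_trans _ C01).
Qed.

Let C7 : R := (1 + C0) * K * C6 + K * C0.

Let C00 : 0 <= C0. Proof. exact: le_trans C01. Qed.

Let C7_ge0 : 0 <= C7.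
Proof. by rewrite addr_ge0// !mulr_ge0// addr_ge0. Qed.

(** Rows killed by [psi p] avoid the expanded direction of every word starting
    at [p]. *)
Lemma kernel_contracted p q (w : 'rV[R]_d.+1) : (p <= q)%N -> (q <= N)%N ->
  w *m psi p = 0 -> `|w *m word p q| <= C7 * tau ^+ (q - p) * `|word p q| * `|w|.
Proof.
move=> pq qN w0; have pN := leq_trans pq qN.
have [|u [v uv]] := @word_rank1 p q; first by rewrite pq qN.
have [u1 v1 [t ht]] := uv.
have [_ ta] := near_rank1_scalar u1 v1 ht.
have wu : `|w *m u| <= K * `|w| * (C6 * tau ^+ (q - p)).
  apply: le_trans (norm_mul_sdist _ _ (psih p)) _.
  rewrite /psih -scalemxAr w0 scaler0 normr0 add0r.
  by apply: ler_wpM2l; [rewrite mulr_ge0|exact: (psih_col pq qN uv)].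
have t1 : `|t| <= (1 + C0) * `|word p q|.
  apply: (le_trans ta); apply: ler_wpM2r => //; rewrite lerD2l ler_piMr//.
  by rewrite exprn_ile1// ltW.
have -> : w *m word p q = t *: ((w *m u) *m v) + w *m (word p q - t *: (u *m v)).
  by rewrite mulmxBr -scalemxAr mulmxA addrC subrK.
apply: le_trans (ler_normD _ _) _.
rewrite normrZ norm_col_mul_row v1 mulr1.
have -> : C7 * tau ^+ (q - p) * `|word p q| * `|w| =
   ((1 + C0) * `|word p q|) * (K * `|w| * (C6 * tau ^+ (q - p))) +
   K * `|w| * (C0 * tau ^+ (q - p) * `|word p q|) by rewrite /C7; ring.
apply: lerD; first exact: ler_pM.
by apply: le_trans (norm_mulmx_le _ _) _; apply: ler_wpM2l.
Qed.

Variable n1 : nat.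
Hypothesis n1P : forall n, (n1 <= n)%N -> 2 * C7 * tau ^+ n <= 2^-1.

Let C11 : R := 2 + B ^+ (n1 + n1).
Let C12 : R := 2 * B ^+ 2 * C7 * C11.

Let C11_ge0 : 0 <= C11. Proof. by rewrite addr_ge0// exprn_ge0. Qed.
Let C12_ge0 : 0 <= C12.
Proof. by rewrite /C12; do 3?[apply: mulr_ge0 => //]; exact: exprn_ge0. Qed.

(** The norm of a word is detected by any row [w] that is normalized along the
    trajectory: every basis row is a multiple of [w] up to a contracted one.
    The ratios of the [alpha] turn this into the quantity that is bounded
    next. *)
Lemma norm_word_normal p m (w : 'rV[R]_d.+1) : (p <= m)%N -> (m <= N)%N ->
  `|w| = 1 -> w *m psi p = (alpha p)%:M ->
  `|word p m| * (alpha m / alpha p) <=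
    C11 * (`|w *m word p m| * (alpha m / alpha p) + 1).
Proof.
move=> pm mN w1 wp; have pN := leq_trans pm mN.
have a0 := alpha_gt0 pN; have am := alpha_gt0 mN.
have r0 : 0 < alpha m / alpha p by rewrite divr_gt0.
have [h|h] := leqP n1 (m - p); last first.
  have h1 : `|word p m| <= B ^+ n1.
    by apply: (le_trans (norm_word_le pm)); rewrite ler_weXn2l// ltnW.
  have h2 : alpha m / alpha p <= B ^+ n1.
    rewrite ler_pdivrMr//; apply: (le_trans (alpha_ratio pm mN)).
    by apply: ler_wpM2r; [exact: ltW|rewrite ler_weXn2l// ltnW].
  have h3 : `|word p m| * (alpha m / alpha p) <= B ^+ (n1 + n1).
    by rewrite exprD ler_pM// ltW.
  have h4 : 0 <= `|w *m word p m| * (alpha m / alpha p) by rewrite mulr_ge0// ltW.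
  apply: (le_trans h3); rewrite mulrDr mulr1 /C11.
  apply: (@le_trans _ _ (2 + B ^+ (n1 + n1))); first by rewrite lerDr.
  by rewrite lerDr mulr_ge0.
have W0 : 0 <= `|word p m| by [].
have key : `|word p m| <= `|w *m word p m| + 2 * C7 * tau ^+ (m - p) * `|word p m|.
  apply: mx_norm_le => [|i j].
    by rewrite addr_ge0// !mulr_ge0// exprn_ge0// ltW.
  pose s := psi p i ord0 / alpha p.
  have s1 : `|s| <= 1.
    by rewrite normrM normfV (gtr0_norm a0) ler_pdivrMr// mul1r /alpha entry_le_norm.
  pose r : 'rV[R]_d.+1 := delta_mx ord0 i - s *: w.
  have r2 : `|r| <= 2.
    have d1 : `|delta_mx ord0 i : 'rV[R]_d.+1| <= 1.
      by apply: mx_norm_le => // k l; rewrite mxE; case: eqP; case: eqP;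
        rewrite ?normr1 ?normr0.
    apply: le_trans (ler_normB _ _) _; rewrite normrZ w1 mulr1; lra.
  have rp : r *m psi p = 0.
    rewrite /r mulmxBl -rowE -scalemxAl wp; apply/matrixP => k l.
    rewrite (ord1 l) (ord1 k) !mxE eqxx mulr1n /s.
    by rewrite divfK ?gt_eqF// /psi mxE subrr.
  have -> : word p m i j = s * (w *m word p m) ord0 j + (r *m word p m) ord0 j.
    have -> : r *m word p m = row i (word p m) - s *: (w *m word p m).
      by rewrite /r mulmxBl -rowE scalemxAl.
    by move: (w *m _) => X; rewrite !mxE; ring.
  apply: le_trans (ler_normD _ _) _; apply: lerD.
    rewrite normrM -[leRHS]mul1r ler_pM// entry_le_norm//.
  apply: le_trans (entry_le_norm _ _ _) _.
  apply: le_trans (kernel_contracted pm mN rp) _.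
  have -> : 2 * C7 * tau ^+ (m - p) * `|word p m| =
    C7 * tau ^+ (m - p) * `|word p m| * 2 by ring.
  by apply: ler_wpM2l => //; rewrite !mulr_ge0.
have h5 : 2 * C7 * tau ^+ (m - p) * `|word p m| <= 2^-1 * `|word p m|.
  by apply: ler_wpM2r => //; exact: n1P.
have h6 : `|word p m| <= 2 * `|w *m word p m| by lra.
apply: (@le_trans _ _ (2 * (`|w *m word p m| * (alpha m / alpha p)))).
  by rewrite [leRHS]mulrA ler_wpM2r// ltW.
have h4 : 0 <= `|w *m word p m| * (alpha m / alpha p) by rewrite mulr_ge0// ltW.
apply: ler_pM => //; last by rewrite lerDl.
by rewrite /C11 lerDl exprn_ge0.
Qed.

Lemma normal_row p : (p <= N)%N ->
  exists w : 'rV[R]_d.+1, `|w| = 1 /\ w *m psi p = (alpha p)%:M.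
Proof.
move=> pN; have [i [j h]] := mx_norm_attained (psi p).
rewrite ord1 -/(alpha p) in h.
pose s : R := (-1) ^+ (psi p i 0 < 0)%R.
have d1 : `|delta_mx ord0 i : 'rV[R]_d.+1| = 1.
  apply/eqP; rewrite eq_le; apply/andP; split.
    by apply: mx_norm_le => // k l; rewrite mxE; case: eqP; case: eqP;
      rewrite ?normr1 ?normr0.
  by rewrite (le_trans _ (entry_le_norm _ ord0 i))// mxE !eqxx normr1.
exists (s *: delta_mx ord0 i); split.
  by rewrite normrZ d1 mulr1 /s normrX normrN1 expr1n.
rewrite -scalemxAl -rowE; apply/matrixP => k l.
rewrite (ord1 l) (ord1 k).
have -> : (s *: row i (psi p)) ord0 ord0 = s * psi p i 0 by rewrite !mxE.
by rewrite [RHS]mxE eqxx mulr1n -h /s normrEsign.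
Qed.

(** Backward induction on the starting point of the word: passing from [p] to
    [p.+1] multiplies the normalized quantity by at most [1 + C12 * tau ^+ k],
    since [w *m g p] differs from a multiple of the next normalized row by a
    row killed by [psi p.+1]. The product of these factors converges. *)
Lemma normal_row_growth k m (w : 'rV[R]_d.+1) : (k <= m)%N -> (m <= N)%N ->
  `|w| = 1 -> w *m psi (m - k) = (alpha (m - k))%:M ->
  `|w *m word (m - k) m| * (alpha m / alpha (m - k)) + 1 <=
    2 * \prod_(j < k) (1 + C12 * tau ^+ j).
Proof.
elim: k w => [|k IH] w km mN w1 wp.
  rewrite subn0 word_nil mulmx1 w1 mul1r divff ?big_ord0; first by lra.
  by rewrite gt_eqF// alpha_gt0.
have km' := ltnW km; have mkN : (m - k <= N)%N := leq_trans (leq_subr _ _) mN.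
have [w' [w'1 w'p]] := normal_row mkN.
have {IH} := IH w' km' mN w'1 w'p.
have nw := norm_word_normal (leq_subr k m) mN w'1 w'p.
have pE : (m - k = (m - k.+1).+1)%N by rewrite subnSK.
rewrite {}pE in nw w'p mkN *; move: wp nw w'p mkN.
move eqp : (m - k.+1)%N => p.
have pm : (p < m)%N by rewrite -eqp ltn_subrL (leq_trans _ km).
move=> wp nw w'p pN IH.
have kp : (m - p.+1 = k)%N by rewrite -eqp subnSK// subKn.
have mp := alpha_gt0 mN; have ap := alpha_gt0 (ltnW pN); have aS := alpha_gt0 pN.
have apS : alpha p <= B * alpha p.+1 by rewrite /alpha (psi_rec pN) norm_letter_mul.
have aSp : alpha p.+1 <= B * alpha p by rewrite /alpha (psi_rec pN) norm_letter_mulV.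
pose a := alpha p / alpha p.+1.
have a0 : 0 < a by rewrite divr_gt0.
have aB : a <= B by rewrite ler_pdivrMr.
have aVB : alpha m / alpha p <= B * (alpha m / alpha p.+1).
  rewrite ler_pdivrMr//.
  have -> : B * (alpha m / alpha p.+1) * alpha p =
    alpha m * (B * alpha p / alpha p.+1) by ring.
  by rewrite ler_peMr ?(ltW mp)// ler_pdivlMr// mul1r.
pose x := w *m g p - a *: w'.
have x0 : x *m psi p.+1 = 0.
  rewrite /x mulmxBl -mulmxA -psi_rec// wp -scalemxAl w'p /a.
  apply/matrixP => i j; rewrite !mxE -mulr_natr -[in X in _ - X]mulr_natr.
  by rewrite mulrA divfK ?subrr// gt_eqF.
have xB : `|x| <= 2 * B.
  apply: le_trans (ler_normB _ _) _; rewrite normrZ w'1 mulr1 gtr0_norm//.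
  by have := norm_mul_letter w p; rewrite w1 mulr1; lra.
have kc := kernel_contracted pm mN x0; rewrite kp in kc.
have e1 : w *m word p m = a *: (w' *m word p.+1 m) + x *m word p.+1 m.
  by rewrite (word_cons pm) mulmxA /x mulmxBl -scalemxAl addrC subrK.
set P := \prod_(j < k.+1) _.
pose z := `|w' *m word p.+1 m| * (alpha m / alpha p.+1) + 1.
have r0 : 0 < alpha m / alpha p by rewrite divr_gt0.
have rS : 0 < alpha m / alpha p.+1 by rewrite divr_gt0.
have z1 : 1 <= z by rewrite /z lerDr mulr_ge0// ltW.
have step : `|w *m word p m| * (alpha m / alpha p) + 1 <= z * (1 + C12 * tau ^+ k).
  have h1 : `|w *m word p m| <= a * `|w' *m word p.+1 m| +
      C7 * tau ^+ k * `|word p.+1 m| * (2 * B).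
    rewrite e1; apply: le_trans (ler_normD _ _) _.
    rewrite normrZ gtr0_norm//; apply: lerD => //.
    apply: (le_trans kc); apply: ler_wpM2l => //.
    by rewrite !mulr_ge0.
  have h2 : a * `|w' *m word p.+1 m| * (alpha m / alpha p) = z - 1.
    by rewrite /z addrK /a; field; rewrite !gt_eqF.
  have h3 : C7 * tau ^+ k * `|word p.+1 m| * (2 * B) * (alpha m / alpha p) <=
      z * (C12 * tau ^+ k).
    apply: (@le_trans _ _ (C7 * tau ^+ k * `|word p.+1 m| * (2 * B) *
        (B * (alpha m / alpha p.+1)))).
      by apply: ler_wpM2l => //; rewrite !mulr_ge0.
    have -> : C7 * tau ^+ k * `|word p.+1 m| * (2 * B) *
        (B * (alpha m / alpha p.+1)) =
      (C7 * tau ^+ k * 2 * B ^+ 2) * (`|word p.+1 m| * (alpha m / alpha p.+1)) by ring.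
    have -> : z * (C12 * tau ^+ k) = (C7 * tau ^+ k * 2 * B ^+ 2) * (C11 * z).
      by rewrite /C12; ring.
    by apply: ler_wpM2l nw; rewrite !mulr_ge0.
  have h4 : `|w *m word p m| * (alpha m / alpha p) <= (z - 1) + z * (C12 * tau ^+ k).
    rewrite -h2; apply: le_trans (ler_wpM2r (ltW r0) h1) _.
    by rewrite mulrDl; apply: lerD.
  by rewrite mulrDr mulr1; move: h4; rewrite !mulrA; lra.
apply: (le_trans step); rewrite /P big_ord_recr/= mulrA.
apply: ler_wpM2r IH.
by rewrite addr_ge0// mulr_ge0// exprn_ge0// ltW.
Qed.

Lemma norm_word_mul m : (m <= N)%N ->
  `|word 0 m| * `|word m N| <=
    C5 * C11 * 2 * expR (C12 / (1 - tau)) * `|word 0 N|.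
Proof.
move=> mN; have [w [w1 wp]] := normal_row (leq0n N).
have am := alpha_gt0 mN; have a0 := alpha_gt0 (leq0n N).
have := @normal_row_growth m m w (leqnn m) mN w1; rewrite subnn => /(_ wp) gr.
have nw := norm_word_normal (leq0n m) mN w1 wp.
have pe : \prod_(j < m) (1 + C12 * tau ^+ j) <= expR (C12 / (1 - tau)).
  apply: (@le_trans _ _ (\prod_(j < m) expR (C12 * tau ^+ j))).
    apply: ler_prod => j _; rewrite expR_ge1Dx andbT.
    by rewrite addr_ge0// mulr_ge0// exprn_ge0// ltW.
  rewrite -expR_sum ler_expR -mulr_sumr ler_wpM2l//; exact: geo_sum_le.
have h1 : `|word 0 m| * (alpha m / alpha 0) <=
    C11 * (2 * expR (C12 / (1 - tau))).
  apply: (le_trans nw); apply: ler_wpM2l => //; apply: (le_trans gr).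
  by rewrite ler_wpM2l.
have h2 : `|word 0 m| * alpha m <= C11 * (2 * expR (C12 / (1 - tau))) * alpha 0.
  by rewrite -ler_pdivrMr// -mulrA.
have h3 : alpha 0 <= `|word 0 N| by exact: ler_norm_col.
apply: (@le_trans _ _ (`|word 0 m| * (C5 * alpha m))).
  by apply: ler_wpM2l => //; exact: norm_word_alpha.
rewrite mulrCA -!mulrA; apply: ler_wpM2l => //; apply: (le_trans h2).
rewrite -!mulrA; apply: ler_wpM2l => //; apply: ler_wpM2l => //.
by apply: ler_wpM2l => //; exact: expR_ge0.
Qed.

End NearMultiplicativityWords.

Section NearMultiplicativityConclusion.
Variables (R : realType) (d : nat).
Local Notation M := 'M[R]_d.+1.

Lemma geo_small (C e t : R) : 0 < e -> 0 < t -> t < 1 ->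
  exists n0, forall n, (n0 <= n)%N -> C * t ^+ n <= e.
Proof.
move=> e0 t0 t1.
have /cvgrPdist_le h : C * t ^+ n @[n --> \oo] --> C * 0.
  apply: cvgM; first exact: cvg_cst.
  by apply: cvg_expr; rewrite gtr0_norm.
have [n0 _ hn] := h _ e0; exists n0 => n /hn /=.
rewrite mulr0 sub0r normrN; apply: le_trans; exact: ler_norm.
Qed.

Lemma word_tr (g : nat -> M) N p q : (p <= q)%N -> (q <= N)%N ->
  word (fun i => (g (N - i.+1)%N)^T) p q = (word g (N - q) (N - p))^T.
Proof.
move=> /subnK <-; elim: (q - p)%N => [|k IH] kN.
  by rewrite add0n !word_nil trmx1.
rewrite addSn word_rcons ?leq_addl// IH; last exact: ltnW.
rewrite [in RHS]word_cons; last first.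
  by move: kN; lia.
by rewrite trmx_mul subnSK.
Qed.

Variables (b C0 tau : R).
Hypotheses (b1 : 1 <= b) (C01 : 1 <= C0) (tau0 : 0 < tau) (tau1 : tau < 1).

(** Stability of expanding rows, by transposing and reversing words. *)
Lemma row_stable (g : nat -> M) N p p' u v u' v' :
  (forall i, g i \in unitmx) -> (forall i, `|g i| <= b) ->
  (forall i, `|invmx (g i)| <= b) ->
  (forall p q, (p <= q <= N)%N -> exists u v,
     near_rank1 (C0 * tau ^+ (q - p)) (word g p q) u v) ->
  (p <= p')%N -> (p' <= N)%N ->
  near_rank1 (C0 * tau ^+ (N - p')) (word g p' N) u v ->
  near_rank1 (C0 * tau ^+ (N - p)) (word g p N) u' v' ->
  sdist v v' <= 8 * (d.+1%:R * b) ^+ 2 * C0 * (2 / (1 - tau)) * tau ^+ (N - p').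
Proof.
move=> gu gb gVb gr pp' p'N uv uv'.
have pN := leq_trans pp' p'N.
have h4 : forall r q, (r <= q <= N)%N -> exists u v,
    near_rank1 (C0 * tau ^+ (q - r)) (word (fun i => (g (N - i.+1)%N)^T) r q) u v.
  move=> r q /andP[rq qN]; rewrite word_tr//.
  have [|x [y xy]] := gr (N - q)%N (N - r)%N; first by rewrite leq_sub2l// leq_subr.
  exists y^T, x^T; have -> : (q - r = N - r - (N - q))%N by lia.
  exact: near_rank1_tr.
rewrite -sdist_tr -(subn0 (N - p')%N).
apply: (@col_stable R d b C0 tau (fun i => (g (N - i.+1)%N)^T) N b1 C01 tau0 tau1
  _ _ _ h4 0%N (N - p')%N (N - p)%N v^T u^T v'^T u'^T) => //.
- by move=> i; rewrite unitmx_tr.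
- by move=> i; rewrite norm_trmx.
- by move=> i; rewrite -trmx_inv norm_trmx.
- exact: leq_sub2l.
- exact: leq_subr.
- rewrite word_tr ?leq_subr// !subn0 subKn//; exact: near_rank1_tr.
- rewrite word_tr ?leq_subr// !subn0 subKn//; exact: near_rank1_tr.
Qed.

(** Cancellation in products is excluded by the closeness of all subwords to
    rank one, because the expanded direction of a word then depends little on
    its distant letters. The constant comes from a convergent infinite product
    over the lengths of the subwords, see [normal_row_growth]. *)
Theorem near_multiplicativity : exists2 M0 : R, 0 < M0 &
  forall (g : nat -> M) N,
  (forall i, g i \in unitmx) -> (forall i, `|g i| <= b) ->
  (forall i, `|invmx (g i)| <= b) ->
  (forall p q, (p <= q <= N)%N -> exists u v,
     near_rank1 (C0 * tau ^+ (q - p)) (word g p q) u v) ->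
  forall m, (m <= N)%N ->
  `|word g 0 m| * `|word g m N| <= M0 * `|word g 0 N|.
Proof.
have e0 : 0 < 8^-1 :> R by [].
have [n0 n0P] := geo_small (8 * (d.+1%:R * b) ^+ 2 * C0 * (2 / (1 - tau))) e0 tau0 tau1.
have e1 : 0 < 2^-1 :> R by [].
set C3 := 8 * _ * _ * _ in n0P.
set C5 : R := 8 + (d.+1%:R * b) ^+ (n0 + n0).
set C6 : R := 2 * C5 * C0 + C3.
set C7 : R := (1 + C0) * d.+1%:R * C6 + d.+1%:R * C0.
have [n1 n1P] := geo_small (2 * C7) e1 tau0 tau1.
set C11 : R := 2 + (d.+1%:R * b) ^+ (n1 + n1).
set C12 : R := 2 * (d.+1%:R * b) ^+ 2 * C7 * C11.
exists (`|C5 * C11 * 2 * expR (C12 / (1 - tau))| + 1); first by rewrite ltr_wpDl.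
move=> g N gu gb gVb gr m mN.
have [|u0 [v0 uv0]] := gr 0%N N; first by rewrite leqnn.
have [i [j0 j0P]] := mx_norm_attained v0.
have v01 : `|v0| = 1 by case: uv0.
rewrite ord1 v01 in j0P.
have h := @norm_word_mul R d b C0 tau g N b1 C01 tau0 tau1 gu gb gVb gr n0 n0P
  _ u0 v0 j0 uv0 j0P n1 n1P m mN.
apply: le_trans (h _) _.
  by move=> p p' u v u' v' pp' p'N uv uv'; exact: (row_stable gu gb gVb gr pp' p'N uv uv').
apply: ler_wpM2r => //; apply: (le_trans (ler_norm _)); by rewrite lerDl.
Qed.

End NearMultiplicativityConclusion.

(** * The matrix exponential *)

Section MatrixLimits.
Variable R : realType.

Lemma right_nbhs_witness (p : R -> Prop) : (\forall r \near (0 : R)^'+, p r) ->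
  exists2 r : R, 0 < r & p r.
Proof.
move=> h; near (0 : R)^'+ => r; exists r; last by near: r.
by near: r; exact: nbhs_right_gt.
Unshelve. all: by end_near. Qed.

Lemma cvg_norm_le (V : normedModType R) (u : nat -> V) (L a : V) (c : R) :
  u @ \oo --> L -> (\forall k \near \oo, `|u k - a| <= c) -> `|L - a| <= c.
Proof.
move=> /cvgrPdist_le uL ua; apply/ler_addgt0Pr => e e0.
have [k [/= ka kL]] := filter_ex (filterI ua (uL e e0)).
have -> : L - a = (u k - a) + (L - u k) by rewrite [RHS]addrC addrA subrK.
by rewrite (le_trans (ler_normD _ _))// lerD.
Qed.

Lemma cvg_mx m n (u : nat -> 'M[R]_(m, n)) (L : 'M[R]_(m, n)) :
  (forall i j, u k i j @[k --> \oo] --> L i j) -> u @ \oo --> L.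
Proof.
move=> h; apply/cvgrPdist_le => e e0.
have H : \forall k \near \oo, forall ij : 'I_m * 'I_n,
    `|L ij.1 ij.2 - u k ij.1 ij.2| <= e.
  by apply: filter_forall => -[i j]; have /cvgrPdist_le := h i j; exact.
near=> k; apply: mx_norm_le (ltW e0) _ => i j; rewrite !mxE.
by have := near H k; move=> /(_ _) /(_ (i, j)); apply.
Unshelve. all: by end_near. Qed.

Lemma linear_mx_cvg m n (V : normedModType R) (f : {linear 'M[R]_(m, n) -> V})
    (u : nat -> 'M[R]_(m, n)) L : u @ \oo --> L -> f (u k) @[k --> \oo] --> f L.
Proof.
move=> /cvgrPdist_le h; apply/cvgrPdist_le => e e0.
have [C C0 hC] := linear_mx_bounded f.
have e1 : 0 < e / C by rewrite divr_gt0.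
near=> k; rewrite -linearB (le_trans (hC _))// mulrC -ler_pdivlMr//.
by near: k; exact: h.
Unshelve. all: by end_near. Qed.

Lemma linear_mx_continuous m n (V : normedModType R)
    (f : {linear 'M[R]_(m, n) -> V}) : continuous f.
Proof.
move=> A; have [C C0 hC] := linear_mx_bounded f.
apply/(@cvgrPdist_le _ _ _ (nbhs A)) => e e0.
have e1 : 0 < e / C by rewrite divr_gt0.
have : nbhs A (ball A (e / C)) by exact: nbhsx_ballx.
apply: filterS => B; rewrite -ball_normE/= => /ltW h.
by rewrite -linearB (le_trans (hC _))// mulrC -ler_pdivlMr.
Qed.

End MatrixLimits.

Section MatrixExponential.
Variables (R : realType) (n : nat).
Local Notation M := 'M[R]_n.+1.
Local Notation K := (n.+1%:R : R).

Lemma norm_mx1 : `|1 : M| = 1.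
Proof.
apply/eqP; rewrite eq_le; apply/andP; split.
  by apply: mx_norm_le => // i j; rewrite mxE; case: eqP; rewrite ?normr1 ?normr0.
by rewrite (le_trans _ (entry_le_norm _ ord0 ord0))// mxE eqxx normr1.
Qed.

Lemma norm_mulr_mx (A B : M) : `|A * B| <= K * `|A| * `|B|.
Proof. exact: norm_mulmx_le. Qed.

Lemma norm_expr_mx (X : M) k : `|X ^+ k| <= (K * `|X|) ^+ k.
Proof.
elim: k => [|k IH]; first by rewrite !expr0 norm_mx1.
rewrite !exprS (le_trans (norm_mulr_mx _ _))// ler_wpM2l//.
Qed.

Definition exp_part (X : M) := series (fun k => (k`!%:R)^-1 *: X ^+ k).

Lemma norm_exp_term (X : M) k :
  `|(k`!%:R)^-1 *: X ^+ k| <= exp_coeff (K * `|X|) k.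
Proof.
rewrite /exp_coeff normrZ ger0_norm ?invr_ge0// mulrC.
by apply: ler_wpM2r; rewrite ?invr_ge0// norm_expr_mx.
Qed.

Lemma expmx_cvg (X : M) : exp_part X @ \oo --> expmx X.
Proof.
have h : forall i j, cvgn (series (fun k => ((k`!%:R)^-1 *: X ^+ k) i j)).
  move=> i j; apply: normed_cvg => /=.
  apply: (@series_le_cvg _ _ (exp_coeff (K * `|X|))) => //.
  - by move=> k /=.
  - by move=> k; apply: exp_coeff_ge0; rewrite mulr_ge0.
  - by move=> k /=; rewrite (le_trans (entry_le_norm _ _ _))// norm_exp_term.
  - exact: is_cvg_series_exp_coeff.
have h2 : exp_part X @ \oo -->
    \matrix_(i, j) limn (series (fun k => ((k`!%:R)^-1 *: X ^+ k) i j)).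
  apply: cvg_mx => i j; rewrite mxE.
  have -> : (fun k => exp_part X k i j) =
      series (fun k => ((k`!%:R)^-1 *: X ^+ k) i j).
    by apply/funext => k; rewrite /exp_part /series/= summxE.
  exact: h.
by rewrite /expmx (cvg_lim _ h2).
Qed.

Lemma exp_partial_le (x : R) N : 0 <= x -> series (exp_coeff x) N <= expR x.
Proof.
move=> x0; rewrite /expR; apply: nondecreasing_cvgn_le.
  apply: nondecreasing_series => k _ _; exact: exp_coeff_ge0.
exact: is_cvg_series_exp_coeff.
Qed.

Lemma expmx_taylor (X : M) :
  `|expmx X - (1 + X)| <= (K * `|X|) ^+ 2 * expR (K * `|X|).
Proof.
apply: (cvg_norm_le (@expmx_cvg X)); exists 2%N => // N /= N2.
have x0 : 0 <= K * `|X| by rewrite mulr_ge0.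
rewrite /exp_part /series/= big_mkord.
move: N2 => /subnK <-; rewrite addn2.
rewrite 2!big_ord_recl/= expr0 invr1 scale1r /bump/= ?addn0.
rewrite scale1r expr1 addrA [X in `|X|]addrC addKr.
rewrite (le_trans (ler_norm_sum _ _ _))//.
apply: le_trans (ler_wpM2l (exprn_ge0 2 x0) (exp_partial_le (N - 2)%N x0)).
rewrite /series/= big_mkord mulr_sumr ler_sum// => i _.
apply: (le_trans (norm_exp_term _ _)).
rewrite /exp_coeff/= /bump/= !add1n exprS exprS expr2 !mulrA -[leRHS]mulrA -[leLHS]mulrA.
apply: ler_wpM2l; first by rewrite mulr_ge0.
rewrite ler_wpM2l ?exprn_ge0// lef_pV2 ?posrE ?ltr0n ?fact_gt0// ler_nat.
by rewrite !factS mulnA leq_pmull.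
Qed.

Lemma expmx_taylor1 (X : M) : `|X| <= 1 ->
  `|expmx X - (1 + X)| <= (K ^+ 2 * expR K) * `|X| ^+ 2.
Proof.
move=> X1; apply: (le_trans (expmx_taylor X)).
rewrite exprMn mulrAC; apply: ler_wpM2r; first exact: exprn_ge0.
by apply: ler_wpM2l; [exact: exprn_ge0|rewrite ler_expR ler_piMr].
Qed.

End MatrixExponential.

Lemma horner_mx_poly (F : comNzRingType) n (X : 'M[F]_n.+1) N (c : nat -> F) :
  horner_mx X (\poly_(i < N) c i) = \sum_(i < N) c i *: X ^+ i.
Proof.
rewrite poly_def rmorph_sum; apply: eq_bigr => i _ /=.
by rewrite linearZ/= rmorphXn/= horner_mx_X.
Qed.

(** The functional equation is proved on partial sums, which are polynomials
    in [X]: the product of two of them agrees with the partial sum for [s + t]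
    in low degree, and its remaining coefficients are dominated by the tail of
    a scalar exponential series. *)
Section MatrixExponentialGroup.
Variables (R : realType) (n : nat).
Local Notation M := 'M[R]_n.+1.
Local Notation K := (n.+1%:R : R).

Let ep (s : R) N : {poly R} := \poly_(i < N) (s ^+ i / i`!%:R).

Let ep_exp (s : R) (X : M) N : horner_mx X (ep s N) = exp_part (s *: X) N.
Proof.
rewrite horner_mx_poly /exp_part /series/= big_mkord; apply: eq_bigr => i _.
by rewrite exprZn scalerA mulrC.
Qed.

Let binom_exp (s t : R) k :
  \sum_(i < k.+1) (s ^+ i / i`!%:R) * (t ^+ (k - i) / (k - i)`!%:R) =
  (s + t) ^+ k / k`!%:R.
Proof.
rewrite addrC exprDn mulr_suml; apply: eq_bigr => i _.
have ik : (i <= k)%N by rewrite -ltnS.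
have nz j : j`!%:R != 0 :> R by rewrite pnatr_eq0 -lt0n fact_gt0.
rewrite -mulr_natr -(bin_fact ik) !natrM.
have b0 : 'C(k, i)%:R != 0 :> R by rewrite pnatr_eq0 -lt0n bin_gt0.
by field; rewrite !nz b0.
Qed.

Let ep_mul_low s t N k : (k < N)%N -> (ep s N * ep t N)`_k = (s + t) ^+ k / k`!%:R.
Proof.
move=> kN; rewrite coefM -binom_exp; apply: eq_bigr => i _.
have ik : (i <= k)%N by rewrite -ltnS.
by rewrite !coef_poly (leq_ltn_trans ik kN) (leq_ltn_trans (leq_subr _ _) kN).
Qed.

Let ep_mul_bound s t N k :
  `|(ep s N * ep t N)`_k| <= (`|s| + `|t|) ^+ k / k`!%:R.
Proof.
have h u i : `|(ep u N)`_i| <= `|u| ^+ i / i`!%:R.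
  rewrite coef_poly; case: ifP => _; last by rewrite normr0 divr_ge0// exprn_ge0.
  by rewrite normrM normrX normfV (ger0_norm (ler0n _ _)).
rewrite coefM -binom_exp (le_trans (ler_norm_sum _ _ _))// ler_sum// => i _.
by rewrite normrM; apply: ler_pM.
Qed.

Lemma exp_part_mul (X : M) (s t : R) N :
  `|exp_part (s *: X) N * exp_part (t *: X) N - exp_part ((s + t) *: X) N| <=
  series (exp_coeff ((`|s| + `|t|) * (K * `|X|))) (N + N)%N -
  series (exp_coeff ((`|s| + `|t|) * (K * `|X|))) N.
Proof.
rewrite -!ep_exp -rmorphM/= -rmorphB/=.
set p := _ * _ - _.
have sp : (size p <= N + N)%N.
  rewrite (leq_trans (size_polyD _ _))// geq_max size_polyN.
  rewrite (leq_trans (size_polyMleq _ _))/=; last first.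
    by rewrite (leq_trans (leq_pred _))// leq_add// size_poly.
  by rewrite (leq_trans (size_poly _ _))// leq_addr.
have -> : p = \poly_(i < N + N) p`_i.
  apply/polyP => i; rewrite coef_poly; case: ifP => // /negbT; rewrite -leqNgt => h.
  by rewrite nth_default// (leq_trans sp).
rewrite horner_mx_poly -(big_mkord xpredT (fun i => p`_i *: X ^+ i)).
rewrite (big_cat_nat (n := N))//= ?leq_addr// big_nat_cond big1 ?add0r; last first.
  move=> i; rewrite andbT => /andP[_ iN].
  by rewrite coefB ep_mul_low// coef_poly iN subrr scale0r.
rewrite /series/= [X in _ <= X - _](big_cat_nat (n := N))//= ?leq_addr//.
rewrite [X in X - _]addrC addrK (le_trans (ler_norm_sum _ _ _))//.
apply: ler_sum_nat => i /andP[Ni _].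
rewrite normrZ /exp_coeff/= exprMn mulrAC; apply: ler_pM => //; last first.
  exact: norm_expr_mx.
rewrite coefB [X in _ - X]coef_poly ltnNge Ni/= subr0; exact: ep_mul_bound.
Qed.

Lemma expmxDl (X : M) (s t : R) :
  expmx ((s + t) *: X) = expmx (s *: X) * expmx (t *: X).
Proof.
set E := expmx (s *: X); set F := expmx (t *: X); set G := expmx _.
have cE := @expmx_cvg R n (s *: X); have cF := @expmx_cvg R n (t *: X).
have cG := @expmx_cvg R n ((s + t) *: X).
rewrite -/E -/F -/G in cE cF cG.
set x := (`|s| + `|t|) * (K * `|X|).
have cx := @is_cvg_series_exp_coeff R x.
apply/eqP; rewrite -subr_eq0 -normr_le0; apply/ler_addgt0Pr => e e0; rewrite add0r.
pose L := 1 + K * (`|E| + 1) + K * `|F| + 2.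
have L0 : 0 < L.
  by rewrite /L; have : 0 <= K * (`|E| + 1) by []; have : 0 <= K * `|F| by []; lra.
pose e1 := Num.min 1 (e / L).
have e10 : 0 < e1 by rewrite lt_min ltr01 divr_gt0.
have e11 : e1 <= 1 by rewrite ge_min lexx.
have e1L : e1 * L <= e by rewrite -ler_pdivlMr// ge_min lexx orbT.
have /cvgrPdist_le/(_ _ e10) hE := cE.
have /cvgrPdist_le/(_ _ e10) hF := cF.
have /cvgrPdist_le/(_ _ e10) [NG _ hG] := cG.
have /cvgrPdist_le/(_ _ e10) [Nx _ hx] := cx.
have [N [/= [hE' hF'] [hN1 hN2]]] := filter_ex (filterI (filterI hE hF)
  (filterI (nbhs_infty_ge NG) (nbhs_infty_ge Nx))).
have hG' := hG N hN1.
have hx1 := hx N hN2; have hx2 := hx (N + N)%N (leq_trans hN2 (leq_addr _ _)).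
have hm := exp_part_mul X s t N.
rewrite -/x in hm.
have hm2 : `|exp_part (s *: X) N * exp_part (t *: X) N - exp_part ((s + t) *: X) N|
    <= 2 * e1.
  apply: (le_trans hm); move: hx1 hx2; rewrite /= !ler_norml => /andP[? ?] /andP[? ?].
  lra.
set EN := exp_part (s *: X) N in hE' hm2.
set FN := exp_part (t *: X) N in hF' hm2.
set GN := exp_part _ N in hG' hm2.
have -> : G - E * F = (G - GN) - (EN * FN - GN) - (E - EN) * F - EN * (F - FN).
  by rewrite mulrBl mulrBr; move: (E * F) (EN * F) (EN * FN) => A B C;
    apply/matrixP => i j; rewrite !mxE; ring.
have EN1 : `|EN| <= `|E| + 1.
  have -> : EN = E - (E - EN) by rewrite opprB addrC subrK.
  by rewrite (le_trans (ler_normB _ _))// lerD2l (le_trans hE').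
have t3 : `|(E - EN) * F| <= K * `|F| * e1.
  by rewrite (le_trans (norm_mulr_mx _ _))// mulrAC ler_wpM2l.
have t4 : `|EN * (F - FN)| <= K * (`|E| + 1) * e1.
  rewrite (le_trans (norm_mulr_mx _ _))//; apply: ler_pM => //.
  by rewrite ler_wpM2l.
have tri (a b c d : M) : `|a - b - c - d| <= `|a| + `|b| + `|c| + `|d|.
  do 3![apply: le_trans (ler_normB _ _) _; apply: lerD => //].
apply: le_trans (tri _ _ _ _) _; apply: le_trans e1L; rewrite /L; lra.
Qed.

Lemma expmx0 : expmx (0 : M) = 1.
Proof.
have := expmx_taylor (0 : M); rewrite normr0 mulr0 expr0n/= mul0r addr0.
by rewrite normr_le0 subr_eq0 => /eqP.
Qed.

Lemma expmxVl (X : M) (t : R) : expmx (- t *: X) * expmx (t *: X) = 1.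
Proof. by rewrite -expmxDl addrC subrr scale0r expmx0. Qed.

Lemma expmx_unit (X : M) : expmx X \in unitmx.
Proof.
have := expmxVl X 1; rewrite scale1r => h.
by apply: (proj2 (mulmx1_unit h)).
Qed.

Lemma invmx_expmx (X : M) : invmx (expmx X) = expmx (- X).
Proof.
have := expmxVl X 1; rewrite scale1r scaleN1r => h.
by rewrite -[LHS]mul1r -h -mulrA [_ * invmx _](mulmxV (expmx_unit X)) mulr1.
Qed.

Lemma expmxM_nat (X : M) (m : nat) : expmx (m%:R *: X) = expmx X ^+ m.
Proof.
elim: m => [|m IH]; first by rewrite scale0r expmx0 expr0.
by rewrite -natr1 exprSr -IH expmxDl scale1r.
Qed.

Lemma expmx_conj (Q X : M) : Q \in unitmx ->
  Q *m expmx X *m invmx Q = expmx (Q *m X *m invmx Q).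
Proof.
move=> Qu.
have h : Q *m exp_part X k *m invmx Q @[k --> \oo] --> Q *m expmx X *m invmx Q.
  have h1 := linear_mx_cvg (f := mulmx Q) (@expmx_cvg R n X).
  exact: (linear_mx_cvg (f := mulmxr (invmx Q)) h1).
have h2 := @expmx_cvg R n (Q *m X *m invmx Q).
apply: (cvg_unique _ h) => //.
rewrite (_ : (fun k => _) = exp_part (Q *m X *m invmx Q))//.
apply/funext => k; rewrite /exp_part /series/= mulmx_sumr mulmx_suml.
apply: eq_bigr => i _; rewrite -scalemxAr -scalemxAl; congr (_ *: _).
elim: i => [|i IH]; first by rewrite !expr0 mulmx1 mulmxV.
by rewrite !exprSr -IH -!mulmxE !mulmxA mulmxKV.
Qed.

Lemma expmx_diag (D : M) : is_diag_mx D ->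
  expmx D = \matrix_(i, j) (if i == j then expR (D i i) else 0).
Proof.
move=> /is_diag_mxP dD.
apply: (cvg_unique _ (@expmx_cvg R n D)) => //; apply: cvg_mx => i j; rewrite mxE.
have hk k : (D ^+ k) i j = if i == j then D i i ^+ k else 0.
  elim: k j => [|k IH] j; first by rewrite !expr0 mxE; case: eqP.
  rewrite exprSr mxE (bigD1 i)//= big1 ?addr0 => [|l li].
    rewrite IH eqxx; case: eqVneq => [<-|ij]; first by rewrite exprSr.
    by rewrite (dD _ _ ij) mulr0.
  by rewrite IH eq_sym (negbTE li) mul0r.
rewrite (_ : (fun k => _) = if i == j then series (exp_coeff (D i i)) else fun=> 0).
  case: ifP => _; first exact: is_cvg_series_exp_coeff.
  exact: cvg_cst.
apply/funext => k; rewrite /exp_part /series/= summxE.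
case: ifP => ij; last by apply: big1 => l _; rewrite mxE hk ij mulr0.
by apply: eq_bigr => l _; rewrite mxE hk ij mulrC.
Qed.

Lemma norm_mul_near1 m (A : 'M[R]_(m, n.+1)) (B : M) c : `|B - 1| <= c ->
  `|A *m B| <= `|A| * (1 + K * c).
Proof.
move=> h; rewrite -[B](subrK 1) addrC mulmxDr mulmx1 (le_trans (ler_normD _ _))//.
rewrite mulrDr mulr1 lerD2l (le_trans (norm_mulmx_le _ _))//.
by rewrite mulrCA mulrA ler_wpM2l.
Qed.

(** Powers of two matrices close to the identity stay close for as long as the
    number of factors is comparable with the inverse of that distance. *)
Lemma norm_expr_sub (A B : M) c m : `|A - 1| <= c -> `|B - 1| <= c ->
  `|A ^+ m - B ^+ m| <= m%:R * K * `|A - B| * expR (m%:R * (K * c)).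
Proof.
move=> hA hB; have c0 : 0 <= c by exact: le_trans hA.
have q1 : 1 <= 1 + K * c by rewrite lerDl mulr_ge0.
have q0 : 0 <= 1 + K * c by exact: le_trans q1.
have pw k : `|A ^+ k| <= (1 + K * c) ^+ k.
  elim: k => [|k IH]; first by rewrite !expr0 norm_mx1.
  by rewrite !exprSr (le_trans (norm_mul_near1 _ hA))// ler_wpM2r.
have main : `|A ^+ m - B ^+ m| <= m%:R * K * `|A - B| * (1 + K * c) ^+ m.
  elim: m => [|m IH]; first by rewrite !expr0 subrr normr0 !mul0r.
  have -> : A ^+ m.+1 - B ^+ m.+1 = A ^+ m * (A - B) + (A ^+ m - B ^+ m) * B.
    by rewrite !exprSr mulrBr mulrBl addrA subrK.
  rewrite (le_trans (ler_normD _ _))//.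
  have h1 : `|A ^+ m * (A - B)| <= K * `|A - B| * (1 + K * c) ^+ m.+1.
    rewrite (le_trans (norm_mulr_mx _ _))// mulrAC ler_wpM2l// ?mulr_ge0//.
    by rewrite (le_trans (pw m))// exprS ler_peMl// exprn_ge0.
  have h2 : `|(A ^+ m - B ^+ m) * B| <= m%:R * K * `|A - B| * (1 + K * c) ^+ m.+1.
    rewrite (le_trans (norm_mul_near1 _ hB))// exprSr mulrA ler_wpM2r//.
  have -> : m.+1%:R * K * `|A - B| * (1 + K * c) ^+ m.+1 =
    K * `|A - B| * (1 + K * c) ^+ m.+1 + m%:R * K * `|A - B| * (1 + K * c) ^+ m.+1.
    by rewrite -natr1; ring.
  exact: lerD.
apply: (le_trans main); apply: ler_wpM2l; first by rewrite !mulr_ge0.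
rewrite expRM_natl.
by rewrite lerXn2r ?nnegrE ?expR_ge0// expR_ge1Dx.
Qed.

End MatrixExponentialGroup.

(** * Closed subgroups of the linear group *)

Section ClosedSubgroups.
Variables (R : realType) (n : nat).
Local Notation M := 'M[R]_n.+1.
Local Notation K := (n.+1%:R : R).

(** Closed in the invertible matrices, not in the space of all matrices. *)
Definition closed_subgroup_GL (G : set M) : Prop :=
  [/\ G `<=` [set g | g \in unitmx], G 1,
      forall x y, G x -> G y -> G (x * y),
      forall x, G x -> G (invmx x) &
      forall x, x \in unitmx ->
        (forall e : R, 0 < e -> exists2 y, G y & `|x - y| <= e) -> G x].

Lemma closed_bounded_compact_mx m p (A : set 'M[R]_(m, p)) :
  bounded_set A -> closed A -> compact A.
Proof.
move=> bA cA.
have cont : continuous (@vec_mx R m p) by exact: linear_mx_continuous.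
have -> : A = vec_mx @` (vec_mx @^-1` A).
  apply/seteqP; split=> [x Ax|x [v Av <-]//].
  by exists (mxvec x); rewrite /= mxvecK.
apply: continuous_compact; first by apply: continuous_subspaceT => x; exact: cont.
apply: bounded_closed_compact; last first.
  by apply: preimage_closed => // x _; exact: cont.
have [C [Cr hC]] := bA; exists C; split => // x Cx v Av.
apply: le_trans (hC x Cx (vec_mx v) Av).
apply: mx_norm_le => // i j; rewrite ord1.
by case/mxvec_indexP: j => k l; rewrite -[v]vec_mxK mxvecE vec_mxK entry_le_norm.
Qed.

Lemma unit_sphere_compact : compact [set Z : M | `|Z| = 1].
Proof.
apply: closed_bounded_compact_mx.
  by exists 1; split; rewrite ?realE ?ler01// => x x1 Z /= ->; exact: ltW.
rewrite (_ : [set Z : M | _] = (fun Z : M => `|Z|) @^-1` [set 1])//.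
apply: preimage_closed; last exact: closed_eq.
by move=> x _; exact: norm_continuous.
Qed.

Let taylorC : R := K ^+ 2 * expR K.

Let taylorC0 : 0 <= taylorC.
Proof. by rewrite mulr_ge0// ?exprn_ge0// expR_ge0. Qed.

Lemma expmx_near1 (Z : M) (r : R) : 0 <= r -> r <= 1 -> `|Z| = 1 ->
  `|expmx (r *: Z) - (1 + r *: Z)| <= taylorC * r ^+ 2.
Proof.
move=> r0 r1 Z1; have nz : `|r *: Z| = r by rewrite normrZ Z1 mulr1 ger0_norm.
by have := @expmx_taylor1 R n (r *: Z); rewrite nz => /(_ r1).
Qed.

Lemma expmx_sub1 (Z : M) (r : R) : 0 <= r -> r <= 1 -> `|Z| = 1 ->
  `|expmx (r *: Z) - 1| <= (1 + taylorC) * r.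
Proof.
move=> r0 r1 Z1.
have -> : expmx (r *: Z) - 1 = (expmx (r *: Z) - (1 + r *: Z)) + r *: Z.
  by rewrite opprD addrA subrK.
rewrite (le_trans (ler_normD _ _))// normrZ Z1 mulr1 (ger0_norm r0).
rewrite mulrDl mul1r addrC lerD2l (le_trans (expmx_near1 r0 r1 Z1))//.
by rewrite ler_wpM2l// expr2 ler_piMr.
Qed.

(** Limits of directions in which a closed subgroup accumulates at the identity
    are tangent to it: the powers [h ^+ m], with [m] about [t / `|h - 1|], are
    close to [expmx (t *: Z)]. *)
Lemma limit_direction (G : set M) (Z : M) : closed_subgroup_GL G -> `|Z| = 1 ->
  (forall e : R, 0 < e -> exists h, [/\ G h, h != 1, `|h - 1| < e &
      `|h - 1 - `|h - 1| *: Z| <= e * `|h - 1|]) ->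
  lie_algebra G Z.
Proof.
move=> [Gu G1 Gm Gv Gc] Z1 hZ.
have GX x k : G x -> G (x ^+ k).
  by move=> Gx; elim: k => [|k IH]; rewrite ?expr0// exprS; exact: Gm.
suff pos : forall t : R, 0 <= t -> G (expmx (t *: Z)).
  move=> t; have [t0|t0] := leP 0 t; first exact: pos.
  have := Gv _ (pos (- t) _); rewrite oppr_ge0 invmx_expmx scaleNr opprK.
  by apply; exact: ltW.
move=> t t0; apply: Gc; first exact: expmx_unit.
move=> e e0.
pose D : R := 1 + taylorC.
have D0 : 0 <= D by rewrite addr_ge0.
pose E := expR (t * (K * D)).
have E0 : 0 <= E by exact: expR_ge0.
pose L : R := t * K * D * E + K * E * D + 1.
have L0 : 0 < L by rewrite ltr_wpDl// addr_ge0// !mulr_ge0.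
pose d := Num.min 1 (e / L).
have d0 : 0 < d by rewrite lt_min ltr01 divr_gt0.
have d1 : d <= 1 by rewrite ge_min lexx.
have dL : d * L <= e by rewrite -ler_pdivlMr// ge_min lexx orbT.
have [h [Gh h1 hd hh]] := hZ d d0.
set r := `|h - 1| in hd hh.
have r0 : 0 < r by rewrite normr_gt0 subr_eq0.
have r1 : r <= 1 by rewrite (le_trans (ltW hd)).
have r0' := ltW r0.
have tr0 : 0 <= t / r by rewrite divr_ge0.
pose m := Num.truncn (t / r).
have /andP[m1 m2] := truncn_itv tr0; rewrite -/m in m1 m2.
pose s := t - m%:R * r.
have s0 : 0 <= s by rewrite subr_ge0 -ler_pdivlMr.
have sr : s <= r.
  by rewrite /s lerBlDl -[X in _ + X]mul1r -mulrDl -ler_pdivrMr// natr1 ltW.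
have mr : m%:R * r <= t by rewrite -ler_pdivlMr.
exists (h ^+ m); first exact: GX.
have hr : `|h - expmx (r *: Z)| <= D * d * r.
  have -> : h - expmx (r *: Z) = (h - 1 - r *: Z) - (expmx (r *: Z) - (1 + r *: Z)).
    by move: (expmx _) => X; apply/matrixP => i j; rewrite !mxE; ring.
  rewrite (le_trans (ler_normB _ _))// /D -mulrA mulrDl mul1r lerD//.
  rewrite (le_trans (expmx_near1 r0' r1 Z1))// ler_wpM2l// expr2 ler_wpM2r// ltW//.
have c1 : `|h - 1| <= D * r.
  by rewrite -/r ler_peMl// /D lerDl.
have c2 := expmx_sub1 r0' r1 Z1; rewrite -/D in c2.
have mKD : m%:R * (K * (D * r)) <= t * (K * D).
  have -> : m%:R * (K * (D * r)) = (m%:R * r) * (K * D) by ring.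
  by rewrite ler_wpM2r// mulr_ge0.
have h2 : `|h ^+ m - expmx (r *: Z) ^+ m| <= d * (t * K * D * E).
  rewrite (le_trans (norm_expr_sub m c1 c2))//.
  have -> : d * (t * K * D * E) = (t * K * (D * d)) * E by ring.
  apply: ler_pM; rewrite ?mulr_ge0 ?expR_ge0 ?ler_expR//.
  apply: (@le_trans _ _ (m%:R * K * (D * d * r))); first by rewrite ler_wpM2l// mulr_ge0.
  have -> : m%:R * K * (D * d * r) = (m%:R * r) * K * (D * d) by ring.
  by rewrite ler_wpM2r// ?ler_wpM2r// mulr_ge0// ltW.
have es : expmx (t *: Z) = expmx (r *: Z) ^+ m * expmx (s *: Z).
  by rewrite -expmxM_nat scalerA -expmxDl /s addrC subrK.
have h3 : `|expmx (r *: Z) ^+ m| <= E.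
  have := norm_expr_sub m c2 (_ : `|1 - 1 : M| <= D * r).
  have pw k : `|expmx (r *: Z) ^+ k| <= (1 + K * (D * r)) ^+ k.
    elim: k => [|k IH]; first by rewrite !expr0 norm_mx1.
    by rewrite !exprSr (le_trans (norm_mul_near1 _ c2))// ler_wpM2r// addr_ge0// !mulr_ge0.
  move=> _; apply: (le_trans (pw m)).
  apply: (@le_trans _ _ (expR (m%:R * (K * (D * r))))); last by rewrite ler_expR.
  by rewrite expRM_natl lerXn2r ?nnegrE ?expR_ge0// ?expR_ge1Dx// addr_ge0// !mulr_ge0.
have h4 : `|expmx (t *: Z) - expmx (r *: Z) ^+ m| <= d * (K * E * D).
  rewrite es -[X in _ - X]mulr1 -mulrBr (le_trans (norm_mulr_mx _ _))//.
  have -> : d * (K * E * D) = K * E * (D * d) by ring.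
  apply: ler_pM => //; rewrite ?mulr_ge0//; first by rewrite ler_wpM2l.
  rewrite (le_trans (expmx_sub1 s0 (le_trans sr r1) Z1))// ler_wpM2l//.
  by rewrite (le_trans sr)// ltW.
have -> : expmx (t *: Z) - h ^+ m =
   (expmx (t *: Z) - expmx (r *: Z) ^+ m) - (h ^+ m - expmx (r *: Z) ^+ m).
  by rewrite opprB addrA subrK.
rewrite (le_trans (ler_normB _ _))// (le_trans (lerD h4 h2))//.
apply: le_trans dL; rewrite /L; lra.
Qed.

End ClosedSubgroups.
Section ClosedSubgroupTheorem.
Variables (R : realType) (n : nat).
Local Notation M := 'M[R]_n.+1.
Local Notation K := (n.+1%:R : R).

(** Nearly closest elements to the identity in the cosets of [H]. *)
Let far (G H : set M) (h : M) : Prop :=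
  [/\ G h, h != 1 & forall h', H h' -> `|h - 1| <= 2 * `|invmx h' * h - 1|].

Let no_far_direction (G H : set M) (Z : M) :
  closed_subgroup_GL G -> (forall X, lie_algebra G X -> H (expmx X)) ->
  `|Z| = 1 -> exists2 e : R, 0 < e & forall h, far G H h -> `|h - 1| < e ->
    ~ `|h - 1 - `|h - 1| *: Z| <= e * `|h - 1|.
Proof.
move=> cG HX Z1; apply: contrapT => none.
have dir (e : R) : 0 < e -> exists h, [/\ far G H h, `|h - 1| < e &
    `|h - 1 - `|h - 1| *: Z| <= e * `|h - 1|].
  move=> e0; apply: contrapT => no; apply: none; exists e => // h fh he hZ.
  by apply: no; exists h.
have LZ : lie_algebra G Z.
  apply: limit_direction cG Z1 _ => e e0.
  by have [h [[Gh h1 _] he hZ]] := dir e e0; exists h.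
have HZ (t : R) : H (expmx (t *: Z)).
  by apply: HX => s; rewrite scalerA; exact: LZ.
pose C : R := K ^+ 2 * expR K.
have C0 : 0 <= C by rewrite mulr_ge0 ?exprn_ge0 ?expR_ge0.
pose L : R := 4 * K * (2 + C) * (1 + C) + 1.
have L0 : 0 < L by rewrite ltr_wpDl// !mulr_ge0// addr_ge0.
pose e : R := Num.min 1 L^-1.
have e0 : 0 < e by rewrite lt_min ltr01 invr_gt0.
have e1 : e <= 1 by rewrite ge_min lexx.
have eL : e * L <= 1 by rewrite -ler_pdivlMr// mul1r ge_min lexx orbT.
have [h [[Gh h1 hfar] he hh]] := dir e e0.
set r := `|h - 1| in he hh.
have r0 : 0 < r by rewrite normr_gt0 subr_eq0.
have r1 : r <= 1 by rewrite (le_trans (ltW he)).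
have := hfar _ (HZ r); rewrite invmx_expmx -scaleNr.
have -> : expmx (- r *: Z) * h - 1 = expmx (- r *: Z) * (h - expmx (r *: Z)).
  by rewrite mulrBr expmxVl.
have mZ : `|- Z| = 1 by rewrite normrN.
have h2 : `|expmx (- r *: Z)| <= 2 + C.
  have := expmx_sub1 (ltW r0) r1 mZ; rewrite scalerN -scaleNr -/C => h2.
  rewrite -[expmx _](subrK 1) (le_trans (ler_normD _ _))// norm_mx1.
  have : (1 + C) * r <= 1 + C by rewrite ler_piMr// addr_ge0.
  lra.
have h3 : `|h - expmx (r *: Z)| <= (1 + C) * e * r.
  have -> : h - expmx (r *: Z) = (h - 1 - r *: Z) - (expmx (r *: Z) - (1 + r *: Z)).
    by move: (expmx _) => X; apply/matrixP => i j; rewrite !mxE; ring.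
  rewrite (le_trans (ler_normB _ _))// -mulrA mulrDl mul1r lerD//.
  rewrite (le_trans (expmx_near1 (ltW r0) r1 Z1))// ler_wpM2l// expr2 ler_wpM2r//;
    exact: ltW.
have h4 : `|expmx (- r *: Z) * (h - expmx (r *: Z))| <= K * (2 + C) * ((1 + C) * e * r).
  rewrite (le_trans (norm_mulr_mx _ _))//; apply: ler_pM; rewrite ?mulr_ge0//.
  by rewrite ler_wpM2l.
rewrite -/r => h5.
have h6 : 4 * (K * (2 + C) * ((1 + C) * e * r)) = (e * L - e) * r by rewrite /L; ring.
have h7 : (e * L - e) * r < r.
  by rewrite -[ltRHS]mul1r ltr_pM2r//; lra.
lra.
Qed.

Let no_far (G H : set M) : closed_subgroup_GL G ->
  (forall X, lie_algebra G X -> H (expmx X)) ->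
  exists2 r : R, 0 < r & forall h, far G H h -> `|h - 1| < r -> False.
Proof.
move=> cG HX.
pose p r Z := forall h, far G H h -> `|h - 1| < r -> h - 1 <> `|h - 1| *: Z.
have [|r r0 hr] := @right_nbhs_witness R (fun r => [set Z : M | `|Z| = 1] `<=` p r).
  apply: (proj1 (compact_near_coveringP _) (@unit_sphere_compact R n)) => Z /= Z1.
  have [e e0 he] := no_far_direction cG HX Z1.
  exists (ball Z e, [set r | r < e]); first split => /=.
  - exact: nbhsx_ballx.
  - exact: nbhs_right_lt.
  move=> [Y r] /=; rewrite -ball_normE/= => -[ZY re] h fh hr hY.
  apply: (he h fh (lt_trans hr re)).
  by rewrite {1}hY -scalerBr normrZ normr_id mulrC ler_wpM2r// distrC ltW.
exists r => // h fh hlt; have [_ h1 _] := fh.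
have nh : 0 < `|h - 1| by rewrite normr_gt0 subr_eq0.
apply: (hr (`|h - 1|^-1 *: (h - 1)) _ h fh hlt) => /=.
  by rewrite normrZ gtr0_norm ?invr_gt0// mulVf// gt_eqF.
by rewrite scalerA divff ?gt_eqF// scale1r.
Qed.

(** A closed subgroup with the same Lie algebra is open, hence everything.
    Openness: otherwise, dividing points of [G] close to the identity by
    nearly closest elements of [H] gives points of [G] that accumulate at the
    identity along a direction tangent to [G]; but moving along this direction,
    which [H] allows, would bring them closer to [H]. *)
Theorem closed_subgroup_exp (G H : set M) :
  closed_subgroup_GL G -> connected G -> closed_subgroup_GL H -> H `<=` G ->
  (forall X, lie_algebra G X -> H (expmx X)) -> H = G.
Proof.
move=> cG conG cH HG HX.
have [Gu G1 Gm Gv Gc] := cG; have [Hu H1 Hm Hv Hc] := cH.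
have [r0 r00 hr0] := no_far cG HX.
have loc g : G g -> `|g - 1| < r0 / 2 -> H g.
  move=> Gg g1.
  pose D : set R := [set `|invmx h * g - 1| | h in H].
  have D0 : lbound D 0 by move=> _ [h _ <-].
  have Dne : D !=set0 by exists `|invmx 1 * g - 1|, 1.
  have hasD : has_inf D by split => //; exists 0.
  have infle h : H h -> inf D <= `|invmx h * g - 1|.
    by move=> Hh; apply: ge_inf; [exists 0|exists h].
  have inf0 : 0 <= inf D by exact: lb_le_inf.
  have gu := Gu _ Gg.
  have [i0|ipos] := leP (inf D) 0.
    suff: H (invmx g) by move=> /Hv; rewrite invmxK.
    apply: Hc; first by rewrite unitmx_inv.
    move=> e e0.
    pose d := e / (K * `|invmx g|).
    have ng : 0 < K * `|invmx g|.
      rewrite mulr_gt0// normr_gt0; apply: contraTneq gu => gv0.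
      by rewrite -unitmx_inv gv0 unitmxE det0 unitr0.
    have d0 : 0 < d by rewrite divr_gt0.
    have [_ [h Hh <-] hd] := inf_adherent d0 hasD.
    exists (invmx h); first exact: Hv.
    have -> : invmx g - invmx h = - ((invmx h * g - 1) * invmx g).
      by rewrite mulrBl mul1r -mulrA [g * _](mulmxV gu) mulr1 opprB.
    rewrite normrN (le_trans (norm_mulr_mx _ _))// mulrAC mulrC.
    rewrite -ler_pdivlMr// ltW// (lt_le_trans hd)// -/d; lra.
  have [_ [h Hh <-] hd] := inf_adherent ipos hasD.
  have i1 : inf D <= `|g - 1| by have := infle _ H1; rewrite invmx1 mul1r.
  exfalso; apply: (hr0 (invmx h * g)); last by lra.
  split.
  - by apply: Gm => //; exact/HG/Hv.
  - apply/negP => /eqP e; have := infle _ Hh; rewrite e subrr normr0; lra.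
  - move=> h' Hh'; have hu := Hu _ Hh; have h'u := Hu _ Hh'.
    have e : invmx h' * (invmx h * g) = invmx (h * h') * g.
      by rewrite mulrA -[invmx h' * _](invrM hu h'u).
    rewrite e; have := infle _ (Hm _ _ Hh Hh'); lra.
apply: conG.
- by exists 1.
- exists [set x | exists2 h, H h & `|invmx h * x - 1| < r0 / 2]; last first.
    apply/seteqP; split=> [h Hh|x [Gx [h Hh hx]]].
      split; first exact: HG.
      by exists h => //; rewrite [_ * h](mulVmx (Hu _ Hh)) subrr normr0 divr_gt0.
    have -> : x = h * (invmx h * x) by rewrite mulrA [h * _](mulmxV (Hu _ Hh)) mul1r.
    apply: Hm => //; apply: loc => //; apply: Gm => //; exact/HG/Hv.
  rewrite openE => x [h Hh hx] /=.
  pose d := (r0 / 2 - `|invmx h * x - 1|) / (K * `|invmx h| + 1).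
  have D0 : 0 < K * `|invmx h| + 1 by rewrite ltr_wpDl.
  have d0 : 0 < d by rewrite divr_gt0// subr_gt0.
  apply: (filterS _ (nbhsx_ballx x d d0)) => y; rewrite -ball_normE/= => xy.
  exists h => //.
  have -> : invmx h * y - 1 = (invmx h * x - 1) - invmx h * (x - y).
    rewrite mulrBr; move: (invmx h * x) (invmx h * y) => X Y.
    by apply/matrixP => i j; rewrite !mxE; ring.
  rewrite (le_lt_trans (ler_normB _ _))// -ltrBrDl.
  rewrite (le_lt_trans (norm_mulr_mx _ _))//.
  have : (K * `|invmx h| + 1) * `|x - y| < r0 / 2 - `|invmx h * x - 1|.
    by rewrite mulrC -ltr_pdivlMr.
  have : 0 <= `|x - y| by []; rewrite mulrDl mul1r; lra.
- exists (closure H); first exact: closed_closure.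
  apply/seteqP; split=> [h Hh|x [Gx cx]]; first by split; [exact: HG|exact: subset_closure].
  apply: Hc; first exact: Gu.
  move=> e e0; have [y [Hy]] := cx _ (nbhsx_ballx x e e0).
  by rewrite -ball_normE => /ltW xy; exists y.
Qed.

End ClosedSubgroupTheorem.

(** * Real points of algebraic groups *)

Section RealPoints.
Import complex.
Variables (R : realType).
Local Notation C := (complex.complex R).
Local Notation rc := (real_complex R).

Lemma rc_inj : injective rc. Proof. exact: fmorph_inj. Qed.

Lemma poly_at_real n (q : mpoly.mpoly (n * n) R) (x : 'M[R]_n) :
  poly_at (mpoly.map_mpoly rc q) (map_mx rc x) =
  rc (mpoly.meval (fun k => mxvec x 0 k) q).
Proof.
rewrite /poly_at !mpoly.mevalE (perm_big _ (mpoly.msupp_map_mpoly q rc_inj))/=.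
rewrite rmorph_sum; apply: eq_bigr => m _.
rewrite mpoly.mcoeff_map_mpoly rmorphM rmorph_prod; congr (_ * _).
by apply: eq_bigr => i _; rewrite rmorphXn -map_mxvec mxE.
Qed.

Lemma meval_continuous n (q : mpoly.mpoly (n.+1 * n.+1) R) :
  continuous (fun x : 'M[R]_n.+1 => mpoly.meval (fun k => mxvec x 0 k) q).
Proof.
have entc k : continuous (fun x : 'M[R]_n.+1 => mxvec x 0 k).
  case/mxvec_indexP: k => i j.
  have -> : (fun x : 'M[R]_n.+1 => mxvec x 0 (mxvec_index i j)) = (fun x => x i j).
    by apply/funext => x; rewrite mxvecE.
  exact: coord_continuous.
have cst c : continuous (fun _ : 'M[R]_n.+1 => c : R) by exact: cst_continuous.
have add (f h : 'M[R]_n.+1 -> R) : continuous f -> continuous h ->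
    continuous (fun x => f x + h x) by move=> cf ch x; exact: (cvgD (cf x) (ch x)).
have mul (f h : 'M[R]_n.+1 -> R) : continuous f -> continuous h ->
    continuous (fun x => f x * h x) by move=> cf ch x; exact: (cvgM (cf x) (ch x)).
have fold (op : R -> R -> R) (id0 : R) (I : Type) (s : seq I) (f : I -> 'M[R]_n.+1 -> R) :
    (forall f h, continuous f -> continuous h ->
      continuous (fun x : 'M[R]_n.+1 => op (f x) (h x))) ->
    (forall i, continuous (f i)) ->
    continuous (fun x => \big[op/id0]_(i <- s) f i x).
  move=> opc fc; elim: s => [|i s IH].
    have -> : (fun x => \big[op/id0]_(i <- [::]) f i x) = fun=> id0.
      by apply/funext => x; rewrite big_nil.
    exact: cst.
  have -> : (fun x => \big[op/id0]_(j <- i :: s) f j x) =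
      fun x => op (f i x) (\big[op/id0]_(j <- s) f j x).
    by apply/funext => x; rewrite big_cons.
  exact: opc.
have -> : (fun x : 'M[R]_n.+1 => mpoly.meval (fun k => mxvec x 0 k) q) =
    fun x => \sum_(m <- mpoly.msupp q) mpoly.mcoeff m q *
       \prod_i mxvec x 0 i ^+ mpoly.fun_of_multinom m i.
  by apply/funext => x; rewrite mpoly.mevalE.
apply: (fold _ 0 _ _ _ add) => m; apply: (mul _ _ (cst _)).
apply: (fold _ 1 _ _ _ mul) => i.
move: (mpoly.fun_of_multinom m i) => k; elim: k => [|k IHk].
  have -> : (fun x : 'M[R]_n.+1 => mxvec x 0 i ^+ 0) = fun=> 1.
    by apply/funext => y; rewrite expr0.
  exact: cst.
have -> : (fun x : 'M[R]_n.+1 => mxvec x 0 i ^+ k.+1) =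
    fun x => mxvec x 0 i * mxvec x 0 i ^+ k by apply/funext => y; rewrite exprS.
exact: mul.
Qed.

Lemma real_points_closed_subgroup n (GG : set 'M[C]_n.+1) :
  algebraic_group_over_R GG -> closed_subgroup_GL (real_points GG).
Proof.
move=> [[Gu G1 Gm Gv] [I Ireal GI]]; split.
- by move=> x /Gu; rewrite /= map_unitmx.
- by rewrite /real_points/= map_scalar_mx rmorph1.
- by move=> x y; rewrite /real_points/= map_mxM; exact: Gm.
- by move=> x; rewrite /real_points/= map_invmx; exact: Gv.
move=> x xu hx; rewrite /real_points/= GI; split; first by rewrite map_unitmx.
move=> p Ip; have [q pq] := Ireal p Ip; rewrite pq poly_at_real.
rewrite (_ : mpoly.meval _ _ = 0) ?rmorph0//.
set f := (fun x : 'M[R]_n.+1 => mpoly.meval (fun k => mxvec x 0 k) q).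
have f0 y : real_points GG y -> f y = 0.
  rewrite /real_points/= GI => -[_ /(_ p Ip)]; rewrite pq poly_at_real => e.
  by apply: rc_inj; rewrite rmorph0.
have clf : closed (f @^-1` [set 0]).
  by apply: preimage_closed; [move=> y _; exact: meval_continuous|exact: closed_eq].
apply: clf => B /nbhs_ballP[e /= e0 eB].
have [y Gy xy] := hx (e / 2) (divr_gt0 e0 (ltr0n _ 2)).
exists y; split; first exact: f0.
apply: eB; rewrite -ball_normE/=; apply: (le_lt_trans xy).
by rewrite ltr_pdivrMr// ltr_pMr// ltr1n.
Qed.

(** The identity component is a subgroup because its translates are connected,
    and it contains its limit points because adding a limit point to a
    connected set leaves it connected. *)
Lemma component_closed_subgroup n (X : set 'M[R]_n.+1) :
  closed_subgroup_GL X -> closed_subgroup_GL (connected_component X 1%:M).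
Proof.
move=> [Xu X1 Xm Xv Xc].
have X1' : X 1%:M by [].
have sub := connected_component_sub.
have con : connected (connected_component X 1%:M) by exact: component_connected.
have tr (h : 'M[R]_n.+1) : X h -> connected_component X 1%:M h ->
    forall k, X k -> connected_component X k (k *m h).
  move=> Xh ch k Xk.
  apply: (@connected_component_max _ X [set k *m y | y in connected_component X 1%:M]).
  - by exists 1%:M; [exact: connected_component_refl|rewrite mulmx1].
  - by move=> _ [y /sub Xy <-]; exact: Xm.
  - apply: connected_continuous_connected => //.
    apply: continuous_subspaceT; exact: (linear_mx_continuous (f := mulmx k)).
  - by exists h.
split.
- by move=> x /sub /Xu.
- exact: connected_component_refl.
- move=> x y cx cy; apply: (connected_component_trans cx).
  exact: tr (sub _ _ _ _ cy) cy _ (sub _ _ _ _ cx).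
- move=> x cx; have Xx := sub _ _ _ _ cx.
  have := tr x Xx cx (invmx x) (Xv _ Xx).
  by rewrite (mulVmx (Xu _ Xx)); exact: connected_component_sym.
- move=> x xu hx.
  have Xx : X x.
    by apply: Xc => // e e0; have [y cy xy] := hx e e0; exists y => //; exact: sub cy.
  apply: (@connected_component_max _ X (connected_component X 1%:M `|` [set x])).
  + by left; exact: connected_component_refl.
  + by move=> y [/sub//|->].
  + move=> B [b Bb] [U oU BU] [F cF BF].
    have conF : forall c, connected_component X 1%:M c -> B c ->
        connected_component X 1%:M `<=` B.
      move=> c cc Bc.
      move=> y cy; suff : (B `&` connected_component X 1%:M) y by case.
      rewrite (con (B `&` connected_component X 1%:M))//; first by exists c.
      * exists U => //; rewrite BU; apply/seteqP; split => [z [[_ Uz] cz]//|z [cz Uz]].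
        by split => //; split => //; left.
      * exists F => //; rewrite BF; apply/seteqP; split => [z [[_ Fz] cz]//|z [cz Fz]].
        by split => //; split => //; left.
    have xcl (V : set 'M[R]_n.+1) : open V -> V x ->
        exists2 y, connected_component X 1%:M y & V y.
      rewrite openE => oV /oV /nbhs_ballP[e /= e0 eV].
      have [y cy xy] := hx (e / 2) (divr_gt0 e0 (ltr0n _ 2)).
      exists y => //; apply: eV; rewrite -ball_normE/=; apply: (le_lt_trans xy).
      by rewrite ltr_pdivrMr// ltr_pMr// ltr1n.
    have [c cc Bc] : exists2 c, connected_component X 1%:M c & B c.
      have Bb' := Bb; rewrite BU in Bb'; case: Bb' => -[cb|/= xb] Ub; first by exists b.
      rewrite xb in Ub; have [y cy Uy] := xcl U oU Ub.
      by exists y => //; rewrite BU; split => //; left.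
    have all := conF c cc Bc.
    apply/seteqP; split => [y|y [/all//|->]]; first by rewrite BU => -[].
    rewrite BF; split; first by right.
    apply: cF => V /nbhs_ballP[e /= e0 eV].
    have [z cz xz] := hx (e / 2) (divr_gt0 e0 (ltr0n _ 2)).
    exists z; split; first by have := all _ cz; rewrite BF => -[].
    apply: eV; rewrite -ball_normE/=; apply: (le_lt_trans xz).
    by rewrite ltr_pdivrMr// ltr_pMr// ltr1n.
  + by right.
Qed.

Lemma real_component_closed_subgroup n (GG : set 'M[C]_n.+1) :
  algebraic_group_over_R GG -> closed_subgroup_GL (real_component GG).
Proof. by move=> h; exact/component_closed_subgroup/real_points_closed_subgroup. Qed.

Lemma real_component_sub n (X Y : set 'M[C]_n.+1) :
  algebraic_group_over_R X -> X `<=` Y -> real_component X `<=` real_component Y.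
Proof.
move=> aX XY; have [_ X1 _ _ _] := real_points_closed_subgroup aX.
apply: connected_component_max; first exact: connected_component_refl.
  by move=> x /connected_component_sub; exact: XY.
exact: component_connected.
Qed.

End RealPoints.

(** * Real diagonalization of split tori *)

Section SplitTori.
Import complex.
Variables (R : realType).
Local Notation C := (complex.complex R).
Local Notation rc := (real_complex R).

Section ConjugateDiagonal.
Variables (F : fieldType) (n : nat) (Q : 'M[F]_n.+1).
Hypothesis Qu : Q \in unitmx.

Definition diag_in (A : 'M[F]_n.+1) := is_diag_mx (Q *m A *m invmx Q).

Lemma diag_in1 : diag_in 1%:M.
Proof. by rewrite /diag_in mulmx1 mulmxV// scalar_mx_is_diag. Qed.

Lemma diag_in_mul A B : diag_in A -> diag_in B -> diag_in (A *m B).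
Proof.
move=> /diag_mxP[a ea] /diag_mxP[b eb]; apply/diag_mxP.
have -> : Q *m (A *m B) *m invmx Q = (Q *m A *m invmx Q) *m (Q *m B *m invmx Q).
  by rewrite !mulmxA mulmxKV.
by rewrite ea eb mulmx_diag; eexists.
Qed.

Lemma diag_in_lin a A B : diag_in A -> diag_in B -> diag_in (a *: A + B).
Proof.
move=> /is_diag_mxP hA /is_diag_mxP hB; apply/is_diag_mxP => i j ij.
by rewrite mulmxDr mulmxDl -scalemxAr -scalemxAl 2!mxE hA// hB// mulr0 addr0.
Qed.

Lemma diag_in0 : diag_in 0.
Proof. by rewrite /diag_in mulmx0 mul0mx; apply/is_diag_mxP => i j; rewrite mxE. Qed.

Lemma diag_in_sum (I : Type) (s : seq I) (f : I -> 'M[F]_n.+1) :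
  (forall i, diag_in (f i)) -> diag_in (\sum_(i <- s) f i).
Proof.
move=> h; elim/big_rec: _ => [|i A _ hA]; first exact: diag_in0.
by rewrite -[f i]scale1r; exact: diag_in_lin.
Qed.

Lemma diag_in_scale a A : diag_in A -> diag_in (a *: A).
Proof. by move=> h; rewrite -[_ *: _]addr0; apply: diag_in_lin => //; exact: diag_in0. Qed.

Lemma diag_in_horner A p : diag_in A -> diag_in (horner_mx A p).
Proof.
move=> hA; rewrite -[p]coefK horner_mx_poly.
by apply: diag_in_sum => i; apply: diag_in_scale; elim: (nat_of_ord i) => [|k IH];
  rewrite ?expr0 ?exprS; [exact: diag_in1|exact: diag_in_mul].
Qed.

End ConjugateDiagonal.

(** A one-parameter group with Laurent polynomial entries takes values in the
    polynomials in its value at 2, which is diagonalizable: the powers of this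
    value are combinations of distinct geometric progressions. *)
Section LaurentGroups.
Variables (n k J : nat) (c : R -> 'M[R]_n.+1) (Mj : 'I_J -> 'M[R]_n.+1).
Hypothesis cE : forall s, s != 0 -> c s = \sum_(j < J) (s ^+ j / s ^+ k) *: Mj j.
Hypothesis cM : forall s t, s != 0 -> t != 0 -> c (s * t) = c s *m c t.
Hypothesis c1 : c 1 = 1%:M.

Let mu (j : 'I_J) : R := 2 ^+ j / 2 ^+ k.

Let mu_inj : injective mu.
Proof.
move=> i j /(mulIf _) h; apply/val_inj/eqP.
have : 2 ^+ i = 2 ^+ j :> R by apply/h; rewrite invr_neq0// expf_neq0.
have n1 : 2 != 1 :> R by rewrite gt_eqF// ltr1n.
by move=> e; apply/eqP/(ieexprIn (ltr0n R 2) n1 e).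
Qed.

Let cX m : c 2 ^+ m = \sum_(j < J) mu j ^+ m *: Mj j.
Proof.
have -> : c 2 ^+ m = c (2 ^+ m).
  elim: m => [|m IH]; first by rewrite !expr0 c1.
  by rewrite exprS IH exprS cM// expf_neq0.
rewrite cE ?expf_neq0//; apply: eq_bigr => j _; congr (_ *: _).
by rewrite /mu exprMn exprVn -!exprM mulnC [(m * k)%N]mulnC.
Qed.

Let horner_c2 p : horner_mx (c 2) p = \sum_(j < J) p.[mu j] *: Mj j.
Proof.
rewrite -[p in LHS]coefK horner_mx_poly.
under eq_bigr do rewrite cX scaler_sumr.
rewrite exchange_big; apply: eq_bigr => j _.
by rewrite horner_coef scaler_suml; apply: eq_bigr => i _; rewrite scalerA.
Qed.

(** The minimal polynomial of [c 2] splits with simple roots among the [mu j],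
    which are distinct. *)
Lemma laurent_diagonalizable : exists2 P : 'M[R]_n.+1, P \in unitmx & similar_diag P (c 2).
Proof.
apply/diagonalizableP; exists [seq mu j | j <- enum 'I_J].
  by rewrite (map_inj_uniq mu_inj) enum_uniq.
apply: mxminpoly_min; rewrite horner_c2 big1// => j _.
rewrite (_ : _.[_] = 0) ?scale0r//; apply/eqP.
rewrite -/(root _ _) root_prod_XsubC; apply: map_f; exact: mem_enum.
Qed.

(** Lagrange interpolation at the [mu j] recovers the coefficients [Mj], hence
    every value of the group, as polynomials in [c 2]. *)
Lemma laurent_polynomial s : s != 0 -> exists p, c s = horner_mx (c 2) p.
Proof.
move=> s0.
pose L j : {poly R} := \prod_(l < J | l != j) ((mu j - mu l)^-1 *: ('X - (mu l)%:P)).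
have LE j l : (L j).[mu l] = (l == j)%:R.
  rewrite /L horner_prod; case: eqVneq => [->|lj].
    rewrite big1// => i ij; rewrite hornerZ hornerXsubC mulVf// subr_eq0.
    by apply: contra_neq ij => /mu_inj.
  by rewrite (bigD1 l)//= hornerZ hornerXsubC subrr mulr0 mul0r.
exists (\sum_(j < J) (s ^+ j / s ^+ k) *: L j).
rewrite cE// horner_c2; apply: eq_bigr => l _; congr (_ *: _).
rewrite horner_sum (bigD1 l)//= hornerZ LE eqxx mulr1 big1 ?addr0// => j jl.
by rewrite hornerZ LE eq_sym (negbTE jl) mulr0.
Qed.

End LaurentGroups.

Lemma poly_along_curve m (q : mpoly.mpoly m R) (u : 'I_m -> {poly R}) :
  exists P : {poly R}, forall s, P.[s] = mpoly.meval (fun k => (u k).[s]) q.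
Proof.
exists (\sum_(e <- mpoly.msupp q) (mpoly.mcoeff e q)%:P *
  \prod_i u i ^+ mpoly.fun_of_multinom e i) => s.
rewrite mpoly.mevalE horner_sum; apply: eq_bigr => e _.
rewrite hornerM hornerC horner_prod; congr (_ * _).
by apply: eq_bigr => i _; rewrite horner_exp.
Qed.


(** Real points are products of values of one-parameter groups with Laurent
    polynomial entries, one for each coordinate of the diagonal torus, and these
    are simultaneously diagonalizable over the reals. *)
Lemma split_torus_diag n (T : set 'M[C]_n.+1) : split_torus T ->
  exists2 Q : 'M[R]_n.+1, Q \in unitmx & forall g, real_points T g -> diag_in Q g.
Proof.
move=> [[[Tu T1 Tm Tv] _] [d [f [f' [[regf regf'] [fT f'T] [f'f ff'] fM]]]]].
(* The coordinate subgroups of the diagonal torus; their images under [f'] have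
   Laurent polynomial entries in [s]. *)
pose D (i : 'I_d) (s : R) : 'M[C]_d := diag_mx (\row_j (if j == i then rc s else 1)).
have rc0 s : (rc s == 0) = (s == 0) by exact: fmorph_eq0.
have detD i s : \det (D i s) = rc s.
  rewrite det_diag (bigD1 i)//= big1 ?mulr1 => [|j ji]; first by rewrite mxE eqxx.
  by rewrite mxE (negbTE ji).
have DT i s : s != 0 -> diagonal_torus (D i s).
  by move=> s0; split; rewrite ?diag_mx_is_diag// unitmxE detD unitfE rc0.
have DM i s t : D i (s * t) = D i s *m D i t.
  rewrite mulmx_diag; congr diag_mx; apply/rowP => j; rewrite !mxE.
  by case: eqP; rewrite ?rmorphM ?mulr1.
have dM x y : diagonal_torus x -> diagonal_torus y -> @diagonal_torus R d (x *m y).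
  move=> [xu /diag_mxP[a ea]] [yu /diag_mxP[b eb]].
  by split; [rewrite unitmx_mul xu yu|rewrite ea eb mulmx_diag diag_mx_is_diag].
have dC x y : diagonal_torus x -> @diagonal_torus R d y -> x *m y = y *m x.
  move=> [xu /diag_mxP[a ->]] [yu /diag_mxP[b ->]].
  by rewrite !mulmx_diag; congr diag_mx; apply/rowP => j; rewrite !mxE mulrC.
have f'M x y : diagonal_torus x -> diagonal_torus y -> f' (x *m y) = f' x *m f' y.
  move=> dx dy; have Tx := f'T _ dx; have Ty := f'T _ dy.
  rewrite -[in LHS](ff' _ dx) -[in LHS](ff' _ dy) -fM// f'f//; exact: Tm.
have d1 : diagonal_torus (1%:M : 'M[C]_d).
  by split; [exact: unitmx1|exact: scalar_mx_is_diag].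
have f'1 : f' 1%:M = 1%:M.
  have := f'M _ _ d1 d1; rewrite mulmx1 => /(congr1 (mulmx (invmx (f' 1%:M)))).
  by have u := Tu _ (f'T _ d1); rewrite mulKmx// mulVmx.
have entry (x : 'I_d * 'I_n.+1 * 'I_n.+1) : exists Pk : {poly R} * nat,
    forall s, s != 0 -> f' (D x.1.1 s) x.1.2 x.2 = rc (Pk.1.[s] / s ^+ Pk.2).
  case: x => -[i a] b /=; have [p [k [[q ->] hp]]] := regf' a b.
  pose u (l : 'I_(d * d)) : {poly R} :=
    mxvec (\matrix_(r < d, t < d) (if r == t then if t == i then 'X else 1 else 0)) 0 l.
  have [P hP] := poly_along_curve q u.
  exists (P, k) => s s0 /=; rewrite (hp _ (DT i s s0)) detD.
  have -> : D i s = map_mx rc (diag_mx (\row_j (if j == i then s else 1))).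
    rewrite map_diag_mx; congr diag_mx; apply/rowP => j; rewrite !mxE.
    by case: eqP; rewrite ?rmorph1.
  rewrite poly_at_real hP [in RHS]rmorphM fmorphV rmorphXn; congr (rc _ / _).
  congr (mpoly.meval _ q); apply/funext => l; rewrite /u.
  case/mxvec_indexP: l => r t; rewrite !mxvecE !mxE.
  case: (eqVneq r t) => [->|_]; last by rewrite /= horner0.
  by rewrite /= mulr1n; case: eqP => _; rewrite ?hornerX ?hornerC.
have [Pk hPk] := choice entry.
pose c i s : 'M[R]_n.+1 := \matrix_(a, b) ((Pk (i, a, b)).1.[s] / s ^+ (Pk (i, a, b)).2).
have cf i s : s != 0 -> map_mx rc (c i s) = f' (D i s).
  move=> s0; apply/matrixP => a b; rewrite !mxE.
  by have := hPk (i, a, b) s s0; rewrite /= => ->.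
have minj (x y : 'M[R]_n.+1) : map_mx rc x = map_mx rc y -> x = y.
  move=> /matrixP h; apply/matrixP => a b.
  by have := h a b; rewrite !mxE => /rc_inj.
have map1 : map_mx rc (1%:M : 'M[R]_n.+1) = 1%:M by rewrite map_scalar_mx rmorph1.
have cM i s t : s != 0 -> t != 0 -> c i (s * t) = c i s *m c i t.
  move=> s0 t0; apply: minj; rewrite map_mxM !cf ?mulf_neq0// DM f'M//; exact: DT.
have c1 i : c i 1 = 1%:M.
  apply: minj; rewrite cf ?oner_neq0// map1 -f'1; congr f'.
  apply/matrixP => a b; rewrite !mxE; case: (a == b) => //=.
  by case: eqP; rewrite ?rmorph1.
(* A common denominator and a common bound on the degrees. *)
pose k0 := (\max_(x : 'I_d * 'I_n.+1 * 'I_n.+1) (Pk x).2)%N.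
pose J := (\max_(x : 'I_d * 'I_n.+1 * 'I_n.+1)
   size ((Pk x).1 * 'X^(k0 - (Pk x).2)%N)%R)%N.
pose Mj i (j : 'I_J) : 'M[R]_n.+1 :=
  \matrix_(a, b) ((Pk (i, a, b)).1 * 'X^(k0 - (Pk (i, a, b)).2)%N)`_j.
have cE i s : s != 0 -> c i s = \sum_(j < J) (s ^+ j / s ^+ k0) *: Mj i j.
  move=> s0; apply/matrixP => a b; rewrite summxE mxE.
  set P := (Pk (i, a, b)).1; set k := (Pk (i, a, b)).2.
  have kk0 : (k <= k0)%N by exact: (@leq_bigmax _ (fun x => (Pk x).2) (i, a, b)).
  have sJ : (size (P * 'X^(k0 - k))%R <= J)%N.
    exact: (@leq_bigmax _ (fun x => size ((Pk x).1 * 'X^(k0 - (Pk x).2)%N)%R) (i, a, b)).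
  have -> : P.[s] / s ^+ k = (P * 'X^(k0 - k)).[s] / s ^+ k0.
    have -> : s ^+ k0 = s ^+ (k0 - k) * s ^+ k by rewrite -exprD subnK.
    by rewrite hornerM hornerXn invfM mulrA mulfK// expf_neq0.
  rewrite (horner_coef_wide _ sJ) mulr_suml; apply: eq_bigr => j _.
  by rewrite !mxE mulrC [_ * s ^+ j]mulrC mulrA [_^-1 * _]mulrC.
pose As := [seq c i 2 | i <- enum 'I_d].
have n2 : 2 != 0 :> R by [].
have [cod _] := codiagonalizableP As.
case: cod => [|Q Qu /allP QA].
  split => [A B /mapP[i _ ->] /mapP[j _ ->]|A /mapP[i _ ->]].
    rewrite /comm_mx; apply: minj; rewrite !map_mxM !cf// -!f'M;
      try exact: DT; by rewrite dC//; exact: DT.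
  exact: (laurent_diagonalizable (cE i) (cM i) (c1 i)).
have Qc i s : s != 0 -> diag_in Q (c i s).
  move=> s0; have [p ->] := laurent_polynomial (cE i) (cM i) (c1 i) s0.
  apply: diag_in_horner => //; apply/is_diag_mxP.
  by apply/similar_diagP => //; apply: QA; apply: map_f; rewrite mem_enum.
exists Q => // g Tg.
have [fgu fgd] := fT _ Tg.
have [e fge] := diag_mxP _ fgd.
(* The isomorphism is defined over the reals, so real points have real coordinates. *)
have ereal j : exists t, e 0 j = rc t.
  have [p [k [[q ->] hp]]] := regf j j.
  have := hp _ Tg; rewrite fge mxE eqxx mulr1n poly_at_real det_map_mx.
  by rewrite -rmorphXn -fmorphV -rmorphM => ->; eexists.
have [t te] := choice ereal.
have t0 j : t j != 0.
  have := fgu; rewrite /= fge unitmxE det_diag unitfE => /prodf_neq0/(_ j isT).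
  by rewrite te rc0.
pose E (s : seq 'I_d) : 'M[C]_d := diag_mx (\row_j (if j \in s then rc (t j) else 1)).
have ET s : diagonal_torus (E s).
  split; rewrite ?diag_mx_is_diag//= unitmxE det_diag unitfE; apply/prodf_neq0 => j _.
  by rewrite mxE; case: ifP; rewrite ?rc0// oner_neq0.
have main s : uniq s -> exists2 x : 'M[R]_n.+1, f' (E s) = map_mx rc x & diag_in Q x.
  elim: s => [_|i s IH /= /andP[nis us]].
    exists 1%:M; last exact: diag_in1.
    rewrite map1 -f'1; congr f'.
    by apply/matrixP => a b; rewrite !mxE in_nil.
  have [x fx dx] := IH us.
  exists (c i (t i) *m x); last by apply: diag_in_mul => //; exact: Qc.
  have -> : E (i :: s) = D i (t i) *m E s.
    rewrite mulmx_diag; congr diag_mx; apply/rowP => j; rewrite !mxE inE.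
    by case: eqVneq => [->|_] /=; rewrite ?(negbTE nis) ?mulr1 ?mul1r.
  by rewrite f'M// ?fx ?map_mxM ?cf//; exact: DT.
have [x fx dx] := main _ (enum_uniq 'I_d).
suff -> : g = x by [].
apply: minj; rewrite -fx -[LHS](f'f _ Tg) fge; congr (f' (diag_mx _)).
by apply/rowP => j; rewrite !mxE mem_enum te.
Qed.

End SplitTori.

(** * Lie algebras and restricted weights *)

Section TangentMaps.
Variables (R : realType) (n : nat).
Local Notation M := 'M[R]_n.+1.
Local Notation K := (n.+1%:R : R).

(** This is how second-order Taylor estimates yield first-order identities. *)
Lemma second_order_zero (V : normedModType R) (v : V) (C : R) :
  (forall t : R, 0 < t -> t <= 1 -> `|t *: v| <= C * t ^+ 2) -> v = 0.
Proof.
move=> h; apply/eqP; rewrite -normr_le0; apply/ler_addgt0Pr => e e0; rewrite add0r.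
pose t := Num.min 1 (e / (`|C| + 1)).
have C1 : 0 < `|C| + 1 by rewrite ltr_wpDl.
have t0 : 0 < t by rewrite lt_min ltr01 divr_gt0.
have t1 : t <= 1 by rewrite ge_min lexx.
have := h t t0 t1; rewrite normrZ gtr0_norm// expr2 mulrCA ler_pM2l// => hv.
apply: (le_trans hv); apply: (@le_trans _ _ ((`|C| + 1) * t)).
  by rewrite ler_wpM2r ?(ltW t0)// (le_trans (ler_norm _))// lerDl.
by rewrite mulrC -ler_pdivlMr// ge_min lexx orbT.
Qed.

Lemma expmx_scale_near1 (X : M) : exists2 C : R, 0 <= C &
  forall t : R, `|t| * `|X| <= 1 -> `|expmx (t *: X) - (1 + t *: X)| <= C * t ^+ 2.
Proof.
exists (K ^+ 2 * expR K * `|X| ^+ 2).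
  by rewrite !mulr_ge0// ?exprn_ge0 ?expR_ge0.
move=> t tX; apply: (le_trans (expmx_taylor1 _)); first by rewrite normrZ.
by rewrite normrZ exprMn real_normK ?num_real// [_ * `|X| ^+ 2]mulrC mulrA.
Qed.

(** A linear map constant along a one-parameter group kills its generator, by
    looking at the first-order term at the identity. *)
Lemma tangent_linear (V : normedModType R) (f : {linear M -> V}) (X : M) :
  (forall t : R, f (expmx (t *: X) - 1) = 0) -> f X = 0.
Proof.
move=> h; have [C C0 hC] := linear_mx_bounded f.
have [c c0 hc] := expmx_scale_near1 ((`|X| + 1)^-1 *: X).
have X1 : 0 < `|X| + 1 by rewrite ltr_wpDl.
have Y1 : `|(`|X| + 1)^-1 *: X| <= 1.
  by rewrite normrZ gtr0_norm ?invr_gt0// mulrC ler_pdivrMr// mul1r lerDl.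
have hY t : f (expmx (t *: ((`|X| + 1)^-1 *: X)) - 1) = 0 by rewrite scalerA h.
move: hc Y1 hY; move eY : (_ *: X) => Y hc Y1 hY.
suff fY : f Y = 0.
  by move: fY; rewrite -eY linearZ => /eqP; rewrite scaler_eq0 invr_eq0 (gt_eqF X1)/= => /eqP.
apply: (@second_order_zero _ _ (C * c)) => t t0 t1.
have -> : t *: f Y = - f (expmx (t *: Y) - (1 + t *: Y)).
  by rewrite opprD addrA [f (_ - _)]linearB linearZ/= hY sub0r opprK.
rewrite normrN (le_trans (hC _))// -mulrA ler_wpM2l ?(ltW C0)// hc//.
by rewrite gtr0_norm// mulr_ile1// ltW.
Qed.

Lemma lie_algebra_conj (G : set M) (x X : M) : closed_subgroup_GL G ->
  G x -> lie_algebra G X -> lie_algebra G (x *m X *m invmx x).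
Proof.
move=> [Gu G1 Gm Gv Gc] Gx LX t.
rewrite scalemxAl scalemxAr -expmx_conj; last exact: Gu.
by apply: (Gm _ _ _ (Gv _ Gx)); exact: (Gm _ _ Gx).
Qed.

Variables (G : set M) (g : {vspace M}).
Hypotheses (cG : closed_subgroup_GL G) (hg : is_lie_algebra G g).

(** The bracket is the derivative at 0 of the conjugates of [Y] under
    [expmx (t *: X)], all of which lie in [g]; a linear map with kernel [g]
    therefore kills it. *)
Lemma bracket_mem (X Y : M) : X \in g -> Y \in g -> bracket X Y \in g.
Proof.
move=> Xg Yg; pose s := (`|X| + 1)^-1.
have X1 : 0 < `|X| + 1 by rewrite ltr_wpDl.
have s0 : s != 0 by rewrite invr_neq0// gt_eqF.
suff : bracket (s *: X) Y \in g.
  have -> : bracket (s *: X) Y = s *: bracket X Y.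
    by rewrite /bracket scalerBr -scalerAl -scalerAr.
  by move=> /(memvZ s^-1); rewrite scalerA mulVf// scale1r.
have : `|s *: X| <= 1.
  by rewrite normrZ gtr0_norm ?invr_gt0// mulrC ler_pdivrMr// mul1r lerDl.
have : s *: X \in g by exact: memvZ.
move: (s *: X) => Z Zg Z1.
pose f : 'End(M) := (\1 - projv g)%VF.
have fker W : f W = 0 -> W \in g.
  move=> fW; have : projv g W = W.
    by apply/eqP; rewrite eq_sym -subr_eq0; move: fW; rewrite !lfunE/= !lfunE/= => ->.
  by move=> <-; exact: memv_proj.
have fz W : W \in g -> f W = 0.
  by move=> Wg; rewrite !lfunE/= !lfunE/= projv_id// subrr.
have [C C0 hC] := @linear_mx_bounded R n.+1 n.+1 ('M[R]_n.+1 : normedModType R) f.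
have [c c0 hc] := expmx_scale_near1 Z.
apply: fker; apply: (@second_order_zero _ _
   (C * (K ^+ 2 * (c * `|Y| * (2 + c)) + K ^+ 2 * (2 * `|Y| * c) + K ^+ 2 * `|Y|))) => t t0 t1.
have tZ : `|t| * `|Z| <= 1 by rewrite gtr0_norm// mulr_ile1// ltW.
have tZ' : `|- t| * `|Z| <= 1 by rewrite normrN.
set E := expmx (t *: Z); set F := expmx (- t *: Z).
have hE := hc _ tZ; have hF := hc _ tZ'; rewrite -/E -/F sqrrN in hE hF.
have Fi : F = invmx E by rewrite /E invmx_expmx /F scaleNr.
have mem : E *m Y *m F \in g.
  apply/hg; rewrite Fi; apply: lie_algebra_conj => //; first exact: ((hg Z).1 Zg t).
  exact: (hg Y).1 Yg.
have key : t *: bracket Z Y = (E * Y * F - Y) - ((E - (1 + t *: Z)) * Y * F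
    + (1 + t *: Z) * Y * (F - (1 + - t *: Z)) - (t *: Z) * Y * (t *: Z)).
  rewrite /bracket !(mulrBl, mulrBr, mulrDl, mulrDr, mul1r, mulr1) !scaleNr !mulrN.
  rewrite scalerBr scalerAl scalerAr.
  move: (E * Y * F) (E * Y) (Y * F) (t *: Z * Y) (Y * (t *: Z)) => A1 A2 A3 A4 A5.
  move: (A2 * F) (A4 * F) (A4 * (t *: Z)) => A6 A7 A8.
  by apply/matrixP => i j; rewrite !mxE; ring.
have F2 : `|F| <= 2 + c.
  have -> : F = (F - (1 + - t *: Z)) + 1 + - t *: Z by rewrite -addrA subrK.
  apply: (le_trans (ler_normD _ _)); apply: (le_trans (lerD (ler_normD _ _) (lexx _))).
  rewrite norm_mx1 normrZ; have : c * t ^+ 2 <= c by rewrite ler_piMr// exprn_ile1// ltW.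
  lra.
have Z2 : `|1 + t *: Z| <= 2.
  by rewrite (le_trans (ler_normD _ _))// norm_mx1 normrZ; lra.
set R1 := (E - _) * Y * F in key; set R2 := (1 + _) * Y * _ in key.
set R3 := (t *: Z) * Y * _ in key.
have -> : t *: f (bracket Z Y) = - f (R1 + R2 - R3).
  rewrite -linearZ; have -> : t *: bracket Z Y = (E *m Y *m F - Y) - (R1 + R2 - R3) := key.
  have fB W V : f (W - V) = f W - f V by exact: linearB.
  by rewrite /= [LHS]fB [f (_ - Y)]fB (fz _ mem) (fz _ Yg) subrr sub0r.
have t2 : 0 <= t ^+ 2 by rewrite exprn_ge0// ltW.
have mul3 (A B D : M) : `|A * B * D| <= K ^+ 2 * `|A| * `|B| * `|D|.
  rewrite (le_trans (norm_mulr_mx _ _))// expr2 -!mulrA ler_wpM2l// !mulrA ler_wpM2r//.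
  by rewrite norm_mulr_mx.
have b1 : `|R1| <= (K ^+ 2 * (c * `|Y| * (2 + c))) * t ^+ 2.
  rewrite (le_trans (mul3 _ _ _))//.
  have -> : K ^+ 2 * (c * `|Y| * (2 + c)) * t ^+ 2 =
    K ^+ 2 * (c * t ^+ 2) * `|Y| * (2 + c) by ring.
  apply: ler_pM => //.
  by rewrite ler_wpM2r// ler_wpM2l// exprn_ge0.
have b2 : `|R2| <= (K ^+ 2 * (2 * `|Y| * c)) * t ^+ 2.
  rewrite (le_trans (mul3 _ _ _))//.
  have -> : K ^+ 2 * (2 * `|Y| * c) * t ^+ 2 = K ^+ 2 * 2 * `|Y| * (c * t ^+ 2) by ring.
  apply: ler_pM => //.
  by rewrite ler_wpM2r// ler_wpM2l// exprn_ge0.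
have b3 : `|R3| <= (K ^+ 2 * `|Y|) * t ^+ 2.
  rewrite (le_trans (mul3 _ _ _))// normrZ gtr0_norm//.
  have -> : K ^+ 2 * (t * `|Z|) * `|Y| * (t * `|Z|) =
    K ^+ 2 * `|Y| * t ^+ 2 * `|Z| ^+ 2 by ring.
  apply: ler_piMr; last exact: exprn_ile1.
  by apply: mulr_ge0 => //; apply: mulr_ge0 => //; exact: exprn_ge0.
rewrite normrN (le_trans (hC _))// -mulrA ler_wpM2l ?(ltW C0)//.
rewrite (le_trans (ler_normB _ _))// (le_trans (lerD (ler_normD _ _) (lexx _)))//.
lra.
Qed.

End TangentMaps.

Section WeightFilters.
Variables (R : realType) (n : nat).
Local Notation M := 'M[R]_n.+1.
Variables (G : set M) (g a : {vspace M}) (Q : M).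
Hypotheses (cG : closed_subgroup_GL G) (hg : is_lie_algebra G g).
Hypothesis Qu : Q \in unitmx.
Hypothesis ag : (a <= g)%VS.
Hypothesis aQ : forall x, x \in a -> diag_in Q x.
Variable P : set (dual a).
Hypothesis hP : positive_system g P.

(** Matrix entries in the eigenbasis of the torus; [lam i] is the weight of the
    [i]-th vector of this basis. *)
Definition coo (X : M) : M := Q *m X *m invmx Q.
Definition lam (i : 'I_n.+1) (X : M) : R := coo X i i.

Lemma coo_linear s X Y : coo (s *: X + Y) = s *: coo X + coo Y.
Proof. by rewrite /coo mulmxDr mulmxDl -scalemxAr -scalemxAl. Qed.

Lemma coo0 : coo 0 = 0. Proof. by rewrite /coo mulmx0 mul0mx. Qed.

Lemma cooZ s X : coo (s *: X) = s *: coo X.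
Proof. by rewrite -[s *: X]addr0 coo_linear coo0 addr0. Qed.

Lemma cooD X Y : coo (X + Y) = coo X + coo Y.
Proof. by rewrite -[X]scale1r coo_linear !scale1r. Qed.

Lemma cooN X : coo (- X) = - coo X.
Proof. by rewrite -scaleN1r cooZ scaleN1r. Qed.

Lemma cooZe s X i j : coo (s *: X) i j = s * coo X i j.
Proof. by rewrite cooZ mxE. Qed.

Lemma cooDe X Y i j : coo (X + Y) i j = coo X i j + coo Y i j.
Proof. by rewrite cooD mxE. Qed.

Lemma cooBe X Y i j : coo (X - Y) i j = coo X i j - coo Y i j.
Proof. by rewrite cooDe -scaleN1r cooZe mulN1r. Qed.

Lemma coo0e i j : coo 0 i j = 0. Proof. by rewrite coo0 mxE. Qed.

Lemma cooM X Y : coo (X *m Y) = coo X *m coo Y.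
Proof. by rewrite /coo !mulmxA mulmxKV. Qed.

Lemma coo_inj X Y : coo X = coo Y -> X = Y.
Proof.
move=> h; have := congr1 (fun Z => invmx Q *m Z *m Q) h.
by rewrite /coo !mulmxA mulVmx// !mul1mx !mulmxKV.
Qed.

Lemma coo_bracket X Y : coo (bracket X Y) = bracket (coo X) (coo Y).
Proof. by rewrite /bracket cooD cooN !cooM. Qed.

Lemma lamZ i s X : lam i (s *: X) = s * lam i X.
Proof. by rewrite /lam cooZ mxE. Qed.

Lemma lamD i X Y : lam i (X + Y) = lam i X + lam i Y.
Proof. by rewrite /lam cooD mxE. Qed.

Lemma coo_diag x : x \in a -> coo x = diag_mx (\row_i lam i x).
Proof.
move=> /aQ /is_diag_mxP h; apply/matrixP => i j.
rewrite [RHS]mxE [(\row__ _) _ _]mxE; case: eqVneq => [->|ij]; first by rewrite mulr1n.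
exact: h.
Qed.

Lemma bracket_torus_coo h X i j : h \in a ->
  coo (bracket h X) i j = (lam i h - lam j h) * coo X i j.
Proof.
move=> ha; rewrite coo_bracket /bracket coo_diag//; move: (coo X) => Z.
by rewrite [_ * Z]mul_diag_mx [Z * _]mul_mx_diag !mxE [Z i j * _]mulrC mulrBl.
Qed.

Definition mask_mx (q : 'I_n.+1 -> 'I_n.+1 -> bool) (X : M) : M :=
  invmx Q *m (\matrix_(i, j) (if q i j then coo X i j else 0)) *m Q.

Lemma coo_mask q X i j : coo (mask_mx q X) i j = if q i j then coo X i j else 0.
Proof. by rewrite /coo /mask_mx !mulmxA mulmxV// mul1mx mulmxK// mxE. Qed.

(** Spectral projections of [ad h] are polynomials in [ad h], hence preserve
    the Lie algebra. *)
Lemma mask_eigen h s X : h \in a -> X \in g ->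
  mask_mx (fun i j => lam i h - lam j h == s) X \in g.
Proof.
move=> ha Xg.
have main (vs : seq R) : s \notin vs -> exists2 Y, Y \in g & forall i j,
    coo Y i j = coo X i j * \prod_(v <- vs) ((lam i h - lam j h - v) / (s - v)).
  elim: vs => [_|v vs IH]; first by exists X => // i j; rewrite big_nil mulr1.
  rewrite inE negb_or => /andP[sv /IH[Y Yg hY]].
  exists ((s - v)^-1 *: (bracket h Y - v *: Y)).
    apply/memvZ/memvB; last exact: memvZ.
    by apply: (bracket_mem cG hg) => //; exact: (subvP ag).
  move=> i j; rewrite cooZe cooBe cooZe bracket_torus_coo// hY big_cons.
  ring.
pose vs := [seq lam ij.1 h - lam ij.2 h | ij : 'I_n.+1 * 'I_n.+1 <-
   enum {: 'I_n.+1 * 'I_n.+1} & lam ij.1 h - lam ij.2 h != s].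
have [|Y Yg hY] := main vs.
  by apply/negP => /mapP[ij]; rewrite mem_filter => /andP[/eqP hs _] e; exact: hs.
suff -> : mask_mx (fun i j => lam i h - lam j h == s) X = Y by [].
apply: coo_inj; apply/matrixP => i j; rewrite coo_mask hY.
case: eqP => [e|/eqP ne].
  rewrite e big1_seq ?mulr1// => v /andP[_ /mapP[ij]].
  rewrite mem_filter => /andP[ns _] ->.
  by rewrite divff// subr_eq0 eq_sym.
suff -> : \prod_(v <- vs) ((lam i h - lam j h - v) / (s - v)) = 0 by rewrite mulr0.
have /perm_to_rem/seq.permP vsp : lam i h - lam j h \in vs.
  apply/mapP; exists (i, j) => //; rewrite mem_filter/= ne mem_enum//.
rewrite (perm_big (lam i h - lam j h :: rem (lam i h - lam j h) vs))/=; last exact/seq.permP.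
by rewrite big_cons subrr mul0r mul0r.
Qed.

Lemma mask_comp q q' X : mask_mx q (mask_mx q' X) = mask_mx (fun i j => q i j && q' i j) X.
Proof.
by apply: coo_inj; apply/matrixP => i j; rewrite !coo_mask; case: (q i j).
Qed.

Lemma mask_ext q q' X : (forall i j, coo X i j != 0 -> q i j = q' i j) -> mask_mx q X = mask_mx q' X.
Proof.
move=> h; apply: coo_inj; apply/matrixP => i j; rewrite !coo_mask.
case: (eqVneq (coo X i j) 0) => [->|/h ->//]; by do 2?case: ifP.
Qed.

Lemma mask_eigen_in h (vs : seq R) X : h \in a -> X \in g -> uniq vs ->
  mask_mx (fun i j => lam i h - lam j h \in vs) X \in g.
Proof.
move=> ha Xg; elim: vs => [_|v vs IH /= /andP[vvs uvs]].
  suff -> : mask_mx (fun i j => lam i h - lam j h \in [::]) X = 0 by exact: mem0v.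
  by apply: coo_inj; apply/matrixP => i j; rewrite coo_mask coo0e.
have -> : mask_mx (fun i j => lam i h - lam j h \in v :: vs) X =
    mask_mx (fun i j => lam i h - lam j h == v) X + mask_mx (fun i j => lam i h - lam j h \in vs) X.
  apply: coo_inj; apply/matrixP => i j; rewrite cooDe !coo_mask inE.
  by case: eqP => [->|_]; rewrite ?(negbTE vvs) ?addr0 ?add0r.
by apply: memvD; [exact: mask_eigen|exact: IH].
Qed.

(** Grouping spectral projections of [ad h] according to a predicate on the
    eigenvalue; used to split [X] into raising and lowering parts. *)
Lemma mask_half h X (p : pred R) : h \in a -> X \in g ->
  mask_mx (fun i j => p (lam i h - lam j h)) X \in g.
Proof.
move=> ha Xg.
pose vs := undup [seq lam ij.1 h - lam ij.2 h | ij : 'I_n.+1 * 'I_n.+1 <-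
   enum {: 'I_n.+1 * 'I_n.+1} & p (lam ij.1 h - lam ij.2 h)].
have := mask_eigen_in ha Xg (undup_uniq _ : uniq vs).
rewrite (@mask_ext _ (fun i j => p (lam i h - lam j h)))// => i j _.
rewrite mem_undup; apply/idP/idP => [/mapP[ij]|pij].
  by rewrite mem_filter => /andP[pij _] ->.
by apply/mapP; exists (i, j) => //; rewrite mem_filter/= pij mem_enum.
Qed.

Lemma mask_weight (hs : seq M) i0 j0 X : X \in g -> {subset hs <= a} ->
  mask_mx (fun i j => all (fun h => lam i h - lam j h == lam i0 h - lam j0 h) hs) X \in g.
Proof.
move=> Xg; elim: hs => [_|h hs IH sub].
  rewrite (_ : mask_mx _ X = X)//.
  by apply: coo_inj; apply/matrixP => i j; rewrite coo_mask.
rewrite -(mask_comp (fun i j => lam i h - lam j h == lam i0 h - lam j0 h)).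
apply: mask_eigen; first by apply: sub; rewrite inE eqxx.
by apply: IH => x xhs; apply: sub; rewrite inE xhs orbT.
Qed.

(** A nonzero entry of an element of [g] at the place [(i, j)] yields a
    weight vector for the difference of the weights [i] and [j], which is then
    zero or a root, hence of constant sign on the open chamber. *)
Lemma weight_sign X i j : X \in g -> coo X i j != 0 ->
  [\/ forall x, x \in a -> lam i x = lam j x,
      forall x, open_chamber P x -> lam j x < lam i x |
      forall x, open_chamber P x -> lam i x < lam j x].
Proof.
move=> Xg Xij.
pose beta (H : subvs_of a) : R := lam i (vsval H) - lam j (vsval H).
have lin_beta : linear beta.
  by move=> s u v; rewrite /beta linearP/= !lamD !lamZ /GRing.scale/=; ring.
pose B : {linear subvs_of a -> R^o} :=
  HB.pack beta (GRing.isLinear.Build R (subvs_of a) R^o *:%R beta lin_beta).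
pose alpha : dual a := linfun B.
have alphaE H : alpha H = beta H by rewrite lfunE.
have chamberE x : x \in a -> alpha (vsproj a x) = lam i x - lam j x.
  by move=> xa; rewrite alphaE /beta vsprojK.
have [eq|ne] := pselect (forall x, x \in a -> lam i x = lam j x); first by constructor 1.
have root : is_root g alpha.
  split.
    apply/eqP => alpha0; apply: ne => x xa; apply/eqP.
    by rewrite -subr_eq0 -chamberE// alpha0 lfunE.
  pose Y := mask_mx (fun k l => all (fun h => lam k h - lam l h == lam i h - lam j h) (vbasis a)) X.
  have Yij : coo Y i j = coo X i j.
    by rewrite coo_mask; case: allP => // -[]; move=> h _ /=.
  exists Y; split.
  - by apply: mask_weight => // h; exact: vbasis_mem.
  - apply: contraNneq Xij => Y0; by rewrite -Yij Y0 coo0e.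
  - move=> H; apply: coo_inj; apply/matrixP => k l.
    have Ha : vsval H \in a by exact: subvsP.
    rewrite bracket_torus_coo// cooZe alphaE /beta coo_mask.
    case: allP => [h|_]; last by rewrite !mulr0.
    congr (_ * _); rewrite (coord_vbasis Ha).
    have sum (s : 'I_n.+1) (m : nat) (F : 'I_m -> M) :
        lam s (\sum_(l < m) F l) = \sum_(l < m) lam s (F l).
      by rewrite (big_morph (lam s) (lamD s) (_ : lam s 0 = 0))// /lam coo0e.
    rewrite !sum -!sumrB; apply: eq_bigr => m _; rewrite !lamZ -!mulrBr; congr (_ * _).
    by apply/eqP/h/mem_nth; rewrite size_tuple.
have [_ /(_ _ root)[Pa|Pa] _ _] := hP.
  constructor 2 => x [xa /(_ _ Pa)]; rewrite chamberE// subr_gt0//.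
constructor 3 => x [xa /(_ _ Pa)].
by rewrite opp_lfunE chamberE// oppr_gt0 subr_lt0.
Qed.

(** Every point of the closed chamber is the limit of points of the open
    chamber obtained by adding small multiples of [z0]. *)
Lemma closed_chamber_limit (z0 x : M) (f : M -> R) :
  (forall s X Y, f (s *: X + Y) = s * f X + f Y) ->
  open_chamber P z0 -> (forall y, open_chamber P y -> 0 < f y) ->
  closed_chamber P x -> 0 <= f x.
Proof.
move=> flin [za zP] fpos [xa xP].
rewrite -[f x]subr0 subr_ge0; apply/ler_addgt0Pr => e e0.
pose s := e / (`|f z0| + 1).
have f1 : 0 < `|f z0| + 1 by rewrite ltr_wpDl.
have s0 : 0 < s by rewrite divr_gt0.
have : 0 < f (s *: z0 + x).
  apply: fpos; split; first by rewrite memvD// memvZ.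
  move=> alpha Pa; rewrite linearP/= linearP/=.
  by apply: ltr_pwDl; [rewrite /GRing.scale/= mulr_gt0// zP|exact: xP].
rewrite flin => h.
have : s * f z0 <= e.
  rewrite (le_trans (ler_norm _))// normrM gtr0_norm// /s mulrAC ler_pdivrMr//.
  by rewrite ler_wpM2l ?(ltW e0)// lerDl.
lra.
Qed.

End WeightFilters.

(** * Tensor powers and exterior products *)

Section TensorPowers.
Variables (R : realType) (n k d : nat).
Local Notation M := 'M[R]_n.+1.
Local Notation T := {ffun 'I_k -> 'I_n.+1}.
Local Notation W := 'M[R]_d.+1.
Local Notation K := (d.+1%:R : R).
Variable enc : 'I_d.+1 -> T.
Hypothesis encB : bijective enc.

(** Tensor product of the matrices [A l], in the basis of the tensor power
    indexed by functions, which [enc] numbers. *)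
Definition tens (A : 'I_k -> M) : W :=
  \matrix_(a, b) \prod_l A l (enc a l) (enc b l).

Definition rho (X : M) : W := tens (fun=> X).

(** The action of [X] on the [l]-th tensor factor. *)
Definition slot (l : 'I_k) (X : M) : W := tens (fun l' => if l' == l then X else 1).

(** The action of the Lie algebra on the tensor power, the derivative of [rho]. *)
Definition drho (X : M) : W := \sum_l slot l X.

Lemma tensM A B : tens A * tens B = tens (fun l => A l * B l).
Proof.
apply/matrixP => a b; rewrite !mxE.
have h j : tens A a j * tens B j b =
    \prod_l (A l (enc a l) (enc j l) * B l (enc j l) (enc b l)).
  by rewrite !mxE -big_split.
rewrite (eq_bigr _ (fun j _ => h j)).
rewrite -(reindex enc (P := xpredT) (F := fun c : T =>
   \prod_l (A l (enc a l) (c l) * B l (c l) (enc b l)))); last exact: onW_bij.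
rewrite -(bigA_distr_bigA (fun l i => A l (enc a l) i * B l i (enc b l))).
by apply: eq_bigr => l _; rewrite mxE.
Qed.

Lemma tens1 : tens (fun=> 1) = 1.
Proof.
have [dec encK decK] := encB.
apply/matrixP => a b; rewrite !mxE; case: eqVneq => [->|ab].
  by rewrite big1// => l _; rewrite mxE eqxx.
have [l hl] : exists l, enc a l != enc b l.
  apply/existsP; rewrite -negb_forall; apply: contra ab => /forallP h.
  by apply/eqP/(can_inj encK)/ffunP => l; apply/eqP/h.
by rewrite (bigD1 l)//= mxE (negbTE hl) mul0r.
Qed.

Lemma eq_tens A B : A =1 B -> tens A = tens B.
Proof. by move=> h; apply/matrixP => a b; rewrite !mxE; apply: eq_bigr => l _; rewrite h. Qed.

Lemma rho1 : rho 1 = 1. Proof. exact: tens1. Qed.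

Lemma rhoM X Y : rho (X * Y) = rho X * rho Y. Proof. by rewrite /rho tensM. Qed.

Lemma slot_linear l s X Y : slot l (s *: X + Y) = s *: slot l X + slot l Y.
Proof.
apply/matrixP => a b; rewrite !mxE (bigD1 l)//= [in RHS](bigD1 l)//=.
rewrite [X in _ = _ + X](bigD1 l)//= !eqxx !mxE.
have e Z Z' : \prod_(i < k | i != l) (if i == l then Z else 1 : M) (enc a i) (enc b i) =
  \prod_(i < k | i != l) (if i == l then Z' else 1 : M) (enc a i) (enc b i).
  by apply: eq_bigr => i /negbTE ->.
by rewrite (e (s *: X + Y) Y) (e X Y); ring.
Qed.

Lemma drho_linear : linear drho.
Proof.
move=> s X Y; rewrite /drho scaler_sumr -big_split/=.
by apply: eq_bigr => l _; rewrite slot_linear.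
Qed.

Lemma drhoZ s X : drho (s *: X) = s *: drho X.
Proof.
have drho0 : drho 0 = 0.
  by rewrite -[in LHS](subrr (1 : M)) addrC -scaleN1r drho_linear scaleN1r addNr.
by rewrite -[_ *: X]addr0 drho_linear drho0 addr0.
Qed.

Lemma slot_mul l X Y : slot l X * slot l Y = slot l (X * Y).
Proof. by rewrite tensM; apply: eq_tens => l'; case: eqP; rewrite ?mulr1. Qed.

Lemma slot_comm l l' X Y : l != l' -> slot l X * slot l' Y = slot l' Y * slot l X.
Proof.
move=> ll'; rewrite !tensM; apply: eq_tens => i.
by case: (eqVneq i l) => [->|_]; rewrite ?(negbTE ll') ?mul1r ?mulr1.
Qed.

Lemma drho_bracket X Y : drho X * drho Y - drho Y * drho X = drho (bracket X Y).
Proof.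
have e : drho X * drho Y = \sum_l \sum_l' slot l X * slot l' Y.
  by rewrite mulr_suml; apply: eq_bigr => l _; rewrite mulr_sumr.
have e' : drho Y * drho X = \sum_l \sum_l' slot l' Y * slot l X.
  rewrite mulr_suml exchange_big; apply: eq_bigr => l _.
  by rewrite mulr_sumr.
rewrite e e' -sumrB /drho; apply: eq_bigr => l _.
rewrite -sumrB (bigD1 l)//= big1 ?addr0 => [|l' ll'].
  by rewrite !slot_mul /bracket addrC -scaleN1r -slot_linear scaleN1r addrC.
by rewrite slot_comm ?subrr// eq_sym.
Qed.

Lemma norm_slot l X : `|slot l X| <= `|X|.
Proof.
apply: mx_norm_le => // a b; rewrite mxE normr_prod (bigD1 l)//= eqxx.
rewrite -[leRHS]mulr1; apply: ler_pM => //; first by rewrite prodr_ge0.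
  exact: entry_le_norm.
rewrite prodr_ile1// => i /negbTE ->; rewrite normr_ge0/= mxE.
by case: eqP => _ /=; rewrite ?normr1 ?normr0.
Qed.

Lemma rho_taylor : exists2 C : R, 0 <= C &
  forall X : M, `|X| <= 1 -> `|rho (1 + X) - (1 + drho X)| <= C * `|X| ^+ 2.
Proof.
(* Tensor factors are perturbed one at a time. *)
pose Pj (j : nat) (X : M) := tens (fun l => if (l < j)%N then 1 + X else 1).
pose Sj (j : nat) (X : M) : W := \sum_(l < k | (l < j)%N) slot l X.
have S_le j X : `|Sj j X| <= k%:R * `|X|.
  rewrite (le_trans (ler_norm_sum _ _ _))//.
  apply: (@le_trans _ _ (\sum_(l < k | (l < j)%N) `|X|)).
    by apply: ler_sum => l _; exact: norm_slot.
  rewrite sumr_const mulr_natl ler_wpMn2l//.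
  by rewrite (leq_trans (max_card _))// card_ord.
suff main j : (j <= k)%N -> exists2 C : R, 0 <= C &
    forall X : M, `|X| <= 1 -> `|Pj j X - (1 + Sj j X)| <= C * `|X| ^+ 2.
  have [C C0 hC] := main k (leqnn k); exists C => // X /hC.
  have -> : Pj k X = rho (1 + X) by apply: eq_tens => l; rewrite ltn_ord.
  by have -> : Sj k X = drho X by apply: eq_bigl => l; rewrite ltn_ord.
elim: j => [_|j IH jk].
  exists 0 => // X _; rewrite mul0r.
  have -> : Pj 0%N X = 1 by rewrite -tens1; apply: eq_tens => l.
  by rewrite /Sj big_pred0 ?addr0 ?subrr ?normr0.
have [C C0 hC] := IH (ltnW jk).
exists (C + K * (C + k%:R)) => [|X X1]; first by rewrite addr_ge0// mulr_ge0// addr_ge0.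
pose lj := Ordinal jk.
have eP : Pj j.+1 X = Pj j X * (1 + slot lj X).
  have -> : 1 + slot lj X = tens (fun l => if l == lj then 1 + X else 1).
    rewrite -[in LHS]tens1; have -> : tens (fun=> 1) = slot lj 1.
      by apply: eq_tens => l; case: eqP.
    by rewrite -[slot lj 1]scale1r -slot_linear scale1r.
  rewrite tensM; apply: eq_tens => l; rewrite ltnS leq_eqVlt.
  have -> : (l == lj) = (l == j :> nat) by [].
  by case: (eqVneq (l : nat) j) => [->|_]; rewrite ?ltnn ?mul1r ?mulr1.
have eS : Sj j.+1 X = Sj j X + slot lj X.
  rewrite /Sj (bigD1 lj)//= addrC; congr (_ + _).
  apply: eq_bigl => l; rewrite ltnS leq_eqVlt.
  have -> : (l == lj) = (l == j :> nat) by [].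
  by case: (eqVneq (l : nat) j) => [->|_]; rewrite ?ltnn ?andbT ?andbF.
have -> : Pj j.+1 X - (1 + Sj j.+1 X) =
    (Pj j X - (1 + Sj j X)) + (Pj j X - 1) * slot lj X.
  rewrite eP eS mulrDr mulr1 mulrBl mul1r.
  move: (Pj j X) (Sj j X) (slot lj X) (_ * slot _ _) => A B D E.
  by apply/matrixP => a b; rewrite !mxE; ring.
have P1 : `|Pj j X - 1| <= (C + k%:R) * `|X|.
  have -> : Pj j X - 1 = (Pj j X - (1 + Sj j X)) + Sj j X.
    by rewrite opprD addrA subrK.
  rewrite (le_trans (ler_normD _ _))// mulrDl lerD//.
  rewrite (le_trans (hC X X1))// ler_wpM2l// expr2 ler_piMr//.
rewrite (le_trans (ler_normD _ _))// [leRHS]mulrDl lerD ?hC//.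
rewrite (le_trans (norm_mulr_mx _ _))// -!mulrA ler_wpM2l// expr2 mulrA.
by apply: ler_pM => //; exact: norm_slot.
Qed.

Lemma rho_bounded b : exists2 C : R, 0 <= C & forall X : M, `|X| <= b -> `|rho X| <= C.
Proof.
exists (`|b| ^+ k) => [|X Xb]; first exact: exprn_ge0.
apply: mx_norm_le => [|a c]; first exact: exprn_ge0.
rewrite mxE normr_prod -[k in leRHS]card_ord -prodr_const.
apply: ler_prod => l _; rewrite normr_ge0/=.
by rewrite (le_trans (entry_le_norm _ _ _))// (le_trans Xb)// ler_norm.
Qed.

Lemma rho_diag (D : 'rV[R]_n.+1) :
  rho (diag_mx D) = diag_mx (\row_a \prod_l D 0 (enc a l)).
Proof.
have [dec encK decK] := encB.
apply/matrixP => a b; rewrite !mxE; case: eqVneq => [->|ab].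
  by rewrite mulr1n; apply: eq_bigr => l _; rewrite mxE eqxx mulr1n.
have [l hl] : exists l, enc a l != enc b l.
  apply/existsP; rewrite -negb_forall; apply: contra ab => /forallP h.
  by apply/eqP/(can_inj encK)/ffunP => l; apply/eqP/h.
by rewrite mulr0n (bigD1 l)//= mxE (negbTE hl) mulr0n mul0r.
Qed.

(** Integration of the Lie algebra action: the exponential is a limit of powers
    of matrices that preserve the subspace. *)
Lemma drho_stable_exp m (U : 'M[R]_(m, d.+1)) (Z : W) X :
  (forall V : 'M[R]_(m, d.+1), V *m Z = 0 -> (V *m drho X) *m Z = 0) ->
  U *m Z = 0 -> U *m rho (expmx X) *m Z = 0.
Proof.
move=> stab U0.
have [C C0 hC] := rho_taylor.
have [c c0 hc] := expmx_scale_near1 X.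
have [L L0 hL] : exists2 L : R, 0 <= L & forall Y, `|drho Y| <= L * `|Y|.
  exists k%:R => // Y; rewrite (le_trans (ler_norm_sum _ _ _))//.
  apply: (@le_trans _ _ (\sum_(l < k) `|Y|)).
    by apply: ler_sum => l _; exact: norm_slot.
  by rewrite sumr_const card_ord mulr_natl.
pose b := `|X| + c + 1.
have X0 : 0 <= `|X| by [].
have b1 : 1 <= b by rewrite /b; lra.
have b0 : 0 <= b by exact: le_trans b1.
pose e1 := L * c + C * b ^+ 2.
have e10 : 0 <= e1 by rewrite addr_ge0// mulr_ge0// exprn_ge0.
pose D1 := e1 + L * `|X|.
have D10 : 0 <= D1 by rewrite addr_ge0// mulr_ge0.
pose E1 := K * `|U| * (K * e1 * expR (K * D1)) * K * `|Z|.
have E10 : 0 <= E1 by rewrite !mulr_ge0// expR_ge0.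
(* [rho (expmx X)] is compared with a power of the identity plus [drho X] over
   [N.+1], which preserves the subspace. *)
have small N : b <= N.+1%:R -> `|U *m rho (expmx X) *m Z| <= E1 / N.+1%:R.
  move=> bN; pose t : R := N.+1%:R^-1.
  have N0 : 0 < N.+1%:R :> R by rewrite ltr0n.
  have t0 : 0 < t by rewrite invr_gt0.
  have tb : t * b <= 1 by rewrite mulrC ler_pdivrMr// mul1r.
  have t1 : t <= 1 by rewrite invf_le1// (le_trans b1).
  have tX : t * `|X| <= 1 by apply: le_trans tb; rewrite ler_wpM2l ?(ltW t0)// /b; lra.
  have t2 : t ^+ 2 <= t by rewrite expr2 ler_piMl// ltW.
  have hexp : `|expmx (t *: X) - (1 + t *: X)| <= c * t ^+ 2.
    by apply: hc; rewrite gtr0_norm.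
  pose Y := expmx (t *: X) - 1.
  have Yb : `|Y| <= t * b.
    have -> : Y = (expmx (t *: X) - (1 + t *: X)) + t *: X by rewrite opprD addrA subrK.
    rewrite (le_trans (ler_normD _ _))// normrZ gtr0_norm//.
    have : c * t ^+ 2 <= c * t by rewrite ler_wpM2l.
    by rewrite /b; lra.
  have Y1 : `|Y| <= 1 by exact: le_trans tb.
  pose A := rho (expmx (t *: X)); pose B := 1 + drho (t *: X).
  have AB : `|A - B| <= e1 * t ^+ 2.
    have -> : A - B = (rho (1 + Y) - (1 + drho Y)) + drho (Y - t *: X).
      have -> : drho (Y - t *: X) = drho Y - drho (t *: X).
        by rewrite addrC -scaleN1r drho_linear scaleN1r addrC.
      rewrite /A /B [1 + Y]addrC subrK.
      move: (rho _) (drho Y) (drho _) => r1 r2 r3.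
      by apply/matrixP => i j; rewrite !mxE; ring.
    rewrite (le_trans (ler_normD _ _))// /e1 mulrDl addrC lerD//.
      rewrite (le_trans (hL _))// -mulrA ler_wpM2l//.
      by have -> : Y - t *: X = expmx (t *: X) - (1 + t *: X) by rewrite opprD addrA.
    rewrite (le_trans (hC _ Y1))// -mulrA ler_wpM2l// -exprMn mulrC.
    by rewrite lerXn2r ?nnegrE ?mulr_ge0 ?(ltW t0).
  have B1 : `|B - 1| <= D1 * t.
    rewrite /B [1 + _]addrC addrK (le_trans (hL _))// normrZ gtr0_norm// mulrCA mulrC.
    by rewrite ler_wpM2r ?(ltW t0)// /D1 lerDr.
  have A1 : `|A - 1| <= D1 * t.
    have -> : A - 1 = (A - B) + drho (t *: X) by rewrite /B opprD addrA subrK.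
    rewrite (le_trans (ler_normD _ _))// /D1 mulrDl lerD//.
      by rewrite (le_trans AB)// ler_wpM2l.
    by rewrite (le_trans (hL _))// normrZ gtr0_norm// mulrCA mulrC.
  have rN : rho (expmx X) = A ^+ N.+1.
    have -> : expmx X = expmx (t *: X) ^+ N.+1.
      by rewrite -expmxM_nat scalerA mulfV ?gt_eqF// scale1r.
    rewrite /A; elim: N.+1 => [|j IH]; first by rewrite !expr0 rho1.
    by rewrite !exprS rhoM IH.
  have UB j : U *m B ^+ j *m Z = 0.
    elim: j => [|j IH]; first by rewrite expr0 mulmx1.
    have eB : B = 1 + t *: drho X by rewrite /B drhoZ.
    rewrite exprSr -mulmxE mulmxA; move: (B ^+ j) IH => Bj IH.
    rewrite eB mulmxDr mulmx1 mulmxDl IH add0r -scalemxAr -scalemxAl.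
    by rewrite (stab _ IH) scaler0.
  have -> : U *m rho (expmx X) *m Z = U *m (A ^+ N.+1 - B ^+ N.+1) *m Z.
    by rewrite mulmxBr mulmxBl UB subr0 rN.
  have hAB := norm_expr_sub N.+1 A1 B1.
  have hAB2 : `|A ^+ N.+1 - B ^+ N.+1| <= K * e1 * expR (K * D1) * t.
    rewrite (le_trans hAB)//.
    have -> : N.+1%:R * (K * (D1 * t)) = K * D1.
      by rewrite /t; field; rewrite gt_eqF.
    rewrite [leRHS]mulrAC ler_wpM2r ?expR_ge0//.
    have -> : K * e1 * t = N.+1%:R * K * (e1 * t ^+ 2).
      by rewrite /t; field; rewrite gt_eqF.
    by rewrite ler_wpM2l// mulr_ge0.
  rewrite (le_trans (norm_mulmx_le _ _))//.
  have -> : E1 / N.+1%:R = K * (K * `|U| * (K * e1 * expR (K * D1) * t)) * `|Z|.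
    by rewrite /E1 /t; ring.
  rewrite ler_wpM2r// ler_wpM2l// (le_trans (norm_mulmx_le _ _))//.
  by rewrite ler_wpM2l// mulr_ge0.
apply/eqP; rewrite -normr_le0; apply/ler_addgt0Pr => e e0; rewrite add0r.
pose N := Num.truncn (Num.max b (E1 / e)).
have hN : Num.max b (E1 / e) < N.+1%:R by exact: truncnS_gt.
have bN : b <= N.+1%:R by rewrite (le_trans _ (ltW hN))// le_max lexx.
apply: (le_trans (small _ bN)); rewrite ler_pdivrMr ?ltr0n// mulrC -ler_pdivrMr//.
by rewrite (le_trans _ (ltW hN))// le_max lexx orbT.
Qed.

End TensorPowers.

Section Wedge.
Variables (R : realType) (n k d : nat).
Local Notation M := 'M[R]_n.+1.
Local Notation T := {ffun 'I_k -> 'I_n.+1}.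
Variable enc : 'I_d.+1 -> T.
Hypothesis encB : bijective enc.

(** The exterior product of the rows of [B], as an antisymmetric tensor. *)
Definition wedge (B : 'M[R]_(k, n.+1)) : 'rV[R]_d.+1 :=
  \row_a \det (\matrix_(l, j) B j (enc a l)).

Lemma wedge_rho B Z : wedge B *m rho enc Z = wedge (B *m Z).
Proof.
apply/rowP => b; rewrite !mxE.
transitivity (\sum_a \sum_(s : {perm 'I_k}) (-1) ^+ s *
    \prod_l (B (s l) (enc a l) * Z (enc a l) (enc b l))).
  apply: eq_bigr => a _; rewrite !mxE /determinant mulr_suml.
  apply: eq_bigr => s _; rewrite -mulrA -big_split/=; congr (_ * _).
  by apply: eq_bigr => l _; rewrite mxE.
rewrite exchange_big /determinant; apply: eq_bigr => s _.
rewrite -mulr_sumr; congr (_ * _).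
rewrite -(reindex enc (P := xpredT) (F := fun c : T =>
   \prod_l (B (s l) (c l) * Z (c l) (enc b l)))); last exact: onW_bij.
rewrite -(bigA_distr_bigA (fun l i => B (s l) i * Z i (enc b l))).
by apply: eq_bigr => l _; rewrite !mxE.
Qed.

Lemma wedge_mul Y B : wedge (Y *m B) = \det Y *: wedge B.
Proof.
apply/rowP => a; rewrite !mxE.
have -> : \matrix_(l, j) (Y *m B) j (enc a l) = (\matrix_(l, j) B j (enc a l)) *m Y^T.
  by apply/matrixP => l j; rewrite !mxE; apply: eq_bigr => i _; rewrite !mxE mulrC.
by rewrite det_mulmx det_tr mulrC.
Qed.

(** Differentiate at [s = 0] the identity given by [wedge_rho] and [wedge_mul]
    for [1 + s *: Z], whose scalar factor is a determinant. *)
Lemma wedge_drho B Y Z : B *m Z = Y *m B ->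
  exists c, wedge B *m drho enc Z = c *: wedge B.
Proof.
move=> BZ; set v := wedge B.
suff : v *m drho enc Z *m cokermx v = 0.
  move=> /eqP; rewrite -submxE => /sub_rVP[c ->]; by exists c.
wlog Z1 : Y Z BZ / `|Z| <= 1 => [H|].
  have z0 : 0 < `|Z| + 1 by rewrite ltr_wpDl.
  have := H ((`|Z| + 1)^-1 *: Y) ((`|Z| + 1)^-1 *: Z).
  rewrite -scalemxAr BZ scalemxAl => /(_ erefl).
  rewrite drhoZ normrZ gtr0_norm ?invr_gt0// ler_pdivrMl// mulr1 lerDl => /(_ ler01).
  rewrite -scalemxAr -scalemxAl => /eqP.
  by rewrite scaler_eq0 invr_eq0 gt_eqF//= => /eqP.
have v0 : v *m cokermx v = 0 by exact: mulmx_coker.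
have [C C0 hC] := rho_taylor R encB.
have vrho s : v *m rho enc (1 + s *: Z) *m cokermx v = 0.
  rewrite wedge_rho.
  have -> : B *m (1 + s *: Z) = (1%:M + s *: Y) *m B.
    by rewrite mulmxDr mulmx1 mulmxDl mul1mx -scalemxAr BZ scalemxAl.
  by rewrite wedge_mul -scalemxAl v0 scaler0.
apply: (@second_order_zero _ _ _ (d.+1%:R * (d.+1%:R * `|v| * C) * `|cokermx v|)) => t t0 t1.
have tZ : `|t *: Z| <= t by rewrite normrZ gtr0_norm// ler_piMr// ltW.
have -> : t *: (v *m drho enc Z *m cokermx v) =
   - (v *m (rho enc (1 + t *: Z) - (1 + drho enc (t *: Z))) *m cokermx v).
  rewrite mulmxBr mulmxBl vrho sub0r opprK mulmxDr mulmx1 mulmxDl v0 add0r.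
  by rewrite drhoZ -scalemxAr -scalemxAl.
rewrite normrN (le_trans (norm_mulmx_le _ _))// [leRHS]mulrAC ler_wpM2r//.
rewrite -[leRHS]mulrA; apply: ler_wpM2l => //; apply: (le_trans (norm_mulmx_le _ _)).
rewrite -!mulrA; do 2?apply: ler_wpM2l => //.
apply: (le_trans (hC _ (le_trans tZ t1))); apply: ler_wpM2l => //.
by rewrite lerXn2r ?nnegrE ?(ltW t0).
Qed.

Lemma drho_sparse (Z : M) a b : drho enc Z a b != 0 ->
  exists2 l, Z (enc a l) (enc b l) != 0 & forall l', l' != l -> enc a l' = enc b l'.
Proof.
move=> ne; have [l hl] : exists l, slot enc l Z a b != 0.
  apply/existsP; rewrite -negb_forall; apply: contraNN ne => /forallP h.
  by rewrite summxE big1// => l _; apply/eqP.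
exists l.
  by apply: contra hl => /eqP z; rewrite mxE (bigD1 l)//= eqxx z mul0r.
move=> l' l'l; apply/eqP; apply: contraT => ne'; move: hl.
by rewrite mxE (bigD1 l')//= (negbTE l'l) mxE (negbTE ne') mul0r eqxx.
Qed.

Lemma rho_near : exists2 C : R, 0 <= C & forall X : M, `|X| <= 1 -> `|rho enc (1 + X) - 1| <= C * `|X|.
Proof.
have [C C0 hC] := rho_taylor R encB.
exists (C + k%:R) => [|X X1]; first by rewrite addr_ge0.
have -> : rho enc (1 + X) - 1 = (rho enc (1 + X) - (1 + drho enc X)) + drho enc X.
  by rewrite opprD addrA subrK.
rewrite (le_trans (ler_normD _ _))// mulrDl lerD//.
  by rewrite (le_trans (hC _ X1))// ler_wpM2l// expr2 ler_piMr.
rewrite (le_trans (ler_norm_sum _ _ _))//.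
apply: (@le_trans _ _ (\sum_(l < k) `|X|)).
  by apply: ler_sum => l _; exact: norm_slot.
by rewrite sumr_const card_ord mulr_natl.
Qed.

End Wedge.

(** A matrix of maximal rank with rows in the subspace spans it. *)
Lemma subspace_matrix (F : fieldType) d (D : 'rV[F]_d -> Prop) :
  D 0 -> (forall s u v, D u -> D v -> D (s *: u + v)) ->
  exists r (B : 'M[F]_(r, d)), row_free B /\ forall v, D v <-> (v <= B)%MS.
Proof.
move=> D0 DL.
pose p r := `[< exists A : 'M[F]_d, \rank A = r /\ forall v : 'rV_d, (v <= A)%MS -> D v >].
have p0 : exists r, p r.
  exists 0%N; apply/asboolP; exists 0; split; first by rewrite mxrank0.
  by move=> v; rewrite submx0 => /eqP ->.
have pd r : p r -> (r <= d)%N.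
  by move=> /asboolP[A [<- _]]; exact: rank_leq_col.
have [r /asboolP[A [rA DA]] rmax] := ex_maxnP p0 pd.
exists (\rank A), (row_base A); split => [|v]; first exact: row_base_free.
split=> [Dv|]; last by rewrite eq_row_base => /DA.
rewrite eq_row_base; apply: contraT => vA.
have : (A < A + v)%MS.
  rewrite /ltmx addsmxSl/=; apply: contra vA => /(submx_trans _) -> //.
  exact: addsmxSr.
move=> /rank_ltmx; rewrite rA ltnNge => /negP[]; apply: rmax.
apply/asboolP; exists (A + v)%MS; split => // w /sub_addsmxP[[u1 u2] ->] /=.
by rewrite addrC [u2]mx11_scalar mul_scalar_mx; apply: DL => //; apply/DA/submxMl.
Qed.

(** * Highest weight representations *)

Section HighestWeight.
Variables (R : realType) (n : nat).
Local Notation M := 'M[R]_n.+1.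
Variables (G : set M) (g a : {vspace M}) (Q : M).
Hypotheses (cG : closed_subgroup_GL G) (hg : is_lie_algebra G g).
Hypothesis Gconn : connected G.
Hypothesis Qu : Q \in unitmx.
Hypothesis ag : (a <= g)%VS.
Hypothesis aQ : forall x, x \in a -> diag_in Q x.
Variable P : set (dual a).
Hypothesis hP : positive_system g P.
Variable z0 : M.
Hypothesis z0P : open_chamber P z0.
Variable I : {set 'I_n.+1}.
Hypothesis Iup : forall i j X, i \in I -> X \in g -> coo Q X i j != 0 ->
  lam Q i z0 <= lam Q j z0 -> j \in I.
Local Notation T := {ffun 'I_#|I| -> 'I_n.+1}.
Variables (d : nat) (enc : 'I_d.+1 -> T).
Hypothesis encB : bijective enc.

Local Notation Drho X := (drho enc (coo Q X)).

(** Weights of the tensor power; [I] is a set of indices stable under the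
    raising operators of [g]. *)
Definition weight (b : T) (x : M) : R := \sum_l lam Q (b l) x.
Definition top_weight (x : M) : R := \sum_(i in I) lam Q i x.
Definition lower_weight (b : T) := forall x, open_chamber P x -> weight b x < top_weight x.

Definition top_basis : 'M[R]_(#|I|, n.+1) := \matrix_(j, i) (i == enum_val j)%:R.
Definition top_vector : 'rV[R]_d.+1 := wedge enc top_basis.

(** Only lowering operators appear as generators, so that weights can only
    decrease; stability under the whole of [g] is [generated_stable]. *)
Inductive generated : 'rV[R]_d.+1 -> Prop :=
| generated_top : generated top_vector
| generated_0 : generated 0
| generated_lin s u v : generated u -> generated v -> generated (s *: u + v)
| generated_lower Y v : Y \in g ->
    (forall i j, coo Q Y i j != 0 -> lam Q j z0 < lam Q i z0) ->
    generated v -> generated (v *m Drho Y).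

Lemma Drho_linear s X Y : Drho (s *: X + Y) = s *: Drho X + Drho Y.
Proof. by rewrite coo_linear drho_linear. Qed.

(** The span of the basis vectors indexed by [I] is stable under raising
    operators, so that [top_vector] is one of their eigenvectors. *)
Lemma top_basis_raise X :
  (forall i j, i \in I -> coo Q X i j != 0 -> j \in I) ->
  exists Y, top_basis *m coo Q X = Y *m top_basis.
Proof.
move=> Xup; exists (\matrix_(j, j') coo Q X (enum_val j) (enum_val j')).
apply/matrixP => j i; rewrite !mxE (bigD1 (enum_val j))//= big1 => [|i' ne]; last first.
  by rewrite mxE (negbTE ne) mul0r.
rewrite mxE eqxx mul1r addr0.
have [iI|iI] := boolP (i \in I).
  rewrite (bigD1 (enum_rank_in iI i))//= big1 => [|j' ne]; last first.
    rewrite !mxE; case: eqP => [e|_]; last by rewrite mulr0.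
    by case/eqP: ne; rewrite -(enum_valK_in iI j') -e.
  by rewrite !mxE enum_rankK_in// eqxx mulr1 addr0.
rewrite big1 => [|j' _].
  apply/eqP; apply: contraNT iI; apply: Xup; exact: enum_valP.
rewrite !mxE; case: eqP => [e|_]; last by rewrite mulr0.
by move: iI; rewrite e enum_valP.
Qed.

(** The generated space is stable under the whole Lie algebra: raising
    operators are commuted past the lowering ones until they reach the
    eigenvector [top_vector]. *)
Lemma generated_stable v X : generated v -> X \in g -> generated (v *m Drho X).
Proof.
have [za _] := z0P.
move=> gv; elim: gv X => [X Xg|X Xg|s u w _ IHu _ IHw X Xg|Y w Yg Ylow gw IH X Xg].
- (* [L] is the lowering part of [X]; the rest preserves the line of [top_vector]. *)
  pose L := mask_mx Q (fun i j => 0 < lam Q i z0 - lam Q j z0) X.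
  have Lg : L \in g by exact: (mask_half cG hg Qu ag aQ (fun s => 0 < s)).
  have -> : top_vector *m Drho X = 1 *: (top_vector *m Drho L) + top_vector *m Drho (X - L).
    by rewrite scale1r -mulmxDr -[Drho L]scale1r -Drho_linear scale1r addrC subrK.
  apply: generated_lin.
    apply: generated_lower => //; last exact: generated_top.
    by move=> i j; rewrite coo_mask//; case: ifP => [|_]; rewrite ?subr_gt0// eqxx.
  have [Y hY] : exists Y, top_basis *m coo Q (X - L) = Y *m top_basis.
    apply: top_basis_raise => i j iI; rewrite cooBe coo_mask//.
    case: ifP => [_|h]; rewrite ?subrr ?eqxx// subr0 => Xij.
    by apply: (Iup iI Xg Xij); rewrite leNgt -subr_gt0 h.
  have [c hc] := wedge_drho encB hY; rewrite [_ *m _]hc -[_ *: _]addr0.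
  by apply: generated_lin; [exact: generated_top|exact: generated_0].
- by rewrite mul0mx; exact: generated_0.
- rewrite mulmxDl -scalemxAl; apply: generated_lin; [exact: IHu|exact: IHw].
- have -> : w *m Drho Y *m Drho X = 1 *: (w *m Drho X *m Drho Y) + w *m Drho (bracket Y X).
    rewrite scale1r coo_bracket// -(drho_bracket encB) -!mulmxA -mulmxDr; congr (_ *m _).
    by rewrite addrC subrK.
  apply: generated_lin; first by apply: generated_lower => //; exact: IH.
  apply: IH; exact: (bracket_mem cG hg).
Qed.

Lemma top_vector_support b : top_vector 0 b != 0 -> forall x, weight (enc b) x = top_weight x.
Proof.
move=> ne x.
have [s hs] : exists s : {perm 'I_#|I|}, forall l, enc b l = enum_val (s l).
  apply: contrapT => h; move: ne; rewrite mxE /determinant big1 ?eqxx// => s _.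
  have [l hl] : exists l, enc b l != enum_val (s l).
    apply/existsP; rewrite -negb_forall; apply/negP => /forallP h'; apply: h.
    by exists s => l; apply/eqP.
  by rewrite (bigD1 l)//= mxE mxE (negbTE hl) mul0r mulr0.
rewrite /weight /top_weight [RHS]big_enum_val [RHS](reindex_inj (@perm_inj _ s))/=.
by apply: eq_bigr => l _; rewrite hs.
Qed.

Lemma top_vector_neq0 : top_vector != 0.
Proof.
have [dec encK decK] := encB.
pose b := dec [ffun l => enum_val l].
apply/eqP => /rowP/(_ b); rewrite mxE [RHS]mxE decK.
have -> : \matrix_(l, j) top_basis j ([ffun l0 => enum_val l0] l) = 1%:M :> 'M[R]_#|I|.
  apply/matrixP => l j; rewrite !mxE ffunE (inj_eq enum_val_inj).
  by case: eqP.
by rewrite det1 => /eqP; rewrite oner_eq0.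
Qed.

(** Lowering operators strictly decrease weights on the open chamber, so that
    the top weight space is the line of [top_vector]. *)
Lemma generated_weights v : generated v ->
  exists c, forall b, v 0 b != c * top_vector 0 b -> lower_weight (enc b).
Proof.
elim=> [||s u w _ [c hc] _ [c' hc']|Y w Yg Ylow gw [c hc]].
- by exists 1 => b; rewrite mul1r eqxx.
- by exists 0 => b; rewrite mxE mul0r eqxx.
- exists (s * c + c') => b ne.
  have [eu|/hc//] := eqVneq (u 0 b) (c * top_vector 0 b).
  apply: hc'; apply: contraNneq ne => ew; rewrite mxE [X in X + _]mxE eu ew.
  by move: (top_vector 0 b) => tv; apply/eqP; ring.
- exists 0 => b; rewrite mul0r mxE => ne x xP.
  have [b' hb'] : exists b', w 0 b' * Drho Y b' b != 0.
    apply/existsP; rewrite -negb_forall; apply: contraNN ne => /forallP h.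
    by rewrite big1// => b' _; apply/eqP.
  move: hb'; rewrite mulf_eq0 negb_or => /andP[wb' Yb].
  have [l Yl hl] := drho_sparse Yb.
  apply: (@lt_le_trans _ _ (weight (enc b') x)).
    rewrite /weight (bigD1 l)//= [ltRHS](bigD1 l)//=.
    rewrite [X in _ + X < _](eq_bigr (fun l' => lam Q (enc b' l') x)) => [|l' /hl -> //].
    rewrite ltrD2r; have [eq|h|h] := weight_sign cG hg Qu ag aQ hP Yg Yl.
    + by have := Ylow _ _ Yl; have [za _] := z0P; rewrite eq// ltxx.
    + exact: h.
    + by have := lt_trans (h _ z0P) (Ylow _ _ Yl); rewrite ltxx.
  have [z|nz] := eqVneq (top_vector 0 b') 0; last by rewrite top_vector_support.
  by apply/ltW/(hc b') => //; rewrite z mulr0.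
Qed.

Lemma coo_norm : exists2 C : R, 0 <= C & forall X : M, `|coo Q X| <= C * `|X|.
Proof.
exists (n.+1%:R * (n.+1%:R * `|Q|) * `|invmx Q|) => [|X]; first by rewrite !mulr_ge0.
rewrite (le_trans (norm_mulmx_le _ _))// [leRHS]mulrAC ler_wpM2r//.
by rewrite -[leRHS]mulrA ler_wpM2l// norm_mulmx_le.
Qed.

(** Preserving a subspace is a closed condition on the group element. *)
Lemma rho_coo_closed m (B : 'M[R]_(m, d.+1)) (Z : 'M[R]_d.+1) x : x \in unitmx ->
  (forall e : R, 0 < e -> exists2 y : M, B *m rho enc (coo Q y) *m Z = 0 & `|x - y| <= e) ->
  B *m rho enc (coo Q x) *m Z = 0.
Proof.
move=> xu happ.
have [C C0 hC] := rho_near R encB.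
have [c c0 hc] := coo_norm.
pose L := c * (n.+1%:R * `|invmx x|).
have L0 : 0 <= L by rewrite !mulr_ge0.
pose A := B *m rho enc (coo Q x).
apply: (@second_order_zero _ _ _ (d.+1%:R * (d.+1%:R * `|A| * (C * L)) * `|Z|)) => t t0 t1.
pose e := t / (L + 1).
have L1 : 0 < L + 1 by rewrite ltr_wpDl.
have e0 : 0 < e by rewrite divr_gt0.
have [y By xy] := happ (e * t) (mulr_gt0 e0 t0).
pose W := coo Q (invmx x *m (y - x)).
have WL : `|W| <= L * (e * t).
  rewrite (le_trans (hc _))// /L -mulrA ler_wpM2l//.
  by rewrite (le_trans (norm_mulmx_le _ _))// ler_wpM2l ?mulr_ge0// distrC.
have Le : L * e <= 1.
  rewrite /e mulrA ler_pdivrMr// mul1r mulrC.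
  have : t * L <= 1 * L by rewrite ler_wpM2r.
  lra.
have W1 : `|W| <= 1.
  by apply: (le_trans WL); rewrite mulrA; apply: mulr_ile1 => //; [rewrite mulr_ge0//|]; exact: ltW.
have ey : coo Q y = coo Q x * (1 + W).
  have -> : 1 + W = coo Q (1 + invmx x *m (y - x)).
    by rewrite cooD; congr (_ + _); rewrite /coo mulmx1 mulmxV.
  by rewrite -[_ * _]cooM// mulmxDr mulmx1 mulmxA mulmxV// mul1mx addrC subrK.
have -> : t *: (A *m Z) = - (t *: (A *m (rho enc (1 + W) - 1) *m Z)).
  rewrite mulmxBr mulmx1 mulmxBl -scalerN opprB.
  have -> : A *m rho enc (1 + W) *m Z = 0.
    by rewrite -By ey rhoM// /A !mulmxA.
  by rewrite subr0.
rewrite normrN normrZ gtr0_norm//.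
have -> : d.+1%:R * (d.+1%:R * `|A| * (C * L)) * `|Z| * t ^+ 2 =
   t * (d.+1%:R * (d.+1%:R * `|A| * (C * (L * t))) * `|Z|) by ring.
apply: ler_wpM2l; first exact: ltW.
apply: (le_trans (norm_mulmx_le _ _)); apply: ler_wpM2r => //; apply: ler_wpM2l => //.
apply: (le_trans (norm_mulmx_le _ _)); apply: ler_wpM2l; first exact: mulr_ge0.
apply: (le_trans (hC _ W1)); apply: ler_wpM2l => //.
apply: (le_trans WL); apply: ler_wpM2l => //.
rewrite ler_piMl ?(ltW t0)// /e ler_pdivrMr// mul1r.
by apply: (le_trans t1); rewrite lerDr.
Qed.

Lemma rho_cooM x y :
  rho enc (coo Q (x *m y)) = rho enc (coo Q x) *m rho enc (coo Q y).
Proof.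
by have -> : coo Q (x *m y) = coo Q x * coo Q y; [exact: cooM|exact: rhoM].
Qed.

(** The elements of [G] that preserve the generated space form a closed
    subgroup containing all exponentials, which is [G] by connectedness. *)
Lemma generated_group_stable r (B : 'M[R]_(r, d.+1)) : row_free B ->
  (forall v, generated v <-> (v <= B)%MS) ->
  forall x, G x -> (B *m rho enc (coo Q x) <= B)%MS.
Proof.
move=> Bf hB; set Z := cokermx B.
have zero U (V : 'M[R]_(U, d.+1)) : (V <= B)%MS <-> V *m Z = 0.
  by rewrite submxE; split => [/eqP|->].
pose H := [set x | G x /\ B *m rho enc (coo Q x) *m Z = 0].
suff <- : H = G by move=> x [_ /zero].
have [Gu G1 GM GV Gc] := cG.
have coo1 : coo Q 1 = 1 by rewrite /coo mulmx1 mulmxV.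
have rM := rho_cooM.
apply: (closed_subgroup_exp cG Gconn) => [|x []//|X Xg].
  split.
  - by move=> x [/Gu].
  - by split => //; rewrite coo1 rho1// mulmx1 mulmx_coker.
  - move=> x y [Gx /zero hx] [Gy /zero hy]; split; first exact: GM.
    apply/zero; rewrite [x * y]/(x *m y) rM mulmxA (submx_trans _ hy)// submxMr//.
  - move=> x [Gx /zero /submxP[Y hY]]; split; first exact: GV.
    apply/zero.
    have xu : x \in unitmx by exact: Gu.
    have rV : rho enc (coo Q x) *m rho enc (coo Q (invmx x)) = 1%:M.
      by rewrite -rM mulmxV// coo1 rho1.
    have Yf : row_free Y.
      apply/row_freeP; exists (B *m rho enc (coo Q (invmx x)) *m pinvmx B).
      have e : B *m rho enc (coo Q x) *m rho enc (coo Q (invmx x)) = B.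
        by rewrite -mulmxA rV mulmx1.
      have := mulmxVp Bf; move: (pinvmx B) => p Bp.
      by rewrite !mulmxA -hY e Bp.
    have Yu : Y \in unitmx by rewrite -row_free_unit.
    have -> : B *m rho enc (coo Q (invmx x)) = invmx Y *m B.
      have -> : invmx Y *m B = invmx Y *m (Y *m B *m rho enc (coo Q (invmx x))).
        by rewrite -hY -[B *m _ *m _]mulmxA rV mulmx1.
      by rewrite -[Y *m B *m _]mulmxA mulKmx.
    exact: submxMl.
  - move=> x xu h; split; first by apply: Gc => // e /h[y [Gy _] xy]; exists y.
    by apply: rho_coo_closed => // e /h[y [_ By] xy]; exists y.
split; first by have := Xg 1; rewrite scale1r.
have -> : coo Q (expmx X) = expmx (coo Q X) by exact: expmx_conj.
apply: (drho_stable_exp encB) => [V /zero VB|]; last exact: mulmx_coker.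
apply/zero/row_subP => i; rewrite row_mul; apply/hB/generated_stable.
  by apply/hB; exact: submx_trans (row_sub _ _) VB.
exact/hg.
Qed.

Lemma rho_torus x : x \in a ->
  rho enc (coo Q (expmx x)) = diag_mx (\row_b expR (weight (enc b) x)).
Proof.
move=> xa; have -> : coo Q (expmx x) = expmx (coo Q x) by exact: expmx_conj.
rewrite expmx_diag; last exact: aQ.
have -> : \matrix_(i, j) (if i == j then expR (coo Q x i i) else 0) =
    diag_mx (\row_i expR (lam Q i x)).
  by apply/matrixP => i j; rewrite mxE [RHS]mxE [(\row__ _) _ _]mxE; case: eqP => [->|]; rewrite ?mulr1n.
rewrite rho_diag//; congr diag_mx; apply/rowP => b; rewrite !mxE expR_sum.
by apply: eq_bigr => l _; rewrite mxE.
Qed.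

Lemma top_vector_torus x : x \in a ->
  top_vector *m rho enc (coo Q (expmx x)) = expR (top_weight x) *: top_vector.
Proof.
move=> xa; rewrite rho_torus// mul_mx_diag; apply/rowP => b.
have := @top_vector_support b; move: top_vector => tv tv_support.
rewrite mxE [RHS]mxE [(\row__ _) _ _]mxE mulrC.
by have [->|ne] := eqVneq (tv 0 b) 0; rewrite ?mulr0// tv_support.
Qed.

(** The representation on the generated space. The top weight occurs with
    multiplicity one, so that on the torus the representation is the sum of a
    rank-one matrix carrying the top weight and of terms of lower weights. *)
Theorem highest_weight_module : exists r (rU : M -> 'M[R]_r.+1),
  [/\ forall x y, G x -> G y -> rU (x *m y) = rU x *m rU y,
      rU 1%:M = 1%:M,
      forall b : R, exists2 C : R, 0 <= C & forall x, `|x| <= b -> `|rU x| <= C &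
      exists (u : 'cV[R]_r.+1) (v : 'rV[R]_r.+1), [/\ u != 0, v != 0,
        forall x, x \in a -> v *m rU (expmx x) = expR (top_weight x) *: v &
        exists2 C : R, 0 <= C & forall x t, x \in a ->
          (forall b, lower_weight b -> weight b x + t <= top_weight x) ->
          `|rU (expmx x) - expR (top_weight x) *: (u *m v)| <= C * expR (top_weight x - t)]].
Proof.
have [r [B [Bf hB]]] := subspace_matrix generated_0 generated_lin.
have topB : (top_vector <= B)%MS by apply/hB/generated_top.
case: r B Bf hB topB => [|r] B Bf hB topB.
  have [w e] := submxP topB; case/eqP: top_vector_neq0.
  by rewrite e [B]flatmx0 mulmx0.
have stab := generated_group_stable Bf hB.
pose rU (x : M) : 'M[R]_r.+1 := B *m rho enc (coo Q x) *m pinvmx B.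
have rUB x : G x -> B *m rho enc (coo Q x) = rU x *m B.
  by move=> Gx; rewrite /rU mulmxKpV// stab.
have [c hc] := choice (fun i => generated_weights (proj2 (hB _) (row_sub i B))).
pose u : 'cV[R]_r.+1 := \col_i c i.
pose v := top_vector *m pinvmx B.
have vB : v *m B = top_vector by rewrite mulmxKpV.
have v0 : v != 0.
  by apply: contraNneq top_vector_neq0 => v0; rewrite -vB v0 mul0mx.
(* In [B1], from which the top weight is removed, only lower weights remain. *)
pose B1 := B - u *m top_vector.
have B1low i b : B1 i b != 0 -> lower_weight (enc b).
  move=> ne; apply: (hc i b); rewrite mxE; apply: contraNneq ne => e.
  have -> : B1 i b = B i b - u i 0 * top_vector 0 b.
    by rewrite mxE [X in _ + X]mxE [X in - X]mxE big_ord1.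
  by rewrite e [u _ _]mxE subrr.
have aG x : x \in a -> G (expmx x).
  by move=> /(subvP ag)/hg/(_ 1); rewrite scale1r.
have u0 : u != 0.
  apply/eqP => u0.
  have B1E : B1 = B by rewrite /B1 u0 mul0mx subr0.
  have /existsP[b hb] : [exists b, top_vector 0 b != 0].
    apply: contraT; rewrite negb_exists => /forallP h.
    case/eqP: top_vector_neq0; apply/rowP => b; rewrite [RHS]mxE.
    by apply/eqP; have := h b; rewrite negbK.
  have /existsP[i hi] : [exists i, B i b != 0].
    apply: contraT; rewrite negb_exists => /forallP h; move: hb.
    rewrite -vB mxE big1 ?eqxx// => i _; have := h i; rewrite negbK => /eqP ->.
    by rewrite mulr0.
  have := B1low i b; rewrite B1E => /(_ hi) /(_ _ z0P).
  by rewrite top_vector_support// ltxx.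
exists r, rU; split.
- move=> x y Gx Gy.
  have -> : rU (x *m y) = B *m rho enc (coo Q x) *m rho enc (coo Q y) *m pinvmx B.
    by rewrite /rU rho_cooM !mulmxA.
  by rewrite rUB// -[rU x *m _ *m _]mulmxA /rU !mulmxA.
- by rewrite /rU; have -> : coo Q 1%:M = 1 by [rewrite /coo mulmx1 mulmxV]; rewrite rho1// mulmx1 mulmxVp.
- move=> b; have [c1 c10 hc1] := coo_norm; have [C C0 hC] := rho_bounded enc (c1 * b).
  exists (d.+1%:R * (d.+1%:R * `|B| * C) * `|pinvmx B|) => [|x xb]; first by rewrite !mulr_ge0.
  apply: (le_trans (norm_mulmx_le _ _)); apply: ler_wpM2r => //; apply: ler_wpM2l => //.
  apply: (le_trans (norm_mulmx_le _ _)); apply: ler_wpM2l; first exact: mulr_ge0.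
  by apply: hC; apply: (le_trans (hc1 _)); exact: ler_wpM2l.
exists u, v; split => // [x xa|].
  by rewrite /rU mulmxA [v *m (B *m _)]mulmxA vB top_vector_torus// -scalemxAl.
exists (d.+1%:R * `|B1| * `|pinvmx B|) => [|x t xa hx]; first by rewrite !mulr_ge0.
have -> : rU (expmx x) - expR (top_weight x) *: (u *m v) =
    B1 *m rho enc (coo Q (expmx x)) *m pinvmx B.
  rewrite /B1 2!mulmxBl -[u *m _ *m _]mulmxA top_vector_torus//.
  by rewrite -scalemxAr -scalemxAl /v mulmxA.
apply: (le_trans (norm_mulmx_le _ _)); rewrite [leRHS]mulrAC; apply: ler_wpM2r => //.
rewrite -[leRHS]mulrA; apply: ler_wpM2l => //.
rewrite rho_torus// mul_mx_diag; apply: mx_norm_le => [|i b].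
  by rewrite mulr_ge0// expR_ge0.
rewrite mxE [(\row__ _) _ _]mxE normrM (gtr0_norm (expR_gt0 _)).
have [->|ne] := eqVneq (B1 i b) 0; first by rewrite normr0 mul0r mulr_ge0// expR_ge0.
apply: ler_pM; [exact: normr_ge0|exact: expR_ge0|exact: entry_le_norm|].
by rewrite ler_expR lerBrDr; apply: hx; exact: B1low ne.
Qed.

End HighestWeight.

(** * Cartan projections in highest weight representations *)

Section CartanProjection.
Variables (R : realType) (n : nat).
Local Notation M := 'M[R]_n.+1.
Variables (G : set M) (g a : {vspace M}) (Q : M).
Hypotheses (cG : closed_subgroup_GL G) (hg : is_lie_algebra G g).
Hypothesis Gconn : connected G.
Hypothesis Qu : Q \in unitmx.
Hypothesis ag : (a <= g)%VS.
Hypothesis aQ : forall x, x \in a -> diag_in Q x.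
Variable P : set (dual a).
Hypothesis hP : positive_system g P.
Variable z0 : M.
Hypothesis z0P : open_chamber P z0.
Variables (K : set M) (bK : R) (kappa : M -> M).
Hypothesis KG : K `<=` G.
Hypothesis KV : forall k, K k -> K (invmx k).
Hypothesis Kb : forall k, K k -> `|k| <= bK.
Hypothesis kappaP : forall x, G x -> closed_chamber P (kappa x) /\ in_KexpK K x (kappa x).

(** All differences of weights of the tensor powers in use are integral
    combinations of weights with bounded coefficients, encoded here by the two
    multiplicity functions [m] and [m']. *)
Definition weight_diff (m m' : {ffun 'I_n.+1 -> 'I_n.+2}) (x : M) : R :=
  \sum_j ((m j)%:R - (m' j)%:R) * lam Q j x.

(** [gapped x t] says that [x] is at depth [t] in the chamber, measured with
    all the combinations of weights that are positive on the open chamber. *)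
Definition gapped (x : M) (t : R) := forall m m',
  (forall z, open_chamber P z -> 0 < weight_diff m m' z) -> t <= weight_diff m m' x.

Definition upclosed (I : {set 'I_n.+1}) := forall i j X, i \in I -> X \in g ->
  coo Q X i j != 0 -> lam Q i z0 <= lam Q j z0 -> j \in I.

Lemma weight_diff_linear m m' s x y :
  weight_diff m m' (s *: x + y) = s * weight_diff m m' x + weight_diff m m' y.
Proof.
rewrite /weight_diff mulr_sumr -big_split/=; apply: eq_bigr => j _.
by rewrite lamD lamZ; ring.
Qed.

Lemma gapped0 x : closed_chamber P x -> gapped x 0.
Proof.
move=> xP m m' pos; apply: (closed_chamber_limit _ z0P pos xP) => s X Y.
exact: weight_diff_linear.
Qed.

Lemma gapped_le x s t : s <= t -> gapped x t -> gapped x s.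
Proof. by move=> st h m m' /h; exact: le_trans. Qed.

Lemma gappedD x y s t : gapped x s -> gapped y t -> gapped (x + y) (s + t).
Proof.
move=> hx hy m m' pos; rewrite -[x]scale1r weight_diff_linear mul1r.
by rewrite lerD ?hx ?hy.
Qed.

Lemma gappedZ x s t : 0 <= s -> gapped x t -> gapped (s *: x) (s * t).
Proof.
move=> s0 hx m m' pos; rewrite -[s *: x]addr0 weight_diff_linear.
have -> : weight_diff m m' 0 = 0.
  by rewrite /weight_diff big1// => j _; rewrite /lam coo0e mulr0.
by rewrite addr0 ler_wpM2l ?hx.
Qed.

Lemma lam_bounded : exists2 C : R, 0 <= C & forall j x, `|lam Q j x| <= C * `|x|.
Proof.
have [C C0 hC] := coo_norm Q; exists C => // j x.
exact: le_trans (entry_le_norm _ _ _) (hC x).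
Qed.

Lemma gapped_near : exists2 L : R, 0 <= L &
  forall x y t, gapped x t -> gapped y (t - L * `|y - x|).
Proof.
have [C C0 hC] := lam_bounded.
exists (n.+1%:R * (n.+2%:R * C)) => [|x y t hx m m' pos]; first by rewrite !mulr_ge0.
have -> : y = 1 *: x + (y - x) by rewrite scale1r addrC subrK.
rewrite weight_diff_linear mul1r lerD ?hx//.
rewrite [X in `|X|](_ : _ = y - x); last by rewrite scale1r addrC addKr.
move: (y - x) => w; rewrite lerNl (le_trans (ler_norm _))// normrN.
rewrite (le_trans (ler_norm_sum _ _ _))//.
apply: (@le_trans _ _ (\sum_(j < n.+1) n.+2%:R * C * `|w|)); last first.
  rewrite sumr_const card_ord -[leLHS]mulr_natl; move: (n.+1%:R : R) (n.+2%:R : R) => N1 N2.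
  by rewrite !mulrA.
apply: ler_sum => j _; rewrite normrM -mulrA; apply: ler_pM => //.
have := ltn_ord (m j); have := ltn_ord (m' j).
rewrite -(ltr_nat R) -[(m j < _)%N](ltr_nat R).
have := ler0n R (m j); have := ler0n R (m' j).
by rewrite ler_norml; lra.
Qed.

Lemma gapped_lower_weight (I : {set 'I_n.+1}) x t : gapped x t ->
  forall b : {ffun 'I_#|I| -> 'I_n.+1}, lower_weight Q P b ->
    weight Q b x + t <= top_weight Q I x.
Proof.
move=> hx b low.
pose m : {ffun 'I_n.+1 -> 'I_n.+2} := [ffun j => inord (j \in I)].
pose m' : {ffun 'I_n.+1 -> 'I_n.+2} := [ffun j => inord #|[pred l | b l == j]|].
have mm' y : weight_diff m m' y = top_weight Q I y - weight Q b y.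
  rewrite /weight_diff /top_weight /weight.
  have -> : \sum_l lam Q (b l) y = \sum_j (m' j)%:R * lam Q j y.
    rewrite (partition_big (fun l => b l) xpredT)//=; apply: eq_bigr => j _.
    rewrite (eq_bigr (fun=> lam Q j y)); last by move=> l /eqP ->.
    rewrite sumr_const /m' ffunE inordK ?mulr_natl//.
    rewrite ltnS (leq_trans (max_card _))// card_ord.
    by rewrite (leq_trans (max_card _))// card_ord.
  rewrite [X in _ = X - _]big_mkcond -sumrB; apply: eq_bigr => j _.
  rewrite mulrBl /m ffunE inordK; first by case: (j \in I); rewrite ?mul1r ?mul0r.
  by case: (j \in I).
by rewrite addrC -lerBrDr -mm'; apply: hx => z zP; rewrite mm' subr_gt0; exact: low.
Qed.

Lemma enum_tensors (I : {set 'I_n.+1}) :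
  exists d (enc : 'I_d.+1 -> {ffun 'I_#|I| -> 'I_n.+1}), bijective enc.
Proof.
pose T := {ffun 'I_#|I| -> 'I_n.+1}.
have c0 : (0 < #|{: T}|)%N by apply/card_gt0P; exists [ffun=> ord0].
have eC : #|{: T}|.-1.+1 = #|{: T}| by rewrite prednK.
exists #|{: T}|.-1, (fun i => enum_val (cast_ord eC i)).
by apply: bij_comp; [exact: enum_val_bij|exists (cast_ord (esym eC)); [exact: cast_ordK|exact: cast_ordKV]].
Qed.

(** The factors in [K] and their inverses have bounded norm in the
    representation, so everything is read off from the torus factor, where the
    top weight dominates all others on the chamber, by the depth of the Cartan
    projection. *)
Theorem norm_highest_weight I : upclosed I -> exists r (rU : M -> 'M[R]_r.+1) C,
  [/\ (forall x y, G x -> G y -> rU (x *m y) = rU x *m rU y) /\ rU 1%:M = 1%:M,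
      forall b : R, exists2 C : R, 0 <= C & forall x, `|x| <= b -> `|rU x| <= C,
      1 <= C,
      forall x, G x -> expR (top_weight Q I (kappa x)) <= C * `|rU x| /\
        `|rU x| <= C * expR (top_weight Q I (kappa x)) &
      forall x t, G x -> gapped (kappa x) t ->
        exists u v, near_rank1 (C * expR (- t)) (rU x) u v].
Proof.
move=> Iup; have [d [enc encB]] := enum_tensors I.
have [r [rU [rM r1 rb [u [v [u0 v0 vexp [C0 C00 hC0]]]]]]] :=
  highest_weight_module cG hg Gconn Qu ag aQ hP z0P Iup encB.
have [Ck Ck0 hCk] := rb bK.
have [Gu G1 GM GV _] := cG.
pose D : R := r.+1%:R.
have D1 : 1 <= D by rewrite ler1n.
have D0 : 0 <= D by exact: le_trans D1.
pose A1 := D ^+ 3 * Ck ^+ 2.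
pose A2 := D ^+ 2 * Ck ^+ 2.
have A10 : 0 <= A1 by rewrite mulr_ge0// exprn_ge0.
have A20 : 0 <= A2 by rewrite mulr_ge0// exprn_ge0.
pose A3 := A2 * (`|u *m v| + C0).
have A30 : 0 <= A3 by rewrite mulr_ge0// addr_ge0.
pose A4 := A2 * C0 * A1.
have A40 : 0 <= A4 by rewrite !mulr_ge0.
exists r, rU, (1 + A1 + A3 + A4).
have C1 : 1 <= 1 + A1 + A3 + A4 by lra.
have decomp x : G x -> exists k l, [/\ G k /\ G l, G (expmx (kappa x)), kappa x \in a,
    rU x = rU k *m rU (expmx (kappa x)) *m rU l &
    [/\ `|rU k| <= Ck, `|rU l| <= Ck, `|rU (invmx k)| <= Ck, `|rU (invmx l)| <= Ck &
      rU (invmx k) *m rU k = 1%:M /\ rU l *m rU (invmx l) = 1%:M]].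
  move=> Gx; have [[xa _] [k [l [Kk Kl xE]]]] := kappaP Gx.
  have Gk := KG Kk; have Gl := KG Kl.
  have Ge : G (expmx (kappa x)).
    by move: (xa) => /(subvP ag)/hg/(_ 1); rewrite scale1r.
  exists k, l; split => //; last first.
    split; rewrite ?hCk ?Kb//; try exact: KV.
    rewrite -!rM ?mulVmx ?mulmxV//; try exact: GV; try exact: Gu.
  by rewrite {1}xE rM ?rM//; exact: GM.
have norm3 (X Y Z : 'M[R]_r.+1) : `|X| <= Ck -> `|Z| <= Ck -> `|X *m Y *m Z| <= A2 * `|Y|.
  move=> hX hZ; apply: (le_trans (norm_mulmx_le _ _)).
  have -> : A2 * `|Y| = D * (D * Ck * `|Y|) * Ck by rewrite /A2; ring.
  apply: ler_pM => //.
  apply: ler_wpM2l => //; apply: (le_trans (norm_mulmx_le _ _)).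
  by apply: ler_wpM2r => //; apply: ler_wpM2l.
have expD x : x \in a -> expR (top_weight Q I x) <= D * `|rU (expmx x)|.
  move=> xa; have v_gt0 : 0 < `|v| by rewrite normr_gt0.
  have := norm_mulmx_le v (rU (expmx x)); rewrite vexp// normrZ (gtr0_norm (expR_gt0 _)).
  by rewrite mulrAC ler_pM2r.
have low x : G x -> expR (top_weight Q I (kappa x)) <= A1 * `|rU x|.
  move=> Gx; have [k [l [_ _ xa xE [hk hl hk' hl' [kV lV]]]]] := decomp x Gx.
  apply: (le_trans (expD _ xa)).
  have -> : A1 * `|rU x| = D * (A2 * `|rU x|) by rewrite /A1 /A2; ring.
  apply: ler_wpM2l => //.
  have -> : rU (expmx (kappa x)) = rU (invmx k) *m rU x *m rU (invmx l).
    by rewrite xE !mulmxA kV mul1mx -mulmxA lV mulmx1.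
  exact: norm3.
split => // [x Gx|x t Gx hgap].
  split.
    by apply: (le_trans (low x Gx)); apply: ler_wpM2r => //; lra.
  have [k [l [_ _ xa xE [hk hl _ _ _]]]] := decomp x Gx.
  rewrite xE; apply: (le_trans (norm3 _ _ _ hk hl)).
  apply: (@le_trans _ _ (A3 * expR (top_weight Q I (kappa x)))); last first.
    by apply: ler_wpM2r; [exact: expR_ge0|lra].
  rewrite /A3 -mulrA; apply: ler_wpM2l => //.
  have := hC0 (kappa x) 0 xa (gapped_lower_weight (gapped0 (kappaP Gx).1)).
  rewrite subr0 => h.
  rewrite -[rU _](subrK (expR (top_weight Q I (kappa x)) *: (u *m v))).
  apply: (le_trans (ler_normD _ _)); rewrite normrZ (gtr0_norm (expR_gt0 _)).
  by rewrite [_ * `|u *m v|]mulrC [leRHS]mulrDl addrC lerD.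
have [k [l [[Gk Gl] _ xa xE [hk hl hk' hl' [kV lV]]]]] := decomp x Gx.
have ku0 : rU k *m u != 0.
  by apply: contraNneq u0 => e; rewrite -[u]mul1mx -kV -mulmxA e mulmx0.
have vl0 : v *m rU l != 0.
  by apply: contraNneq v0 => e; rewrite -[v]mulmx1 -lV mulmxA e mul0mx.
exists (`|rU k *m u|^-1 *: (rU k *m u)), (`|v *m rU l|^-1 *: (v *m rU l)).
split; [by rewrite normrZ normfV normr_id mulVf// normr_eq0
  |by rewrite normrZ normfV normr_id mulVf// normr_eq0|].
exists (expR (top_weight Q I (kappa x)) * `|rU k *m u| * `|v *m rU l|).
rewrite -scalemxAl -scalemxAr !scalerA.
have -> : expR (top_weight Q I (kappa x)) * `|rU k *m u| * `|v *m rU l| * `|rU k *m u|^-1 *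
    `|v *m rU l|^-1 = expR (top_weight Q I (kappa x)).
  by field; rewrite !normr_eq0 ku0 vl0.
have -> : rU x - expR (top_weight Q I (kappa x)) *: (rU k *m u *m (v *m rU l)) =
    rU k *m (rU (expmx (kappa x)) - expR (top_weight Q I (kappa x)) *: (u *m v)) *m rU l.
  by rewrite mulmxBr mulmxBl -xE -scalemxAr -scalemxAl !mulmxA.
apply: (le_trans (norm3 _ _ _ hk hl)).
have := hC0 (kappa x) t xa (gapped_lower_weight hgap); rewrite expRD => h.
apply: (@le_trans _ _ (A2 * (C0 * (A1 * `|rU x| * expR (- t))))).
  apply: ler_wpM2l => //; apply: (le_trans h); apply: ler_wpM2l => //.
  by apply: ler_wpM2r; [exact: expR_ge0|exact: low].
have -> : A2 * (C0 * (A1 * `|rU x| * expR (- t))) = A4 * expR (- t) * `|rU x|.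
  by rewrite /A4; ring.
apply: ler_wpM2r => //; apply: ler_wpM2r; [exact: expR_ge0|lra].
Qed.


Lemma ln_quotient (A x y : R) : 0 < A -> expR x <= A * expR y -> x - y <= ln A.
Proof.
move=> A0; rewrite -{1}[A]lnK ?posrE// -expRD ler_expR => h.
by rewrite lerBlDr.
Qed.

Lemma top_weight_linear I s x y :
  top_weight Q I (s *: x + y) = s * top_weight Q I x + top_weight Q I y.
Proof.
rewrite /top_weight mulr_sumr -big_split/=; apply: eq_bigr => j _.
by rewrite lamD lamZ.
Qed.

Lemma top_weightB I x y : top_weight Q I (x - y) = top_weight Q I x - top_weight Q I y.
Proof. by rewrite addrC -scaleN1r top_weight_linear; ring. Qed.

Lemma word_in (h : nat -> M) p q : (forall i, G (h i)) -> (p <= q)%N -> G (word h p q).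
Proof.
have [_ G1 GM _ _] := cG => hG; elim: q => [|q IH]; first by rewrite leqn0 => /eqP ->; rewrite word_nil.
rewrite leq_eqVlt => /predU1P[->|]; first by rewrite word_nil.
by rewrite ltnS => pq; rewrite word_rcons//; apply: GM => //; exact: IH.
Qed.

Lemma top_weight_perturb I b : upclosed I -> exists M0 : R, forall x c, G x -> G c ->
  `|c| <= b -> `|invmx c| <= b ->
  `|top_weight Q I (kappa (x *m c) - kappa x)| <= M0.
Proof.
move=> Iup; have [r [rU [C [[rM r1] rb C1 hC _]]]] := norm_highest_weight Iup.
have [Cb Cb0 hCb] := rb b.
have [Gu _ GM GV _] := cG.
have C0 : 0 <= C by exact: le_trans C1.
pose A := C ^+ 2 * (r.+1%:R * Cb) + 1.
have A0 : 0 < A by rewrite ltr_wpDl// mulr_ge0 ?exprn_ge0// mulr_ge0.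
have half x c : G x -> G c -> `|c| <= b ->
    top_weight Q I (kappa (x *m c)) - top_weight Q I (kappa x) <= ln A.
  move=> Gx Gc cb; apply: ln_quotient => //.
  have [h1 _] := hC (x *m c) (GM _ _ Gx Gc); have [_ h2] := hC x Gx.
  apply: (le_trans h1); rewrite rM//.
  apply: (@le_trans _ _ (C * (r.+1%:R * (C * expR (top_weight Q I (kappa x))) * Cb))).
    apply: ler_wpM2l => //; apply: (le_trans (norm_mulmx_le _ _)).
    apply: ler_pM => //; last exact: hCb.
    by apply: ler_wpM2l.
  have e0 := expR_ge0 (top_weight Q I (kappa x)).
  rewrite /A mulrDl mul1r -[leLHS]addr0; apply: lerD => //.
  by rewrite le_eqVlt; apply/orP; left; apply/eqP; ring.
exists (ln A) => x c Gx Gc cb cb'; rewrite top_weightB ler_norml half// andbT.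
rewrite lerNl opprB.
have := half (x *m c) (invmx c) (GM _ _ Gx Gc) (GV _ Gc) cb'.
by rewrite -mulmxA mulmxV ?mulmx1//; exact: Gu.
Qed.

(** Near multiplicativity of the norm in the representation attached to [I];
    the depth of the subwords provides their distance to rank one. *)
Lemma top_weight_near_additive I b c C1 : upclosed I -> 0 < c ->
  exists M0 : R, forall h N, (forall i, G (h i)) -> (forall i, `|h i| <= b) ->
    (forall i, `|invmx (h i)| <= b) ->
    (forall p q, (p <= q <= N)%N -> gapped (kappa (word h p q)) (c * (q - p)%:R - C1)) ->
    forall m, (m <= N)%N ->
      `|top_weight Q I (kappa (word h 0 N) - (kappa (word h 0 m) + kappa (word h m N)))| <= M0.
Proof.
move=> Iup c0; have [r [rU [C [[rM r1] rb C_ge1 hC hgap]]]] := norm_highest_weight Iup.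
have [Cb Cb0 hCb] := rb b.
have [Gu _ GM GV _] := cG.
have C0 : 0 <= C by exact: le_trans C_ge1.
pose C' := C * expR `|C1|.
have C'1 : 1 <= C'.
  rewrite /C' -[1]mulr1; apply: ler_pM => //.
  by rewrite -expR0 ler_expR.
pose tau := expR (- c).
have tau0 : 0 < tau by exact: expR_gt0.
have tau1 : tau < 1 by rewrite /tau -expR0 ltr_expR oppr_lt0.
have b1 : 1 <= 1 + Cb by rewrite lerDl.
have [M0 M00 hM] := near_multiplicativity r b1 C'1 tau0 tau1.
pose A := C ^+ 3 * (M0 + r.+1%:R).
have A0 : 0 < A by rewrite mulr_gt0// ?exprn_gt0 ?(lt_le_trans _ C_ge1)// addr_gt0.
exists (ln A) => h N hG hb hb' gaps m mN.
pose k := rU \o h.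
have rV x : G x -> rU x *m rU (invmx x) = 1%:M.
  by move=> Gx; rewrite -rM ?mulmxV//; [exact: Gu|exact: GV].
have ku i : k i \in unitmx.
  by have [] := mulmx1_unit (rV _ (hG i)).
have kV i : invmx (k i) = rU (invmx (h i)).
  have e : k i *m rU (invmx (h i)) = 1%:M by exact: rV.
  by rewrite -[invmx _]mulmx1 -e mulKmx.
have wE p q : (p <= q)%N -> word k p q = rU (word h p q).
  elim: q => [|q IH]; first by rewrite leqn0 => /eqP ->; rewrite !word_nil.
  rewrite leq_eqVlt => /predU1P[->|]; first by rewrite !word_nil.
  rewrite ltnS => pq; rewrite !word_rcons// rM ?IH//; exact: word_in.
have gaps' p q : (p <= q <= N)%N ->
    exists u v, near_rank1 (C' * tau ^+ (q - p)) (word k p q) u v.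
  move=> /[dup] pqN /andP[pq _]; rewrite wE//.
  have -> : C' * tau ^+ (q - p) = C * expR (- (c * (q - p)%:R - `|C1|)).
    rewrite /C' /tau -mulrA; congr (_ * _).
    by rewrite -expRM_natl -expRD; congr expR; ring.
  apply: hgap; first exact: word_in.
  by apply: gapped_le (gaps _ _ pqN); rewrite lerD2l lerN2 ler_norm.
have hk i : `|k i| <= 1 + Cb by apply: (le_trans (hCb _ (hb i))); rewrite lerDr.
have hk' i : `|invmx (k i)| <= 1 + Cb.
  by rewrite kV; apply: (le_trans (hCb _ (hb' i))); rewrite lerDr.
have := hM k N ku hk hk' gaps' m mN; rewrite !wE//.
have [l0 u0] := hC _ (word_in hG (leq0n N)).
have [l1 u1] := hC _ (word_in hG (leq0n m)).
have [l2 u2] := hC _ (word_in hG mN).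
have eN : word h 0 N = word h 0 m *m word h m N by rewrite -word_cat.
have lo : `|rU (word h 0 N)| <= r.+1%:R * `|rU (word h 0 m)| * `|rU (word h m N)|.
  by rewrite eN rM ?norm_mulmx_le//; exact: word_in.
move=> up; rewrite top_weightB.
have -> : top_weight Q I (kappa (word h 0 m) + kappa (word h m N)) =
    top_weight Q I (kappa (word h 0 m)) + top_weight Q I (kappa (word h m N)).
  by rewrite -[kappa (word h 0 m)]scale1r top_weight_linear mul1r scale1r.
move: (top_weight Q I _) l0 u0 (top_weight Q I _) l1 u1 (top_weight Q I _) l2 u2 up lo.
move: (normr_ge0 (rU (word h 0 N))) (normr_ge0 (rU (word h 0 m))) (normr_ge0 (rU (word h m N))).
move: `|rU (word h 0 N)| `|rU (word h 0 m)| `|rU (word h m N)| => n0 n1 n2 n00 n10 n20.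
move=> T0 l0 u0 T1 l1 u1 T2 l2 u2 up lo.
have e0 := expR_ge0 T0; have e1 := expR_ge0 T1; have e2 := expR_ge0 T2.
have r0 : 0 <= r.+1%:R :> R by [].
rewrite ler_norml lerNl opprB; apply/andP; split; apply: ln_quotient => //.
  rewrite expRD; apply: (@le_trans _ _ (C * n1 * (C * n2))); first exact: ler_pM.
  apply: (@le_trans _ _ (C ^+ 2 * (M0 * (C * expR T0)))).
    have -> : C * n1 * (C * n2) = C ^+ 2 * (n1 * n2) by ring.
    apply: ler_wpM2l; first exact: exprn_ge0.
    by apply: (le_trans up); apply: ler_wpM2l => //; exact: ltW.
  have -> : C ^+ 2 * (M0 * (C * expR T0)) = C ^+ 3 * M0 * expR T0 by ring.
  apply: ler_wpM2r => //; rewrite /A; apply: ler_wpM2l; first exact: exprn_ge0.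
  by rewrite lerDl.
apply: (le_trans l0); rewrite expRD.
apply: (@le_trans _ _ (C * (r.+1%:R * (C * expR T1) * (C * expR T2)))).
  apply: ler_wpM2l => //; apply: (le_trans lo); apply: ler_pM => //.
    exact: mulr_ge0.
  exact: ler_wpM2l.
have -> : C * (r.+1%:R * (C * expR T1) * (C * expR T2)) =
    C ^+ 3 * r.+1%:R * (expR T1 * expR T2) by ring.
apply: ler_wpM2r; first exact: mulr_ge0.
by rewrite /A; apply: ler_wpM2l; [exact: exprn_ge0|rewrite lerDr ltW].
Qed.

(** Each weight is a difference of highest weights, up to a multiple: adding to
    the strictly larger weights those equal to it again gives an up-closed
    set. *)
Lemma lam_top_weights i : exists I1 I2, [/\ upclosed I1, upclosed I2 &
  exists2 m, (0 < m)%N & forall x, x \in a ->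
    top_weight Q I1 x - top_weight Q I2 x = m%:R * lam Q i x].
Proof.
have [za _] := z0P.
pose E := [set j | `[< forall x, x \in a -> lam Q j x = lam Q i x >]]%SET.
pose I2 := [set j | lam Q i z0 < lam Q j z0]%SET.
have I2up : upclosed I2.
  by move=> j j' X; rewrite !inE => ij _ _; exact: lt_le_trans.
have I1up : upclosed (E :|: I2)%SET.
  move=> j j' X; rewrite finset.in_setU => /orP[jE|jI2] Xg Xjj' le; last first.
    by rewrite finset.in_setU (I2up j j' X)// orbT.
  move: jE; rewrite inE => /asboolP eq; rewrite finset.in_setU.
  have [e|e|e] := weight_sign cG hg Qu ag aQ hP Xg Xjj'.
  - by rewrite inE; apply/orP; left; apply/asboolP => x xa; rewrite -e// eq.
  - by have := lt_le_trans (e _ z0P) le; rewrite ltxx.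
  - by rewrite [X in _ || X]inE -eq// e// orbT.
exists (E :|: I2)%SET, I2; split => //; exists #|E|.
  by apply/card_gt0P; exists i; rewrite inE; apply/asboolP.
move=> x xa; rewrite /top_weight (eq_bigl [predU E & I2]) => [|j]; last by rewrite finset.in_setU.
rewrite bigU/=; last first.
  rewrite -finset.setI_eq0; apply/eqP/finset.setP => j; rewrite !inE.
  by case: asboolP => //= e; rewrite e// ltxx.
rewrite addrK (eq_bigr (fun=> lam Q i x)) => [|j]; last by rewrite inE => /asboolP ->.
by rewrite sumr_const mulr_natl.
Qed.

(** The weights separate the points of [a], which is diagonal in the chosen
    basis. *)
Lemma norm_top_weights : exists2 c : R, 0 <= c & forall x M0, x \in a ->
  (forall I, upclosed I -> `|top_weight Q I x| <= M0) -> `|x| <= c * M0.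
Proof.
exists (n.+1%:R * (n.+1%:R * `|invmx Q| * 2) * `|Q|) => [|x M0 xa h]; first by rewrite !mulr_ge0.
have lamM i : `|lam Q i x| <= 2 * M0.
  have [I1 [I2 [up1 up2 [m m0 hm]]]] := lam_top_weights i.
  apply: (@le_trans _ _ `|m%:R * lam Q i x|).
    by rewrite normrM normr_nat ler_peMl// ler1n.
  rewrite -hm//; apply: (le_trans (ler_normB _ _)).
  by have := h _ up1; have := h _ up2; lra.
have M00 : 0 <= M0 by have := le_trans (normr_ge0 _) (lamM ord0); lra.
have -> : x = invmx Q *m coo Q x *m Q.
  by rewrite /coo !mulmxA mulVmx// mul1mx mulmxKV.
apply: (le_trans (norm_mulmx_le _ _)); rewrite [leRHS]mulrAC; apply: ler_wpM2r => //.
rewrite -[leRHS]mulrA; apply: ler_wpM2l => //.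
apply: (le_trans (norm_mulmx_le _ _)); rewrite -[leRHS]mulrA; apply: ler_wpM2l; first exact: mulr_ge0.
apply: mx_norm_le => [|i j]; first by rewrite mulr_ge0.
rewrite (coo_diag aQ)// mxE [(\row__ _) _ _]mxE; case: eqP => _; rewrite ?mulr1n//.
by rewrite mulr0n normr0 mulr_ge0.
Qed.

Lemma fin_uniform (T : finType) (p : T -> R -> Prop) :
  (forall i s t, s <= t -> p i s -> p i t) -> (forall i, exists s, p i s) ->
  exists2 s : R, 0 <= s & forall i, p i s.
Proof.
move=> mono /choice[f hf]; exists (\sum_i `|f i|) => [|i]; first exact: sumr_ge0.
apply: mono (hf i); rewrite (le_trans (ler_norm _))//.
by rewrite (bigD1 i)//= lerDl sumr_ge0.
Qed.

Lemma kappa_in x : G x -> kappa x \in a.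
Proof. by move=> /kappaP[[]]. Qed.

(** Multiplication by a bounded element changes the norm in each
    representation by a bounded factor. *)
Theorem kappa_perturb b : exists2 M0 : R, 0 <= M0 & forall x c, G x -> G c ->
  `|c| <= b -> `|invmx c| <= b -> `|kappa (x *m c) - kappa x| <= M0.
Proof.
have [c0 c00 hc0] := norm_top_weights; have [_ _ GM _ _] := cG.
have [|I|M0 M00 hM] := @fin_uniform {set 'I_n.+1} (fun I M0 => upclosed I ->
   forall x c, G x -> G c -> `|c| <= b -> `|invmx c| <= b ->
   `|top_weight Q I (kappa (x *m c) - kappa x)| <= M0).
- by move=> I s t st h Iup x c Gx Gc cb cb'; apply: le_trans st; exact: h.
- have [Iup|] := pselect (upclosed I); last by exists 0.
  by have [M0 hM] := top_weight_perturb b Iup; exists M0.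
exists (c0 * M0) => [|x c Gx Gc cb cb']; first exact: mulr_ge0.
apply: hc0 => [|I Iup]; last exact: hM.
by apply: memvB; apply: kappa_in => //; exact: GM.
Qed.

(** Combines [top_weight_near_additive] over all the representations, which
    together determine the Cartan projection. *)
Theorem kappa_near_additive b c C1 : 0 < c ->
  exists2 M0 : R, 0 <= M0 & forall h N, (forall i, G (h i)) -> (forall i, `|h i| <= b) ->
    (forall i, `|invmx (h i)| <= b) ->
    (forall p q, (p <= q <= N)%N -> gapped (kappa (word h p q)) (c * (q - p)%:R - C1)) ->
    forall m, (m <= N)%N ->
      `|kappa (word h 0 N) - (kappa (word h 0 m) + kappa (word h m N))| <= M0.
Proof.
move=> c_gt0; have [c0 c00 hc0] := norm_top_weights.
have [|I|M0 M00 hM] := @fin_uniform {set 'I_n.+1} (fun I M0 => upclosed I ->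
  forall h N, (forall i, G (h i)) -> (forall i, `|h i| <= b) ->
    (forall i, `|invmx (h i)| <= b) ->
    (forall p q, (p <= q <= N)%N -> gapped (kappa (word h p q)) (c * (q - p)%:R - C1)) ->
    forall m, (m <= N)%N ->
   `|top_weight Q I (kappa (word h 0 N) - (kappa (word h 0 m) + kappa (word h m N)))| <= M0).
- by move=> I s t st H Iup h N h1 h2 h3 h4 m mN; apply: le_trans st; exact: H.
- have [Iup|] := pselect (upclosed I); last by exists 0.
  by have [M0 hM] := top_weight_near_additive b C1 Iup c_gt0; exists M0.
exists (c0 * M0) => [|h N h1 h2 h3 h4 m mN]; first exact: mulr_ge0.
apply: hc0 => [|I Iup]; last exact: hM.
by apply: memvB; [|apply: memvD]; apply/kappa_in/word_in.
Qed.

End CartanProjection.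

(** * Words in the letters of nearby sets *)

Lemma full_range p q k : (0 < k)%N -> (q <= k)%N -> (k <= q - p)%N -> p = 0%N /\ q = k.
Proof. by move=> *; split; lia. Qed.

(** Stated for abstract [kappa] and [gapped], which stand for the Cartan
    projection and the depth in the chamber. *)
Section WordsOfNearbySets.
Variables (R : realType) (n : nat).
Local Notation M := 'M[R]_n.+1.
Local Notation K := (n.+1%:R : R).
Variables (G : set M) (kappa : M -> M) (gapped : M -> R -> Prop) (L : R).
Hypothesis cG : closed_subgroup_GL G.
Hypothesis L0 : 0 <= L.
Hypothesis gapped_le : forall x s t, s <= t -> gapped x t -> gapped x s.
Hypothesis gappedD : forall x y s t, gapped x s -> gapped y t -> gapped (x + y) (s + t).
Hypothesis gapped_near : forall x y t, gapped x t -> gapped y (t - L * `|y - x|).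
Hypothesis perturb : forall b, exists2 M0 : R, 0 <= M0 & forall x c, G x -> G c ->
  `|c| <= b -> `|invmx c| <= b -> `|kappa (x *m c) - kappa x| <= M0.
Hypothesis near_additive : forall b c C1, 0 < c ->
  exists2 M0 : R, 0 <= M0 & forall h N, (forall i, G (h i)) -> (forall i, `|h i| <= b) ->
    (forall i, `|invmx (h i)| <= b) ->
    (forall p q, (p <= q <= N)%N -> gapped (kappa (word h p q)) (c * (q - p)%:R - C1)) ->
    forall m, (m <= N)%N ->
      `|kappa (word h 0 N) - (kappa (word h 0 m) + kappa (word h m N))| <= M0.
Variables (S : set M) (b c0 C2 : R).
Hypotheses (SG : S `<=` G) (b0 : 0 <= b) (c00 : 0 < c0) (C20 : 0 <= C2).
Hypothesis Sb : forall s, S s -> `|s| <= b /\ `|invmx s| <= b.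
Hypothesis Sgap : forall h, (forall i, S (h i)) ->
  forall k, gapped (kappa (word h 0 k)) (c0 * k%:R - C2).

Local Notation bb := (2 * b + 1).

Lemma gapped_within x y t e : `|y - x| <= e -> gapped x t -> gapped y (t - L * e).
Proof.
move=> xy hx; apply: gapped_le (gapped_near y hx).
by rewrite lerD2l lerN2 ler_wpM2l.
Qed.

Lemma word_shift (h : nat -> M) p q : word h p q = word (fun i => h (i + p)%N) 0 (q - p).
Proof. by rewrite /word -{1}[p]add0n big_addn. Qed.

Lemma nearby_inverse : exists2 e : R, 0 < e & e <= 1 /\ forall s s' : M, s \in unitmx -> s' \in unitmx ->
  `|s| <= b -> `|invmx s| <= b -> `|s - s'| <= e -> `|s'| <= bb /\ `|invmx s'| <= bb.
Proof.
have hb := b0.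
pose e := (2 * K * K * b + 1)^-1.
have d0 : 0 < 2 * K * K * b + 1 by rewrite ltr_wpDl// !mulr_ge0.
have d1 : 1 <= 2 * K * K * b + 1 by rewrite lerDr !mulr_ge0.
exists e; first by rewrite invr_gt0.
split=> [|s s' su su' sb sb' ss']; first by rewrite /e invf_le1.
have e1 : e <= 1 by rewrite /e invf_le1.
split.
  have -> : s' = s - (s - s') by rewrite opprB addrC subrK.
  apply: (le_trans (ler_normB _ _)); apply: (le_trans (lerD sb (le_trans ss' e1))); lra.
have eK : K * K * b * e <= 2^-1.
  rewrite /e ler_pdivrMr//.
  have -> : 2^-1 * (2 * K * K * b + 1) = K * K * b + 2^-1 by field.
  by rewrite lerDl invr_ge0.
have E : invmx s' = invmx s + invmx s *m (s - s') *m invmx s'.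
  rewrite mulmxBr mulVmx// mulmxBl mul1mx -mulmxA mulmxV// mulmx1.
  by rewrite addrC subrK.
have h : `|invmx s'| <= b + 2^-1 * `|invmx s'|.
  rewrite {1}E; apply: (le_trans (ler_normD _ _)); apply: lerD => //.
  apply: (le_trans (norm_mulmx_le _ _)); apply: ler_wpM2r => //.
  apply: (@le_trans _ _ (K * (K * b * e))); last by rewrite !mulrA.
  apply: ler_wpM2l => //; apply: (le_trans (norm_mulmx_le _ _)).
  by apply: ler_pM => //; exact: ler_wpM2l.
have := normr_ge0 (invmx s'); lra.
Qed.

Lemma word_bounds k : exists2 B : R, 0 <= B & forall (h h' : nat -> M) (e : R),
  (forall i, G (h i)) -> (forall i, G (h' i)) ->
  (forall i, `|h i| <= bb) -> (forall i, `|invmx (h i)| <= bb) ->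
  (forall i, `|h' i| <= bb) -> (forall i, `|invmx (h' i)| <= bb) ->
  (forall i, `|h i - h' i| <= e) ->
  [/\ `|invmx (word h 0 k)| <= B, `|invmx (word h' 0 k)| <= B,
      `|word h 0 k| <= B & `|word h 0 k - word h' 0 k| <= B * e].
Proof.
have [Gu _ _ _ _] := cG.
have bb0 : 0 <= bb by rewrite addr_ge0// mulr_ge0.
elim: k => [|k [B B0 IH]].
  exists 1 => // h h' e _ _ _ _ _ _ hh'; rewrite !word_nil.
  have -> : invmx (1 : M) = 1 by exact: invmx1.
  rewrite subrr normr0 mul1r norm_mx1; split => //.
  exact: le_trans (normr_ge0 _) (hh' 0%N).
exists (K * bb * B + K * B) => [|h h' e hG hG' hb hbi hb' hbi' hh'].
  by rewrite addr_ge0// !mulr_ge0.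
have [h1 h2 h3 h4] := IH h h' e hG hG' hb hbi hb' hbi' hh'.
have e0 : 0 <= e by exact: le_trans (normr_ge0 _) (hh' 0%N).
have iM (x y : M) : x \in unitmx -> y \in unitmx -> invmx (x *m y) = invmx y *m invmx x.
  by move=> xu yu; exact: (@invrM _ x y).
have bnd (x y : M) : `|x| <= bb -> `|y| <= B -> `|x *m y| <= K * bb * B.
  move=> hx hy; apply: (le_trans (norm_mulmx_le _ _)); apply: ler_pM => //.
  by apply: ler_wpM2l.
have bnd' (x y : M) : `|x| <= bb -> `|y| <= B -> `|y *m x| <= K * bb * B.
  move=> hx hy; apply: (le_trans (norm_mulmx_le _ _)); rewrite mulrAC.
  by apply: ler_pM => //; apply: ler_wpM2l.
have wu (f : nat -> M) : (forall i, G (f i)) -> word f 0 k \in unitmx.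
  by move=> fG; apply/Gu/(word_in cG).
have KB : 0 <= K * B by rewrite mulr_ge0.
rewrite !word_rcons// !iM ?wu//; try by [apply: Gu|apply/Gu].
split.
- by apply: (le_trans (bnd _ _ (hbi k) h1)); rewrite lerDl.
- by apply: (le_trans (bnd _ _ (hbi' k) h2)); rewrite lerDl.
- by apply: (le_trans (bnd' _ _ (hb k) h3)); rewrite lerDl.
have -> : word h 0 k *m h k - word h' 0 k *m h' k =
    (word h 0 k - word h' 0 k) *m h' k + word h 0 k *m (h k - h' k).
  by rewrite mulmxBl mulmxBr [RHS]addrC addrA subrK.
apply: (le_trans (ler_normD _ _)); rewrite mulrDl; apply: lerD.
  apply: (le_trans (norm_mulmx_le _ _)).
  have -> : K * bb * B * e = K * (B * e) * bb by ring.
  by apply: ler_pM => //; apply: ler_wpM2l.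
apply: (le_trans (norm_mulmx_le _ _)); apply: ler_pM => //.
by apply: ler_wpM2l.
Qed.

(** Words of bounded length in nearby letters differ by a bounded factor. *)
Lemma nearby_words : exists2 M0 : R, 0 <= M0 & forall n1 : nat, exists2 e : R, 0 < e &
  forall h h', (forall i, S (h i)) -> (forall i, G (h' i)) ->
    (forall i, `|h i - h' i| <= e) -> forall k, (k <= n1)%N ->
    `|kappa (word h' 0 k) - kappa (word h 0 k)| <= M0.
Proof.
have hb := b0; have [Gu _ GM GV _] := cG.
have [M0 M00 hM] := perturb 2; exists M0 => // n1.
have [e1 e10 [_ he1]] := nearby_inverse.
have one k : exists2 e : R, 0 < e & forall h h', (forall i, S (h i)) -> (forall i, G (h' i)) ->
    (forall i, `|h i - h' i| <= e) -> `|kappa (word h' 0 k) - kappa (word h 0 k)| <= M0.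
  have [B B0 hB] := word_bounds k.
  have d0 : 0 < K * B * B + 1 by rewrite ltr_wpDl// !mulr_ge0.
  exists (Num.min e1 (K * B * B + 1)^-1).
    by rewrite lt_min e10 invr_gt0.
  move=> h h' hS hG' hh'.
  have hG i : G (h i) by exact: SG.
  have hbb i : `|h' i| <= bb /\ `|invmx (h' i)| <= bb.
    have [s1 s2] := Sb (hS i).
    apply: (he1 (h i)) => //; [exact: Gu|exact: Gu|].
    by apply: (le_trans (hh' i)); rewrite ge_min lexx.
  have hb' i : `|h i| <= bb /\ `|invmx (h i)| <= bb.
    by have [s1 s2] := Sb (hS i); split; [apply: (le_trans s1)|apply: (le_trans s2)]; lra.
  have [a1 a2 _ a4] := hB h h' _ hG hG' (fun i => (hb' i).1) (fun i => (hb' i).2)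
    (fun i => (hbb i).1) (fun i => (hbb i).2) hh'.
  have Gw := word_in cG hG (leq0n k); have Gw' := word_in cG hG' (leq0n k).
  move: (word h 0 k) (word h' 0 k) a1 a2 a4 Gw Gw' => w w' a1 a2 a4 Gw Gw'.
  have wu : w \in unitmx by exact: Gu.
  have wu' : w' \in unitmx by exact: Gu.
  have close : `|w - w'| <= B * (K * B * B + 1)^-1.
    by apply: (le_trans a4); apply: ler_wpM2l => //; rewrite ge_min lexx orbT.
  have fin (x : M) : `|x| <= B -> K * `|x| * `|w - w'| <= 1.
    move=> xB; apply: (@le_trans _ _ (K * B * (B * (K * B * B + 1)^-1))).
      by apply: ler_pM => //; apply: ler_wpM2l.
    by rewrite mulrA ler_pdivrMr// mul1r lerDl.
  have c1 : `|invmx w *m w'| <= 2.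
    have -> : invmx w *m w' = 1 - invmx w *m (w - w').
      by rewrite mulmxBr mulVmx// opprB addrC subrK.
    apply: (le_trans (ler_normB _ _)); rewrite norm_mx1 [2]mulr2n lerD2l.
    by apply: (le_trans (norm_mulmx_le _ _)); exact: fin.
  have c2 : `|invmx w' *m w| <= 2.
    have -> : invmx w' *m w = 1 + invmx w' *m (w - w').
      by rewrite mulmxBr mulVmx// addrC subrK.
    apply: (le_trans (ler_normD _ _)); rewrite norm_mx1 [2]mulr2n lerD2l.
    by apply: (le_trans (norm_mulmx_le _ _)); exact: fin.
  have -> : w' = w *m (invmx w *m w') by rewrite mulmxA mulmxV// mul1mx.
  apply: hM => //; first by apply: GM => //; exact: GV.
  suff -> : invmx (invmx w *m w') = invmx w' *m w by [].
  by rewrite -[in RHS](invmxK w); apply: (@invrM _ (invmx w) w') => //; rewrite ?unitmx_inv.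
elim: n1 => [|n1 [e e0 IH]].
  have [e e0 he] := one 0%N; exists e => // h h' h1 h2 h3 k.
  by rewrite leqn0 => /eqP ->; exact: he.
have [e' e'0 he'] := one n1.+1; exists (Num.min e e'); first by rewrite lt_min e0.
move=> h h' h1 h2 h3 k; rewrite leq_eqVlt => /predU1P[->|]; last rewrite ltnS => kn.
  by apply: he' => // i; apply: (le_trans (h3 i)); rewrite ge_min lexx orbT.
by apply: IH => // i; apply: (le_trans (h3 i)); rewrite ge_min lexx.
Qed.

(** Domination persists, with uniform constants, for all sets close to [S]:
    blocks of a fixed length are controlled by comparison with [S], and the
    near additivity of [kappa] propagates the control to all lengths. *)
Theorem nearby_gap : exists c C1 e : R, [/\ 0 < c, 0 < e & forall h' : nat -> M,
  (forall i, G (h' i)) -> (forall i, exists2 s, S s & `|s - h' i| <= e) ->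
  (forall i, `|h' i| <= bb /\ `|invmx (h' i)| <= bb) /\
  forall k, gapped (kappa (word h' 0 k)) (c * k%:R - C1)].
Proof.
have hc0 := c00; have hC2 := C20; have [Gu _ GM GV _] := cG.
have [Mp Mp0 hMp] := nearby_words.
(* [C3] allows for the loss incurred by adding one letter, before near additivity
   applies. *)
have [Mb Mb0 hMb] := perturb bb.
pose C2' := C2 + L * Mp; pose c := c0 / 2; pose C3 := C2' + L * Mb + c.
have c_gt0 : 0 < c by rewrite /c divr_gt0.
have LMp : 0 <= L * Mp by rewrite mulr_ge0.
have LMb : 0 <= L * Mb by rewrite mulr_ge0.
have [Ma Ma0 hMa] := near_additive bb C3 c_gt0.
have [n1 n1_gt0 hn1] : exists2 n1, (0 < n1)%N & C2' + L * Ma <= c * n1%:R.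
  exists (Num.truncn ((C2' + L * Ma) / c)).+1 => //.
  by rewrite [leRHS]mulrC -ler_pdivrMr//; apply: ltW; exact: truncnS_gt.
have [e e0 he] := hMp n1.
have [e1 e10 [_ he1]] := nearby_inverse.
exists c, C2', (Num.min e e1); split => //; first by rewrite lt_min e0.
have letters (h' : nat -> M) : (forall i, G (h' i)) ->
    (forall i, exists2 s, S s & `|s - h' i| <= Num.min e e1) ->
    forall i, `|h' i| <= bb /\ `|invmx (h' i)| <= bb.
  move=> hG' hS i; have [s Ss ss'] := hS i; have [s1 s2] := Sb Ss.
  apply: (he1 s) => //; [exact/Gu/SG|exact: Gu|].
  by apply: (le_trans ss'); rewrite ge_min lexx orbT.
have base h' : (forall i, G (h' i)) ->
    (forall i, exists2 s, S s & `|s - h' i| <= Num.min e e1) ->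
    forall k, (k <= n1)%N -> gapped (kappa (word h' 0 k)) (c0 * k%:R - C2').
  move=> hG' hS k kn.
  have [h hh] := choice (fun i => let: ex_intro2 s Ss ss := hS i in ex_intro _ s (conj Ss ss)).
  rewrite /C2' opprD addrA; apply: gapped_within (Sgap (fun i => (hh i).1) k).
  apply: he => // [i|i]; first exact: (hh i).1.
  by apply: (le_trans (hh i).2); rewrite ge_min lexx.
suff main k : forall h', (forall i, G (h' i)) ->
    (forall i, exists2 s, S s & `|s - h' i| <= Num.min e e1) ->
    gapped (kappa (word h' 0 k)) (c * k%:R - C2').
  move=> h' hG' hS; split; first exact: letters.
  by move=> k; exact: main.
elim/ltn_ind: k => k IH h' hG' hS.
have [kn|nk] := leqP k n1.
  apply: gapped_le (base _ hG' hS k kn); rewrite lerD2r ler_wpM2r// /c; lra.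
(* Proper subwords are covered by induction, and the whole word by removing its
   last letter. *)
have gaps p q : (p <= q <= k)%N -> gapped (kappa (word h' p q)) (c * (q - p)%:R - C3).
  move=> /andP[pq qk].
  have [qpk|] := ltnP (q - p) k.
    rewrite word_shift; apply: gapped_le (IH _ qpk _ _ _) => [|i|i] //.
    by rewrite lerD2l lerN2 /C3; lra.
  move=> kqp; have [p0 qe] := full_range (leq_ltn_trans (leq0n _) nk) qk kqp.
  rewrite p0 qe subn0; case: k IH nk kqp qk qe => // k IH nk _ _ _.
  have := IH k (ltnSn k) h' hG' hS => /gapped_within.
  have [b1 b2] := letters h' hG' hS k.
  have wG := word_in cG hG' (leq0n k).
  have := hMb _ _ wG (hG' k) b1 b2; rewrite -word_rcons// => hw /(_ _ _ hw).
  apply: gapped_le; rewrite /C3 -[k.+1]addn1 natrD; lra.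
(* The first block of length [n1] is controlled by [S] with the better slope [c0],
   which pays for all the errors. *)
have n1k : (n1 <= k)%N by exact: ltnW.
have := hMa h' k hG' (fun i => (letters h' hG' hS i).1) (fun i => (letters h' hG' hS i).2) gaps n1 n1k.
move=> hw.
have g1 := base _ hG' hS n1 (leqnn n1).
have g2 : gapped (kappa (word h' n1 k)) (c * (k - n1)%:R - C2').
  rewrite word_shift; apply: IH => [|i|i] //.
  by rewrite ltn_subrL n1_gt0 (leq_ltn_trans _ nk).
apply: gapped_le (gapped_within hw (gappedD g1 g2)).
rewrite natrB//; have -> : c0 = 2 * c by rewrite /c; field.
move: hn1; lra.
Qed.

End WordsOfNearbySets.

(** * Averages of near-additive sequences of sets *)

Section HausdorffLimits.
Variables (R : realType) (n : nat).
Local Notation M := 'M[R]_n.+1.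

Lemma nbhs_norm_lt (x : M) (e : R) : 0 < e -> nbhs x [set y | `|x - y| < e].
Proof. by move=> e0; apply: (proj2 (@nbhs_normP R M x (fun y => `|x - y| < e))); exists e. Qed.

Lemma closure_norm (A : set M) x : closure A x -> forall e : R, 0 < e ->
  exists2 y, A y & `|x - y| < e.
Proof.
by move=> Ax e e0; have [y [Ay xy]] := Ax _ (nbhs_norm_lt x e0); exists y.
Qed.

Lemma hausdorff_dist_le (d : M -> M -> R) A B (e : R) :
  (forall x, A x -> exists2 y, B y & d x y <= e) ->
  (forall y, B y -> exists2 x, A x & d x y <= e) ->
  (hausdorff_dist d A B <= e%:E)%E.
Proof.
move=> hA hB; rewrite /hausdorff_dist ge_max; apply/andP; split; apply: ge_ereal_sup.
  move=> _ [x Ax <-]; have [y By xy] := hA x Ax.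
  by apply: ge_ereal_inf; exists (d x y)%:E; [exists y|rewrite lee_fin].
move=> _ [y By <-]; have [x Ax xy] := hB y By.
by apply: ge_ereal_inf; exists (d x y)%:E; [exists x|rewrite lee_fin].
Qed.

Lemma hausdorff_dist_lt (d : M -> M -> R) A B (e : R) :
  (hausdorff_dist d A B < e%:E)%E ->
  (forall x, A x -> exists2 y, B y & d x y < e) /\
  (forall y, B y -> exists2 x, A x & d x y < e).
Proof.
rewrite /hausdorff_dist gt_max => /andP[h1 h2]; split => [x Ax|y By].
  have : (ereal_inf [set (d x y)%:E | y in B] < e%:E)%E.
    by apply: le_lt_trans h1; apply: ereal_sup_ubound; exists x.
  by move=> /ereal_inf_lt[_ [y By <-]]; rewrite lte_fin => xy; exists y.
have : (ereal_inf [set (d x y)%:E | x in A] < e%:E)%E.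
  by apply: le_lt_trans h2; apply: ereal_sup_ubound; exists y.
by move=> /ereal_inf_lt[_ [x Ax <-]]; rewrite lte_fin => xy; exists x.
Qed.

Lemma hausdorff_dist_ge0 (d : M -> M -> R) A B : A !=set0 ->
  (forall x y, A x -> B y -> 0 <= d x y) -> (0 <= hausdorff_dist d A B)%E.
Proof.
move=> [x Ax] d0; rewrite /hausdorff_dist le_max; apply/orP; left.
apply: le_ereal_sup_tmp; exists (ereal_inf [set (d x y)%:E | y in B]); first by exists x.
by apply: le_ereal_inf_tmp => _ [y By <-]; rewrite lee_fin d0.
Qed.

Lemma hausdorff_dist_cvg0 (d : M -> M -> R) (A : nat -> set M) B :
  (forall k, A k !=set0) -> (forall k x y, A k x -> B y -> 0 <= d x y) ->
  (forall e : R, 0 < e -> \forall k \near \oo,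
     (forall x, A k x -> exists2 y, B y & d x y <= e) /\
     (forall y, B y -> exists2 x, A k x & d x y <= e)) ->
  hausdorff_dist d (A k) B @[k --> \oo] --> (0 : \bar R)%E.
Proof.
move=> A0 d0 h.
have ge0 k : (0 <= hausdorff_dist d (A k) B)%E by exact: hausdorff_dist_ge0 (d0 k).
have near_le e : 0 < e -> \forall k \near \oo, (hausdorff_dist d (A k) B <= e%:E)%E.
  by move=> /h; apply: filterS => k [h1 h2]; exact: hausdorff_dist_le.
apply/fine_cvgP; split.
  have := near_le 1 ltr01; apply: filterS => k hk.
  by rewrite ge0_fin_numE// (le_lt_trans hk)// ltry.
apply/cvgr0Pnorm_le => e /near_le; apply: filterS => k hk /=.
have fk : hausdorff_dist d (A k) B \is a fin_num.
  by rewrite ge0_fin_numE// (le_lt_trans hk)// ltry.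
by rewrite ger0_norm ?fine_ge0// -lee_fin fineK.
Qed.

End HausdorffLimits.

Section NearAdditiveSets.
Variables (R : realType) (n : nat).
Local Notation M := 'M[R]_n.+1.
Variables (X : nat -> set M) (B M0 : R).
Hypotheses (B0 : 0 <= B) (M00 : 0 <= M0).
Hypothesis Xne : forall k, X k !=set0.
Hypothesis Xb : forall k x, X k x -> `|x| <= B * k.+1%:R.
Hypothesis Xadd : forall p q x y, X p x -> X q y ->
  exists2 z, X (p + q)%N z & `|z - (x + y)| <= M0.

Lemma near_multiple p x q : X p x -> exists2 z, X (q.+1 * p)%N z & `|z - q.+1%:R *: x| <= q%:R * M0.
Proof.
move=> Xx; elim: q => [|q [z Xz hz]].
  by exists x; rewrite ?mul1n// scale1r subrr normr0 mul0r.
have [z' Xz' hz'] := Xadd Xx Xz; exists z'; first by rewrite mulSn.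
have -> : z' - q.+2%:R *: x = (z' - (x + z)) + (z - q.+1%:R *: x).
  by rewrite opprD !addrA subrK -[q.+2]add1n natrD scalerDl scale1r opprD addrA.
apply: (le_trans (ler_normD _ _)).
by rewrite [leRHS](_ : _ = M0 + q%:R * M0); [exact: lerD|rewrite -natr1; ring].
Qed.

(** Repeating a word realizes its average in all large lengths. *)
Lemma average_persists p x e : (0 < p)%N -> X p x -> 0 < e -> exists N0, forall N, (N0 <= N)%N ->
  exists2 z, X N z & `|N%:R^-1 *: z - p%:R^-1 *: x| <= M0 / p%:R + e.
Proof.
move=> p0 Xx e0; have hB := B0; have hM := M00.
pose D := M0 + 2 * (B * p.+1%:R).
have D0 : 0 <= D by rewrite addr_ge0// !mulr_ge0.
pose N1 := (Num.truncn (D / e)).+1.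
have hN1 : D / e < N1%:R by exact: truncnS_gt.
exists (maxn p N1) => N; rewrite geq_max => /andP[pN N1N].
have N_gt0 : (0 < N)%N by exact: leq_trans pN.
have NR : 0 < N%:R :> R by rewrite ltr0n.
have pR : 0 < p%:R :> R by rewrite ltr0n.
have DN : D <= e * N%:R.
  rewrite mulrC -ler_pdivrMr// ltW// (lt_le_trans hN1)// ler_nat//.
have q0 : (0 < N %/ p)%N by rewrite divn_gt0.
have Np : N = ((N %/ p).-1.+1 * p + N %% p)%N by rewrite prednK// -divn_eq.
have rp : (N %% p < p)%N by rewrite ltn_mod.
set q := (N %/ p).-1 in Np; set r := (N %% p)%N in Np rp.
have [y Xy] := Xne r.
have [z1 Xz1 hz1] := near_multiple q Xx.
have [z Xz hz] := Xadd Xz1 Xy; rewrite -Np in Xz.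
exists z => //.
have key : `|z - (N%:R / p%:R) *: x| <= q.+1%:R * M0 + 2 * (B * p.+1%:R).
  have -> : z - (N%:R / p%:R) *: x =
      (z - (z1 + y)) + (z1 - q.+1%:R *: x) + (y - (r%:R / p%:R) *: x).
    have -> : N%:R / p%:R = q.+1%:R + r%:R / p%:R :> R.
      by rewrite {1}Np natrD natrM mulrDl mulfK ?gt_eqF.
    rewrite scalerDl; move: (q.+1%:R *: x) ((r%:R / p%:R) *: x) => u v.
    by apply/matrixP => i j; rewrite !mxE; ring.
  apply: (le_trans (ler_normD _ _)); apply: lerD.
    apply: (le_trans (ler_normD _ _)).
    rewrite [leRHS](_ : _ = M0 + q%:R * M0); last by rewrite -natr1; ring.
    exact: lerD.
  apply: (le_trans (ler_normB _ _)); rewrite [2]mulr2n mulrDl mul1r; apply: lerD.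
    by apply: (le_trans (Xb Xy)); apply: ler_wpM2l => //; rewrite ler_nat ltnS ltnW.
  rewrite normrZ; apply: le_trans (Xb Xx); rewrite ler_piMl//.
  by rewrite ger0_norm ?divr_ge0// ler_pdivrMr// mul1r ler_nat ltnW.
have -> : N%:R^-1 *: z - p%:R^-1 *: x = N%:R^-1 *: (z - (N%:R / p%:R) *: x).
  by rewrite scalerBr scalerA mulrA mulVf ?gt_eqF// mul1r.
rewrite normrZ gtr0_norm ?invr_gt0// mulrC ler_pdivrMr//.
apply: (le_trans key).
have -> : (M0 / p%:R + e) * N%:R = M0 * (N%:R / p%:R) + e * N%:R by ring.
have qN : q%:R <= N%:R / p%:R :> R.
  rewrite ler_pdivlMr// -natrM ler_nat [X in (_ <= X)%N]Np.
  by rewrite (leq_trans _ (leq_addr _ _))// leq_mul2r leqnSn orbT.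
apply: (@le_trans _ _ (M0 * q%:R + D)).
  by rewrite /D -[q.+1%:R]natr1; lra.
by apply: lerD => //; exact: ler_wpM2l.
Qed.

(** Limits of averages along all large lengths. By [average_persists] these are
    also the limits of averages along infinitely many lengths, which is why the
    averages converge. *)
Definition average_limits : set M := [set x | forall e : R, 0 < e ->
  exists N0, forall N, (N0 <= N)%N -> exists2 z, X N z & `|N%:R^-1 *: z - x| <= e].

Lemma frequent_average_limit x :
  (forall (e : R) N0, 0 < e -> exists N, (N0 <= N)%N /\ exists2 z, X N z & `|N%:R^-1 *: z - x| <= e) ->
  average_limits x.
Proof.
move=> h e e0; have hM := M00.
have e3 : 0 < e / 3 by rewrite divr_gt0.
pose N1 := (Num.truncn (M0 / (e / 3))).+1.
have hN1 : M0 / (e / 3) < N1%:R by exact: truncnS_gt.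
have [p [pN1 [y Xy hy]]] := h _ N1 e3.
have p0 : (0 < p)%N by exact: leq_trans pN1.
have Mp : M0 / p%:R <= e / 3.
  rewrite ler_pdivrMr ?ltr0n// mulrC -ler_pdivrMr//.
  by rewrite (le_trans (ltW hN1))// ler_nat.
have [N0 hN0] := average_persists p0 Xy e3; exists N0 => N /hN0[z Xz hz].
exists z => //.
have -> : N%:R^-1 *: z - x = (N%:R^-1 *: z - p%:R^-1 *: y) + (p%:R^-1 *: y - x).
  by rewrite addrA subrK.
by apply: (le_trans (ler_normD _ _)); apply: (le_trans (lerD hz hy)); lra.
Qed.

Lemma average_bound k x : (0 < k)%N -> X k x -> `|k%:R^-1 *: x| <= 2 * B.
Proof.
move=> k0 /Xb h; rewrite normrZ gtr0_norm ?invr_gt0 ?ltr0n// mulrC.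
rewrite ler_pdivrMr ?ltr0n//; apply: (le_trans h).
rewrite [2 * _]mulrC -mulrA; apply: ler_wpM2l => //.
by rewrite -natrM ler_nat mul2n -addnn -addn1 leq_add2l.
Qed.

Lemma average_limits_compact : compact average_limits.
Proof.
have hB := B0; apply: closed_bounded_compact_mx.
  exists (2 * B + 1); split => [|t ht x Jx]; first exact: num_real.
  apply: (le_trans _ (ltW ht)).
  have [N0 hN0] := Jx 1 ltr01.
  have [z Xz hz] := hN0 N0.+1 (leqnSn _).
  have -> : x = N0.+1%:R^-1 *: z - (N0.+1%:R^-1 *: z - x) by rewrite opprB addrC subrK.
  by apply: (le_trans (ler_normB _ _)); apply: lerD => //; exact: average_bound.
move=> x /closure_norm cx e e0.
have e2 : 0 < e / 2 by rewrite divr_gt0.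
have [y Jy xy] := cx _ e2; have [N0 hN0] := Jy _ e2.
exists N0 => N /hN0[z Xz hz]; exists z => //.
have -> : N%:R^-1 *: z - x = (N%:R^-1 *: z - y) + (y - x) by rewrite addrA subrK.
apply: (le_trans (ler_normD _ _)); rewrite [`|y - x|]distrC.
apply: (le_trans (lerD hz (ltW xy))); lra.
Qed.

(** Otherwise the averages would accumulate, by compactness, at a point outside
    the limit set, against [frequent_average_limit]. *)
Lemma averages_upper (e : R) : 0 < e -> \forall N \near \oo, forall z, X N z ->
  exists2 j, average_limits j & `|N%:R^-1 *: z - j| <= e.
Proof.
move=> e0; have hB := B0; pose A := [set x : M | `|x| <= 2 * B].
have cA : compact A.
  apply: closed_bounded_compact_mx.
    exists (2 * B); split => [|t ht x Ax]; first exact: num_real.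
    by apply: (le_trans _ (ltW ht)).
  move=> x /closure_norm cx; apply/ler_addgt0Pr => d d0.
  have [y Ay xy] := cx d d0.
  have -> : x = y + (x - y) by rewrite addrC subrK.
  by apply: (le_trans (ler_normD _ _)); apply: lerD => //; exact: ltW.
have := proj1 (compact_near_coveringP A) cA nat \oo (fun N y => forall z, X N z ->
   y = N%:R^-1 *: z -> exists2 j, average_limits j & `|y - j| <= e) _.
move=> cov.
have : \forall N \near \oo, A `<=` (fun y => forall z, X N z ->
   y = N%:R^-1 *: z -> exists2 j, average_limits j & `|y - j| <= e).
  apply: cov => x Ax.
  have e2 : 0 < e / 2 by rewrite divr_gt0.
  have [[j Jj xj]|noj] := pselect (exists2 j, average_limits j & `|x - j| <= e / 2).
    exists ([set y | `|x - y| < e / 2], setT); first by split; [exact: nbhs_norm_lt|exact: filterT].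
    move=> [y N] /= [xy _] z _ _; exists j => //.
    have -> : y - j = (y - x) + (x - j) by rewrite addrA subrK.
    apply: (le_trans (ler_normD _ _)); rewrite [`|y - x|]distrC.
    apply: (le_trans (lerD (ltW xy) xj)); lra.
  have nJx : ~ average_limits x.
    by move=> Jx; apply: noj; exists x => //; rewrite subrr normr0 ltW.
  have [d [N0 [d0 hd]]] : exists (d : R) N0, 0 < d /\ forall N, (N0 <= N)%N ->
      forall z, X N z -> d < `|N%:R^-1 *: z - x|.
    apply: contrapT => no; apply: nJx; apply: frequent_average_limit => d N0 d0.
    apply: contrapT => no'; apply: no; exists d, N0; split => // N NN z Xz.
    rewrite ltNge; apply/negP => h; apply: no'; exists N; split => //; by exists z.
  exists ([set y | `|x - y| < d], [set N | (N0 <= N)%N]).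
    by split; [exact: nbhs_norm_lt|exact: nbhs_infty_ge].
  move=> [y N] /= [xy NN] z Xz yz; have := hd N NN z Xz.
  by rewrite -yz distrC ltNge (ltW xy).
move=> h; have h0 := nbhs_infty_ge 1; near=> N => z Xz.
have N0 : (0 < N)%N by near: N.
have : A `<=` (fun y => forall z, X N z ->
   y = N%:R^-1 *: z -> exists2 j, average_limits j & `|y - j| <= e) by near: N.
by move=> /(_ (N%:R^-1 *: z) (average_bound N0 Xz) z Xz erefl).
Unshelve. all: by end_near.
Qed.

Lemma average_limits_nonempty : average_limits !=set0.
Proof.
have /filter_ex[N hN] := averages_upper ltr01.
by have [z Xz] := Xne N; have [j Jj _] := hN z Xz; exists j.
Qed.

Lemma averages_lower (e : R) : 0 < e -> \forall N \near \oo, forall j, average_limits j ->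
  exists2 z, X N z & `|N%:R^-1 *: z - j| <= e.
Proof.
move=> e0; have e2 : 0 < e / 2 by rewrite divr_gt0.
have := proj1 (compact_near_coveringP average_limits) average_limits_compact nat \oo
  (fun N j => exists2 z, X N z & `|N%:R^-1 *: z - j| <= e) _; apply => x Jx.
have [N0 hN0] := Jx _ e2.
exists ([set y | `|x - y| < e / 2], [set N | (N0 <= N)%N]).
  by split; [exact: nbhs_norm_lt|exact: nbhs_infty_ge].
move=> [y N] /= [xy /hN0[z Xz hz]]; exists z => //.
have -> : N%:R^-1 *: z - y = (N%:R^-1 *: z - x) + (x - y) by rewrite addrA subrK.
by apply: (le_trans (ler_normD _ _)); apply: (le_trans (lerD hz (ltW xy))); lra.
Qed.

End NearAdditiveSets.

(** The limits are compared along the multiples of [p], which suffices because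
    the averages of both families converge. *)
Lemma average_limits_near (R : realType) n (X X' : nat -> set 'M[R]_n.+1) (B M0 E : R) p :
  0 <= B -> 0 <= M0 -> (forall k, X' k !=set0) ->
  (forall k x, X' k x -> `|x| <= B * k.+1%:R) ->
  (forall p q x y, X' p x -> X' q y -> exists2 z, X' (p + q)%N z & `|z - (x + y)| <= M0) ->
  (0 < p)%N ->
  (forall q x, X (q * p)%N x -> exists2 x', X' (q * p)%N x' & `|x - x'| <= q%:R * E) ->
  forall j (e : R), 0 < e -> average_limits X j ->
    exists2 j', average_limits X' j' & `|j - j'| <= E / p%:R + e.
Proof.
move=> B0 M00 ne' b' add' p0 near j e e0 Jj.
have e2 : 0 < e / 2 by rewrite divr_gt0.
have [N0 hN0] := Jj _ e2.
have [N1 _ hN1] := averages_upper B0 M00 ne' b' add' e2.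
pose q := (N0 + N1).+1.
have qN0 : (N0 <= q * p)%N.
  by rewrite (leq_trans _ (leq_pmulr _ p0))// /q -addnS leq_addr.
have qN1 : (N1 <= q * p)%N.
  by rewrite (leq_trans _ (leq_pmulr _ p0))// /q -addSn leq_addl.
have [z Xz hz] := hN0 _ qN0.
have [z' Xz' hz'] := near q z Xz.
have [j' Jj' hj'] := hN1 _ qN1 z' Xz'; exists j' => //.
have qp : 0 < (q * p)%:R :> R by rewrite ltr0n muln_gt0 p0.
have -> : j - j' = (j - (q * p)%:R^-1 *: z) + (q * p)%:R^-1 *: (z - z') + ((q * p)%:R^-1 *: z' - j').
  by rewrite scalerBr [j - _ + _]addrA subrK [RHS]addrA subrK.
apply: (le_trans (ler_normD _ _)).
have -> : E / p%:R + e = (e / 2 + E / p%:R) + e / 2 by field; rewrite gt_eqF// ltr0n.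
apply: lerD => //; apply: (le_trans (ler_normD _ _)); apply: lerD; first by rewrite distrC.
rewrite normrZ gtr0_norm ?invr_gt0// mulrC ler_pdivrMr//; apply: (le_trans hz').
rewrite natrM; have -> : E / p%:R * (q%:R * p%:R) = q%:R * E; last by [].
by field; rewrite gt_eqF// ltr0n.
Qed.

(** * Uniformity on compact sets *)

Section CompactnessConversions.
Variables (R : realType) (n : nat).
Local Notation M := 'M[R]_n.+1.

Lemma set_pow_word (S : set M) k (x : M) : S !=set0 -> set_pow S k x ->
  exists2 h : nat -> M, (forall i, S (h i)) & x = word h 0 k.
Proof.
move=> [s Ss]; elim: k x => [|k IH] x /=.
  by move=> ->; exists (fun=> s) => //; rewrite word_nil.
move=> [y /IH[h hS ->] [z Sz <-]].
exists (fun i => if (i < k)%N then h i else z) => [i|]; first by case: ifP.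
rewrite word_rcons// ltnn; congr (_ *m _).
by apply: eq_big_nat => i /andP[_ ->].
Qed.

Lemma word_set_pow (S : set M) (h : nat -> M) k : (forall i, S (h i)) ->
  set_pow S k (word h 0 k).
Proof.
move=> hS; elim: k => [|k IH]; first by rewrite word_nil.
by rewrite word_rcons//; exists (word h 0 k) => //; exists (h k).
Qed.

Lemma word_concat (h h' : nat -> M) p q : exists2 f : nat -> M,
  forall i, f i = h i \/ exists j, f i = h' j &
  word f 0 p = word h 0 p /\ word f p (p + q) = word h' 0 q.
Proof.
exists (fun i => if (i < p)%N then h i else h' (i - p)%N) => [i|].
  by case: ifP => _; [left|right; exists (i - p)%N].
split; first by apply: eq_big_nat => i /andP[_ ->].
rewrite word_shift addKn; apply: eq_big_nat => i _.
by rewrite ltnNge leq_addl/= addnK.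
Qed.

Lemma compact_invmx_bounded (S : set M) : compact S -> S `<=` [set x | x \in unitmx] ->
  exists2 b : R, 0 <= b & forall s, S s -> `|s| <= b /\ `|invmx s| <= b.
Proof.
move=> cS Su.
have [c [_ hc]] := compact_bounded cS.
have /compact_near_coveringP := cS.
move=> /(_ nat \oo (fun N s => s \in unitmx -> `|invmx s| <= N%:R) _) [].
  move=> x /Su xu.
  set b := Num.max `|x| `|invmx x|.
  have b0 : 0 <= b by rewrite le_max normr_ge0.
  have [e e0 [_ he]] := nearby_inverse n b0.
  exists ([set y | `|x - y| < e], [set N | ((Num.truncn (2 * b + 1)).+1 <= N)%N]).
    by split => /=; [exact: nbhs_norm_lt|exact: nbhs_infty_ge].
  move=> [y N] /= [xy bN] yu.
  have [_ h] : `|y| <= 2 * b + 1 /\ `|invmx y| <= 2 * b + 1.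
    by apply: (he x y) => //; rewrite ?le_max ?lexx ?orbT// ltW.
  apply: (le_trans h); apply: (le_trans (ltW (truncnS_gt _))).
  by rewrite ler_nat.
move=> N _ hN; exists (`|c| + 1 + N%:R); first by rewrite !addr_ge0.
move=> s Ss; split.
  apply: (@le_trans _ _ (`|c| + 1)); last by rewrite lerDl.
  by apply: hc => //; rewrite (le_lt_trans (ler_norm _))// ltrDl.
apply: (@le_trans _ _ N%:R); last by rewrite lerDr addr_ge0.
by apply: (hN N (leqnn N)) => //; exact: Su.
Qed.

Variables (G : set M) (dG : M -> M -> R).
Hypotheses (hdG : is_metric_on G dG) (hdG' : induces_topology_on G dG).

(** Compactness makes uniform the local comparison of the metric with the norm,
    as for Lebesgue numbers of coverings. *)
Lemma metric_norm_uniform (S : set M) : compact S -> S `<=` G -> forall e : R, 0 < e ->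
  exists2 delta : R, 0 < delta & forall x y, S x -> G y -> dG x y < delta -> `|x - y| < e.
Proof.
move=> cS SG e e0; have [_ _ _ tri] := hdG.
have e2 : 0 < e / 2 by rewrite divr_gt0.
have [|r r0 hr] := @right_nbhs_witness R (fun r => S `<=` (fun x =>
    G x -> forall y, G y -> dG x y < r -> `|x - y| < e)); last first.
  by exists r => // x y Sx; apply: hr => //; exact: SG.
apply: (proj1 (compact_near_coveringP _) cS) => x /SG Gx.
have [d d0 hd] := (hdG' Gx [set y | `|x - y| < e / 2]).1
  (filterS (fun y h (_ : G y) => h) (nbhs_norm_lt x e2)).
have d2 : 0 < d / 2 by rewrite divr_gt0.
have U : within G (nbhs x) [set y | dG x y < d / 2].
  by apply/(hdG' Gx); exists (d / 2).
exists ([set y | G y -> dG x y < d / 2], [set r | r < d / 2]).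
  by split; [exact: U|exact: nbhs_right_lt].
move=> [x' r] /= [xx' rd] Gx' y Gy x'y.
have h1 := xx' Gx'.
have : `|x - x'| < e / 2 by apply: hd => //; lra.
have : `|x - y| < e / 2.
  apply: hd => //; apply: (le_lt_trans (tri _ _ _ Gx Gx' Gy)); lra.
have -> : x' - y = (x - y) - (x - x') by rewrite opprB [RHS]addrC addrA subrK.
move=> a1 a2; apply: (le_lt_trans (ler_normB _ _)).
by apply: (lt_le_trans (ltrD a1 a2)); lra.
Qed.

End CompactnessConversions.

Section NormOnSubspace.
Variables (R : realType) (n : nat) (a : {vspace 'M[R]_n.+1}) (N : 'M[R]_n.+1 -> R).
Hypothesis hN : is_norm_on a N.

Lemma norm_on_bounded : exists2 C : R, 0 < C & forall x, x \in a -> N x <= C * `|x|.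
Proof.
have [N0 _ NZ ND] := hN.
have coordB (i : 'I_(\dim a)) : exists2 C : R, 0 < C &
    forall x : 'M[R]_n.+1, `|coord (vbasis a) i x| <= C * `|x|.
  exact: (@linear_mx_bounded R n.+1 n.+1 R^o (coord (vbasis a) i)).
have [C hC] := choice (fun i => let: ex_intro2 c c0 h := coordB i in ex_intro _ c (conj c0 h)).
have ba (i : 'I_(\dim a)) : (vbasis a)`_i \in a by apply/vbasis_mem/mem_nth; rewrite size_tuple.
exists (1 + \sum_i C i * N (vbasis a)`_i).
  by rewrite ltr_pwDl// sumr_ge0// => i _; rewrite mulr_ge0 ?N0// ltW// (hC i).1.
move=> x xa; rewrite {1}(coord_vbasis xa).
have N00 : N 0 = 0 by rewrite -(scale0r 0) NZ ?mem0v// normr0 mul0r.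
have sumN (r : seq 'I_(\dim a)) (F : 'I_(\dim a) -> 'M[R]_n.+1) : (forall i, F i \in a) ->
    N (\sum_(i <- r) F i) <= \sum_(i <- r) N (F i).
  move=> Fa; elim: r => [|i r IH]; first by rewrite !big_nil N00.
  rewrite !big_cons; apply: (le_trans (ND _ _ (Fa i) _)); last by rewrite lerD2l.
  exact: memv_suml.
apply: (le_trans (sumN _ _ _)) => [i|]; first exact: memvZ.
apply: (@le_trans _ _ (\sum_i C i * N (vbasis a)`_i * `|x|)).
  apply: ler_sum => i _; rewrite NZ// mulrAC; apply: ler_wpM2r; first exact: N0.
  exact: (hC i).2.
by rewrite -mulr_suml; apply: ler_wpM2r => //; rewrite lerDr.
Qed.

(** Projection onto the subspace is Lipschitz. *)
Lemma subspace_closed (J : set 'M[R]_n.+1) : (forall x, J x -> forall e : R, 0 < e ->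
  exists2 y, y \in a & `|y - x| <= e) -> J `<=` [set x | x \in a].
Proof.
move=> h x Jx.
have [C C0 hC] := linear_mx_bounded [the {linear 'M[R]_n.+1 -> 'M[R]_n.+1} of fun_of_lfun (projv a)].
suff : `|x - projv a x| <= 0.
  by rewrite normr_le0 subr_eq0 => /eqP ->; exact: memv_proj.
apply/ler_addgt0Pr => e e0; rewrite add0r.
have d0 : 0 < e / (1 + C) by rewrite divr_gt0// addr_gt0.
have [y ya yx] := h x Jx _ d0.
have -> : x - projv a x = projv a (y - x) - (y - x).
  rewrite linearB/= (projv_id ya); move: (projv a x) => u.
  by apply/matrixP => i j; rewrite !mxE; ring.
apply: (le_trans (ler_normB _ _)); apply: (le_trans (lerD (hC _) (lexx _))).
rewrite -[X in _ + X]mul1r -mulrDl addrC.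
apply: (@le_trans _ _ ((1 + C) * (e / (1 + C)))).
  by apply: ler_wpM2l => //; rewrite addr_ge0// ltW.
by rewrite mulrC divfK// gt_eqF// addr_gt0.
Qed.

End NormOnSubspace.

Section Torus.
Variables (R : realType) (n : nat).
Local Notation M := 'M[R]_n.+1.

(** Being diagonal in a given basis is a linear condition, so it passes from a
    group to its Lie algebra. *)
Lemma lie_algebra_diag (A : set M) (a : {vspace M}) (Q : M) : Q \in unitmx ->
  is_lie_algebra A a -> (forall x, A x -> diag_in Q x) -> forall x, x \in a -> diag_in Q x.
Proof.
move=> Qu ha hA x /ha hx.
pose f (X : M) : M := \matrix_(i, j) (if i == j then 0 else coo Q X i j).
have fl : linear f.
  move=> s X Y; apply/matrixP => i j.
  rewrite [LHS]mxE [RHS]mxE [X in _ = X + _]mxE [X in _ = _ * X + _]mxE [X in _ = _ + X]mxE.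
  by case: ifP => _; rewrite ?mulr0 ?addr0// cooDe cooZe.
pose F : {linear M -> M} := HB.pack f (GRing.isLinear.Build R M M *:%R f fl).
suff f0 : F x = 0.
  apply/is_diag_mxP => i j ij; have /matrixP/(_ i j) := f0.
  by rewrite mxE [RHS]mxE ifN.
apply: tangent_linear => t; apply/matrixP => i j; rewrite mxE [RHS]mxE.
case: eqVneq => // ij; rewrite cooBe.
have /is_diag_mxP := hA _ (hx t); rewrite -/(coo _ _) => -> //.
have -> : coo Q 1 = 1 by rewrite /coo mulmx1 mulmxV.
by rewrite mxE (negbTE ij) subrr.
Qed.

Variables (a : {vspace M}) (P : set (dual a)) (Q : M).

(** Depth is governed by finitely many combinations of weights and varies
    continuously. *)
Lemma compact_gapped (C : set M) : compact C -> C `<=` open_chamber P ->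
  exists2 c : R, 0 < c & forall x, C x -> gapped Q P x c.
Proof.
move=> cC CP; have [L L0 hL] := gapped_near Q P.
apply: (@right_nbhs_witness R (fun c => C `<=` (fun x => gapped Q P x c))).
apply: (proj1 (compact_near_coveringP _) cC) => x Cx.
have [|mm|s s0 hs] := @fin_uniform R ({ffun 'I_n.+1 -> 'I_n.+2} * {ffun 'I_n.+1 -> 'I_n.+2})%type
  (fun mm s => (forall z, open_chamber P z -> 0 < weight_diff Q mm.1 mm.2 z) ->
     expR (- s) <= weight_diff Q mm.1 mm.2 x).
- by move=> i s t st h /h; apply: le_trans; rewrite ler_expR lerN2.
- have [pos|] := pselect (forall z, open_chamber P z -> 0 < weight_diff Q mm.1 mm.2 z); last by exists 0.
  exists (- ln (weight_diff Q mm.1 mm.2 x)) => _; rewrite opprK lnK// posrE.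
  exact/pos/CP.
have gx : gapped Q P x (expR (- s)) by move=> m m'; exact: (hs (m, m')).
have e0 := expR_gt0 (- s); move: (expR (- s)) gx e0 => t gx t0.
have t2 : 0 < t / 2 by rewrite divr_gt0.
have L1 : 0 < L + 1 by rewrite ltr_wpDl.
exists ([set y | `|x - y| < t / 2 / (L + 1)], [set r | r < t / 2]).
  by split => /=; [apply: nbhs_norm_lt; rewrite divr_gt0|exact: nbhs_right_lt].
move=> [y r] /= [xy rt]; apply: gapped_le (hL _ y _ gx).
have : L * `|y - x| <= t / 2.
  rewrite distrC; apply: (@le_trans _ _ ((L + 1) * (t / 2 / (L + 1)))).
    by apply: ler_pM => //; [rewrite lerDl|exact: ltW].
  by rewrite mulrC divfK// gt_eqF.
lra.
Qed.

End Torus.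

(** * Joint spectra *)

Section JointSpectra.
Variables (R : realType) (n : nat).
Local Notation M := 'M[R]_n.+1.
Variables (G : set M) (a : {vspace M}) (kappa : M -> M) (N : M -> R).
Hypothesis cG : closed_subgroup_GL G.
Hypothesis hN : is_norm_on a N.
Hypothesis kappa_a : forall x, G x -> kappa x \in a.

Definition cartan_image (S : set M) (k : nat) : set M := [set kappa x | x in set_pow S k].

(** Uniform linear growth and additivity, up to bounded errors, of the Cartan
    projections of the powers of [S]. *)
Definition near_additive_set (B M0 : R) (S : set M) := [/\ S !=set0, S `<=` G,
  forall h k, (forall i, S (h i)) -> `|kappa (word h 0 k)| <= B * k.+1%:R &
  forall h m k, (forall i, S (h i)) -> (m <= k)%N ->
    `|kappa (word h 0 k) - (kappa (word h 0 m) + kappa (word h m k))| <= M0].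

Section OneSet.
Variables (B M0 : R) (S : set M).
Hypotheses (B0 : 0 <= B) (M00 : 0 <= M0) (nS : near_additive_set B M0 S).

Lemma cartan_image_nonempty k : cartan_image S k !=set0.
Proof.
have [[s Ss] _ _ _] := nS; exists (kappa (word (fun=> s) 0 k)).
by exists (word (fun=> s) 0 k) => //; exact: word_set_pow.
Qed.

Lemma cartan_image_word k x : cartan_image S k x ->
  exists2 h, (forall i, S (h i)) & x = kappa (word h 0 k).
Proof.
have [S0 _ _ _] := nS.
by move=> [y /(set_pow_word S0)[h hS ->] <-]; exists h.
Qed.

Lemma cartan_image_in k x : cartan_image S k x -> x \in a.
Proof.
have [_ SG _ _] := nS.
by move=> /cartan_image_word[h hS ->]; apply/kappa_a/(word_in cG) => // i; exact: SG.
Qed.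

Lemma cartan_image_bound k x : cartan_image S k x -> `|x| <= B * k.+1%:R.
Proof. by have [_ _ h _] := nS; move=> /cartan_image_word[f fS ->]; exact: h. Qed.

Lemma cartan_image_add p q x y : cartan_image S p x -> cartan_image S q y ->
  exists2 z, cartan_image S (p + q)%N z & `|z - (x + y)| <= M0.
Proof.
have [_ _ _ add] := nS.
move=> /cartan_image_word[h hS ->] /cartan_image_word[h' hS' ->].
have [f hf [e1 e2]] := word_concat h h' p q.
have fS i : S (f i) by have [->|[j ->]] := hf i.
exists (kappa (word f 0 (p + q))); first by exists (word f 0 (p + q)) => //; exact: word_set_pow.
by rewrite -e1 -e2; apply: add => //; exact: leq_addr.
Qed.

Lemma joint_spectrum_average_limits :
  is_joint_spectrum a kappa N S (average_limits (cartan_image S)).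
Proof.
have ne := cartan_image_nonempty; have bd := cartan_image_bound.
have ad := cartan_image_add.
have Ja : average_limits (cartan_image S) `<=` [set x | x \in a].
  apply: subspace_closed => x Jx e e0; have [N0 hN0] := Jx e e0.
  have [z Xz hz] := hN0 N0 (leqnn _); exists (N0%:R^-1 *: z) => //.
  by apply: memvZ; exact: cartan_image_in Xz.
have scaled k x : scaled_cartan kappa S k x <->
    exists2 z, cartan_image S k z & x = k%:R^-1 *: z.
  split=> [[y Sy <-]|[z [y Sy <-] ->]]; last by exists y.
  by exists (kappa y) => //; exists y.
have scaled_a k x : scaled_cartan kappa S k x -> x \in a.
  by move=> /scaled[z Xz ->]; apply: memvZ; exact: cartan_image_in Xz.
split=> //.
- exact: (average_limits_compact B0 bd).
- exact: (average_limits_nonempty B0 M00 ne bd ad).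
have [C C0 hC] := norm_on_bounded hN.
have [N0 _ _ _] := hN.
apply: hausdorff_dist_cvg0 => [k|k x y /scaled_a xa /Ja ya|e e0].
- by have [z Xz] := ne k; exists (k%:R^-1 *: z); apply/scaled; exists z.
- by apply: N0; exact: memvB.
have e1 : 0 < e / C by rewrite divr_gt0.
have NC x y : x \in a -> y \in a -> `|x - y| <= e / C -> norm_dist N x y <= e.
  move=> xa ya xy; apply: (le_trans (hC _ (memvB xa ya))).
  by rewrite mulrC -ler_pdivlMr.
near=> k; split => [x sx|j Jj].
  have [z Xz xE] := (scaled k x).1 sx.
  have [j Jj hj] : exists2 j, average_limits (cartan_image S) j & `|k%:R^-1 *: z - j| <= e / C.
    move: z Xz {xE}; near: k; exact: (averages_upper B0 M00 ne bd ad e1).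
  by exists j => //; apply: NC; rewrite ?xE//; [rewrite -xE; exact: scaled_a sx|exact: Ja].
have [z Xz hz] : exists2 z, cartan_image S k z & `|k%:R^-1 *: z - j| <= e / C.
  move: j Jj; near: k; exact: (averages_lower B0 bd e1).
have sz : scaled_cartan kappa S k (k%:R^-1 *: z) by apply/scaled; exists z.
by exists (k%:R^-1 *: z) => //; apply: NC => //; [exact: scaled_a sz|exact: Ja].
Unshelve. all: by end_near.
Qed.

End OneSet.

(** Words in nearby letters have close Cartan projections at the scale of
    blocks of length [p], hence close averages. *)
Lemma nearby_average_limits (B M0 Mp e : R) p (S S' : set M) :
  0 <= B -> 0 <= M0 ->
  near_additive_set B M0 S -> near_additive_set B M0 S' -> (0 < p)%N ->
  (forall s, S s -> exists2 s', S' s' & `|s - s'| <= e) ->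
  (forall h h', (forall i, S (h i)) -> (forall i, S' (h' i)) ->
    (forall i, `|h i - h' i| <= e) -> `|kappa (word h 0 p) - kappa (word h' 0 p)| <= Mp) ->
  forall j (d : R), 0 < d -> average_limits (cartan_image S) j ->
    exists2 j', average_limits (cartan_image S') j' & `|j - j'| <= (2 * M0 + Mp) / p%:R + d.
Proof.
move=> B0 M00 nS nS' p0 SS' close j d d0.
apply: (average_limits_near B0 M00 (cartan_image_nonempty nS') (cartan_image_bound nS')
  (cartan_image_add nS') p0 _ d0) => q _ /(cartan_image_word nS)[h hS ->].
have [h' hh'] := choice (fun i => let: ex_intro2 s Ss ss := SS' _ (hS i) in ex_intro _ s (conj Ss ss)).
have hS' i : S' (h' i) by case: (hh' i).
have hc i : `|h i - h' i| <= e by case: (hh' i).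
exists (kappa (word h' 0 (q * p))).
  by exists (word h' 0 (q * p)) => //; exact: word_set_pow.
have [_ _ _ add] := nS; have [_ _ _ add'] := nS'.
elim: q => [|q IH]; first by rewrite !mul0n !word_nil subrr normr0 mul0r.
have le : (q * p <= q.+1 * p)%N by rewrite leq_mul2r leqnSn orbT.
have bl : `|kappa (word h (q * p) (q.+1 * p)) - kappa (word h' (q * p) (q.+1 * p))| <= Mp.
  rewrite !(word_shift _ (q * p)) mulSn addnK.
  by apply: close => i; [exact: hS|exact: hS'|exact: hc].
have A1 := add h _ _ hS le; have A2 := add' h' _ _ hS' le.
move: bl A1 A2 IH; move: (kappa (word h 0 (q * p))) (kappa (word h' 0 (q * p))) => u u'.
move: (kappa (word h (q * p) _)) (kappa (word h' (q * p) _)) => v v'.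
move: (kappa (word h 0 _)) (kappa (word h' 0 _)) => w w' bl A1 A2 IH.
have -> : w - w' = (w - (u + v)) - (w' - (u' + v')) + (u - u') + (v - v').
  by apply/matrixP => i l; rewrite !mxE; ring.
have -> : q.+1%:R * (2 * M0 + Mp) = M0 + M0 + q%:R * (2 * M0 + Mp) + Mp by rewrite -natr1; ring.
apply: (le_trans (ler_normD _ _)); apply: lerD => //.
apply: (le_trans (ler_normD _ _)); apply: lerD => //.
by apply: (le_trans (ler_normB _ _)); exact: lerD.
Qed.

End JointSpectra.

Theorem theorem1p7 (R : realType) (n : nat)
    (GG : set 'M[complex.complex R]_n.+1)
    (hGG : reductive_group_over_R GG)
    (G : set 'M[R]_n.+1) (hG : G = real_component GG)
    (T : set 'M[complex.complex R]_n.+1)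
    (hT : maximal_split_torus GG T)
    (A : set 'M[R]_n.+1) (hA : A = real_component T)
    (g : {vspace 'M[R]_n.+1}) (hg : is_lie_algebra G g)
    (a : {vspace 'M[R]_n.+1}) (ha : is_lie_algebra A a)
    (K : set 'M[R]_n.+1) (hK : maximal_compact_subgroup G K)
    (hKa : killing_orthogonal g K a)
    (P : set (dual a)) (hP : positive_system g P)
    (kappa : 'M[R]_n.+1 -> 'M[R]_n.+1)
    (hkappa : cartan_projection G K P kappa)
    (dG : 'M[R]_n.+1 -> 'M[R]_n.+1 -> R)
    (hdG : is_metric_on G dG) (hdG' : induces_topology_on G dG)
    (N : 'M[R]_n.+1 -> R) (hN : is_norm_on a N)
    (S : set 'M[R]_n.+1) (hSG : S `<=` G) (hS0 : S !=set0)
    (hSc : compact S) (hSd : dominated P kappa S) :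
  exists J : set 'M[R]_n.+1, is_joint_spectrum a kappa N S J /\
    forall eps : R, 0 < eps ->
      exists2 delta : R, 0 < delta &
        forall S' : set 'M[R]_n.+1, S' `<=` G -> S' !=set0 -> compact S' ->
          (hausdorff_dist dG S S' < delta%:E)%E ->
          exists J' : set 'M[R]_n.+1,
            is_joint_spectrum a kappa N S' J' /\
            (hausdorff_dist (norm_dist N) J J' < eps%:E)%E.
Proof.
have [[algG _] [splitT TG _]] := (hGG, hT).
have cG : closed_subgroup_GL G by rewrite hG; exact: real_component_closed_subgroup.
have Gconn : connected G by rewrite hG; exact: component_connected.
have [Gu G1 GM GV _] := cG.
have [Q Qu TQ] := split_torus_diag splitT.
have aQ : forall x, x \in a -> diag_in Q x.
  apply: lie_algebra_diag Qu ha _ => x; rewrite hA => Ax; apply: TQ.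
  exact: connected_component_sub Ax.
have ag : (a <= g)%VS.
  apply/subvP => x /ha xa; apply/hg => t.
  by rewrite hG; apply: (real_component_sub (proj1 splitT) TG); rewrite -hA; exact: xa.
have [[cK KG K1 KM KV] _] := hK.
have [bK [_ hbK]] := compact_bounded cK.
have Kb k : K k -> `|k| <= `|bK| + 1.
  by move=> Kk; apply: hbK => //; rewrite (le_lt_trans (ler_norm _))// ltrDl.
have kappaP x : G x -> closed_chamber P (kappa x) /\ in_KexpK K x (kappa x).
  by move=> /hkappa[].
have kappa_a x : G x -> kappa x \in a by move=> /kappaP[[]].
have [C [cC CP /= [k0 _ hk0]]] := hSd.
have [z0 z0P] : exists z0, open_chamber P z0.
  have [s Ss] := hS0; exists (k0%:R^-1 *: kappa (word (fun=> s) 0 k0)).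
  apply/CP/(hk0 k0 (leqnn _)); exists (word (fun=> s) 0 k0) => //.
  exact: word_set_pow.
have [L L0 hL] := gapped_near Q P.
have pert := kappa_perturb cG hg Gconn Qu ag aQ hP z0P KG KV Kb kappaP.
have nadd := kappa_near_additive cG hg Gconn Qu ag aQ hP z0P KG KV Kb kappaP.
have [b b0 Sb] := compact_invmx_bounded hSc (subset_trans hSG Gu).
have [c0 c00 hc0] := compact_gapped Q cC CP.
pose C2 := c0 * k0.+1%:R.
have C20 : 0 <= C2 by rewrite mulr_ge0// ltW.
have Sgap h : (forall i, S (h i)) -> forall k, gapped Q P (kappa (word h 0 k)) (c0 * k%:R - C2).
  move=> hS k; have Gw : G (word h 0 k) by apply: (word_in cG) => // i; exact: hSG.
  have [k_le|k_gt] := leqP k k0.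
    apply: gapped_le (gapped0 z0P (kappaP _ Gw).1).
    by rewrite subr_le0 ler_wpM2l// ?ler_nat ?ltW// leqW.
  have kR : 0 < k%:R :> R by rewrite ltr0n (leq_ltn_trans _ k_gt).
  have gC : gapped Q P (k%:R^-1 *: kappa (word h 0 k)) c0.
    apply: hc0; apply: (hk0 k (ltnW k_gt)); exists (word h 0 k) => //.
    exact: word_set_pow.
  have := gappedZ (ltW kR) gC; rewrite scalerA mulfV ?gt_eqF// scale1r.
  by apply: gapped_le; rewrite mulrC lerBlDr lerDl.
have [c [C1 [e1 [c_gt0 e10 near_gap]]]] := nearby_gap cG L0 (@gapped_le _ _ _ Q P)
  (@gappedD _ _ _ Q P) hL pert nadd hSG b0 c00 C20 Sb Sgap.
have [M0 M00 hM0] := nadd (2 * b + 1) c C1 c_gt0.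
have [Mb Mb0 hMb] := pert (2 * b + 1).
have [Mp Mp0 hMp] := nearby_words cG pert hSG b0 Sb.
pose B := Num.max `|kappa 1| Mb.
have B0 : 0 <= B by rewrite le_max normr_ge0.
have nearS S' : S' !=set0 -> S' `<=` G ->
    (forall s', S' s' -> exists2 s, S s & `|s - s'| <= e1) ->
    near_additive_set G kappa B M0 S'.
  move=> S'0 S'G close; split => // [h k hS'|h m k hS' mk].
    have hGi i : G (h i) by exact: S'G.
    have [hb _] := near_gap h hGi (fun i => close _ (hS' i)).
    elim: k => [|k IH].
      by rewrite word_nil mulr1 le_max lexx.
    rewrite word_rcons//.
    have -> : kappa (word h 0 k *m h k) =
        kappa (word h 0 k) + (kappa (word h 0 k *m h k) - kappa (word h 0 k)).
      by rewrite addrC subrK.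
    rewrite -natr1 mulrDr mulr1; apply: (le_trans (ler_normD _ _)); apply: lerD => //.
    apply: (@le_trans _ _ Mb); last by rewrite le_max lexx orbT.
    by apply: hMb; rewrite ?(hb k).1 ?(hb k).2//; exact: (word_in cG).
  have hGi i : G (h i) by exact: S'G.
  have [hb _] := near_gap h hGi (fun i => close _ (hS' i)).
  apply: hM0 => // [i|i|p q /andP[pq _]]; [exact: (hb i).1|exact: (hb i).2|].
  rewrite word_shift; have [_ hgap] := near_gap (fun i => h (i + p)%N)
    (fun i => hGi _) (fun i => close _ (hS' _)).
  exact: hgap.
have nS : near_additive_set G kappa B M0 S.
  by apply: nearS => // s Ss; exists s; rewrite ?subrr ?normr0 ?ltW.
exists (average_limits (cartan_image kappa S)); split.
  exact: (joint_spectrum_average_limits cG hN kappa_a B0 M00 nS).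
move=> eps eps0.
have [CN CN0 hCN] := norm_on_bounded hN.
pose d := eps / 4 / CN.
have d0 : 0 < d by rewrite !divr_gt0.
(* The limits are compared through blocks of length [p], with an error at most [d]. *)
pose p := (Num.truncn ((2 * M0 + Mp) / d)).+1.
have p0 : (0 < p)%N by [].
have hp : (2 * M0 + Mp) / p%:R <= d.
  rewrite ler_pdivrMr ?ltr0n// [leRHS]mulrC -ler_pdivrMr//; apply: ltW; exact: truncnS_gt.
have [e2 e20 he2] := hMp p.
pose e := Num.min e1 e2.
have e0 : 0 < e by rewrite lt_min e10.
have [delta delta0 hdelta] := metric_norm_uniform hdG hdG' hSc hSG e0.
exists delta => // S' S'G S'0 S'c /hausdorff_dist_lt[dSS' dS'S].
have SS' s : S s -> exists2 s', S' s' & `|s - s'| <= e.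
  move=> Ss; have [s' Ss' ss'] := dSS' s Ss; exists s' => //.
  by apply/ltW/hdelta => //; exact: S'G.
have S'S s' : S' s' -> exists2 s, S s & `|s - s'| <= e.
  move=> Ss'; have [s Ss ss'] := dS'S s' Ss'; exists s => //.
  by apply/ltW/hdelta => //; exact: S'G.
have nS' : near_additive_set G kappa B M0 S'.
  apply: nearS => // s' /S'S[s Ss ss']; exists s => //.
  by apply: (le_trans ss'); rewrite ge_min lexx.
exists (average_limits (cartan_image kappa S')).
have JS := joint_spectrum_average_limits cG hN kappa_a B0 M00 nS.
have JS' := joint_spectrum_average_limits cG hN kappa_a B0 M00 nS'.
split => //.
have [_ _ Ja _] := JS; have [_ _ Ja' _] := JS'.
have close h h' : (forall i, S (h i)) -> (forall i, S' (h' i)) ->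
    (forall i, `|h i - h' i| <= e) -> `|kappa (word h 0 p) - kappa (word h' 0 p)| <= Mp.
  move=> hS hS' hh'; rewrite distrC; apply: he2 => // [i|i]; first exact: S'G.
  by apply: (le_trans (hh' i)); rewrite ge_min lexx orbT.
have N_le x y : average_limits (cartan_image kappa S) x ->
    average_limits (cartan_image kappa S') y ->
    `|x - y| <= (2 * M0 + Mp) / p%:R + d -> norm_dist N x y <= eps / 2.
  move=> Jx Jy xy; apply: (le_trans (hCN _ (memvB (Ja _ Jx) (Ja' _ Jy)))).
  apply: (@le_trans _ _ (CN * (2 * d))).
    apply: ler_wpM2l; first exact: ltW.
    by apply: (le_trans xy); rewrite (_ : 2 * d = d + d) ?lerD2r//; ring.
  by rewrite le_eqVlt /d; apply/orP; left; apply/eqP; field; rewrite gt_eqF.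
apply: (@le_lt_trans _ _ (eps / 2)%:E); last by rewrite lte_fin ltr_pdivrMr// ltr_pMr// ltr1n.
apply: hausdorff_dist_le => [x Jx|y Jy].
  have [y Jy xy] := nearby_average_limits B0 M00 nS nS' p0 SS' close d0 Jx.
  by exists y => //; exact: N_le.
have S'S' s' : S' s' -> exists2 s, S s & `|s' - s| <= e.
  by move=> /S'S[s Ss ss']; exists s; rewrite // distrC.
have close' h' h : (forall i, S' (h' i)) -> (forall i, S (h i)) ->
    (forall i, `|h' i - h i| <= e) -> `|kappa (word h' 0 p) - kappa (word h 0 p)| <= Mp.
  move=> hS' hS hh'; rewrite distrC; apply: close => // i; by rewrite distrC.
have [x Jx xy] := nearby_average_limits B0 M00 nS' nS p0 S'S' close' d0 Jy.
by exists x => //; apply: N_le; rewrite // distrC.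
Qed.
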